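(* There exists a universal constant $C>0$ such that for all $\lambda>1$ and all $\delta>0$ sufficiently small depending only on $\lambda$ the following holds: If $|B_r(0)\setminus\Omega|=0$ for a set $\Omega\subset\mathbb R^2$ of finite perimeter and some $r\ge C\delta^{\frac{\lambda-1}{\lambda}}$, then there exist a set $\widetilde\Omega\subset\mathbb R^2$ and $\tilde r>0$ such that $$|\Omega|=|\widetilde\Omega|+|B_{\tilde r}(0)|,$$ $$E_{\lambda,\delta}(\Omega)>E_{\lambda,\delta}(\widetilde\Omega)+E_{\lambda,\delta}(B_{\tilde r}(0)).$$
   Context: $P$ is the De Giorgi perimeter in $\mathbb R^2$, $|\cdot|$ is Lebesgue measure, $B_r(x)$ is the disk of radius $r$ centered at $x$. For $\lambda>0$ and $0<\delta<\frac12$, $$E_{\lambda,\delta}(\Omega):=P(\Omega)-\frac{\lambda}{4|\log\delta|}\int_{\mathbb R^2}\int_{\mathbb R^2}|\chi_\Omega(x+z)-\chi_\Omega(x)|^2\,\frac{g_\delta(|z|)}{|z|^3}\,\mathrm dz\,\mathrm dx,$$ with $g_\delta(r):=g(r/\delta)$, $g:=\chi_{(1,\infty)}$. ''Universal'' means independent of all parameters. *)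

(* Defs.v *)
From HB Require Import structures.
From mathcomp Require Import all_boot all_order all_algebra.
From mathcomp Require Import all_classical all_reals all_analysis.

Set Implicit Arguments.
Unset Strict Implicit.
Unset Printing Implicit Defensive.

Import Order.TTheory GRing.Theory Num.Theory.
Import numFieldNormedType.Exports.

Local Open Scope classical_set_scope.
Local Open Scope ring_scope.

Section plane.
Variable R : realType.

(* The canonical norm of [R * R] in the library is the max norm. *)
Definition enorm (x : R * R) : R := Num.sqrt (x.1 ^+ 2 + x.2 ^+ 2).

Definition disk (x : R * R) (r : R) : set (R * R) :=
  [set y | enorm (y - x) < r].

(* The product measure lives on the Borel (product) sigma-algebra; its
   completion [leb2] lives on the sigma-algebra of Lebesgue measurable sets,
   which are the measurable sets of [Leb2], a copy of the type [R * R]. *)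
Definition leb_prod :
    {measure set (measurableTypeR R * measurableTypeR R) -> \bar R} :=
  (@lebesgue_measure R \x @lebesgue_measure R)%E.

Definition Leb2 : measurableType _ := caratheodory_type (leb_prod^*)%mu.

Definition leb2 : {measure set Leb2 -> \bar R} :=
  @completed_measure_extension _ _ _ leb_prod.

Definition lmeasurable (A : set (R * R)) : Prop := measurable (A : set Leb2).

Definition C1 (phi : R * R -> R * R) : Prop :=
  (forall x, differentiable phi x) /\
  (forall v : R * R, continuous (fun x => 'D_v phi x)).

Definition compactly_supported (phi : R * R -> R * R) : Prop :=
  compact (closure [set x | phi x != 0]).

Definition divergence (phi : R * R -> R * R) (x : R * R) : R :=
  ('D_((1, 0) : R * R) phi x).1 + ('D_((0, 1) : R * R) phi x).2.

Definition perimeter (Omega : set (R * R)) : \bar R :=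
  ereal_sup [set (\int[leb2]_(x in (Omega : set Leb2))
                     (divergence phi x)%:E)%E
            | phi in [set phi | [/\ C1 phi, compactly_supported phi
                                  & forall x, enorm (phi x) <= 1]]].

Definition finite_perimeter (Omega : set (R * R)) : Prop :=
  lmeasurable Omega /\ (perimeter Omega < +oo)%E.

Definition cutoff (delta r : R) : R :=
  \1_(`]1, +oo[ : set R) (r / delta).

Definition nonlocal (delta : R) (Omega : set (R * R)) : \bar R :=
  (\int[leb2]_x \int[leb2]_z
     (`|\1_Omega ((x : R * R) + (z : R * R)) - \1_Omega (x : R * R)| ^+ 2
      * (cutoff delta (enorm z) / enorm z ^+ 3))%:E)%E.

(* Only meaningful on sets of finite perimeter. *)
Definition energy (lambda delta : R) (Omega : set (R * R)) : \bar R :=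
  (perimeter Omega
   - (lambda / (4 * `|ln delta|))%:E * nonlocal delta Omega)%E.

End plane.

(* Main.v *)
Require Import Defs.
From HB Require Import structures.
From mathcomp Require Import all_boot all_order all_algebra.
From mathcomp Require Import all_classical all_reals all_analysis.
From mathcomp Require Import measurable_realfun measurable_structure ring lra.
Import Order.TTheory GRing.Theory Num.Theory.
Import numFieldNormedType.Exports.
Local Open Scope classical_set_scope.
Local Open Scope ring_scope.

Set Implicit Arguments.
Unset Strict Implicit.
Unset Printing Implicit Defensive.

(* Up to a null set [Omega] contains the disk of radius [2 rho], where
   [rho = 2 e^2 delta^((lambda - 1) / lambda)]; move the disk [B] of radius [rho]
   far away. The perimeter grows by at most [2 P(B) <= 4 pi rho]. For
   [2 delta < |z| < rho] every shift pair [x, x + z] crossing the circle counts once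
   for [Omega \ B] and once for [B] but not for [Omega], so the nonlocal integral
   grows by at least [4 int_(2 delta < |z| < rho) |B \ (B - z)| / |z|^3], where the
   lune [B \ (B - z)] has area at least [|z| (2 rho - |z|)]; this is at least
   [8 pi rho (2 ln (rho / (2 delta)) - 3)]. By the choice of [rho],
   [ln (rho / (2 delta)) = 2 + |ln delta| / lambda], and the gain beats the loss.
   Comparing energies requires finite nonlocal integrals even when [|Omega|] is
   infinite. Since the kernel is integrable away from the origin, this follows from a
   bound on [|Omega triangle (Omega - h)|] uniform in [h]: testing the perimeter with
   antiderivatives of difference quotients yields a bound linear in [|h|], and an
   isoperimetric argument applied to the shift differences makes it uniform. *)

(** The exponent [(lambda - 1) / lambda] is critical: the leading part of the nonlocal gain,
    [lambda / (4 |ln delta|)] times [16 pi rho |ln delta| / lambda], equals the perimeter loss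
    [4 pi rho] exactly. The next order decides, and the factor [e^2] in [rho] makes the remaining
    surplus [2 pi rho lambda / |ln delta|] positive. Hence the lune area and the perimeter of the
    disk need sharp leading constants, while the additive constant 3 may be crude. The two energies
    are added separately, so no interaction between the separated pieces has to be estimated. The
    measure [leb2] is complete, whereas Tonelli, shears and rotations act on the Borel product
    measure; [Omega] is therefore replaced by a Borel set that contains both it and the disk and
    differs from it by a null set. Polar coordinates are avoided: the disk is sliced along both
    axes, and the radial integral is bounded by a sum over geometric annuli. The perimeter is a
    supremum over C1 fields, so translations are controlled by exhibiting fields instead of
    smoothing [Omega]. *)

Definition plane_leb (R : realType) :
  set (measurableTypeR R * measurableTypeR R) -> \bar R := leb_prod R.

HB.instance Definition _ (R : realType) :=
  Measure.copy (@plane_leb R) (Measure.clone _ _ _ (leb_prod R) _).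

(** Tonelli asks for this instance, which the named copy [plane_leb] of [leb_prod] carries. The
    pieces exhausting the line increase, so their squares exhaust the plane. *)
Lemma plane_leb_sigma_finite (R : realType) : sigma_finite setT (@plane_leb R).
Proof.
have /sigma_finiteP[F [TF ndF Foo]] := sigma_finiteT (@lebesgue_measure R).
exists (fun n => F n `*` F n).
  rewrite -setXTT {1}TF {1}TF predeqE => -[x y]; split.
    move=> [/= [n _ Fnx] [k _ Fky]]; exists (maxn n k) => //; split.
    - by move: x Fnx; exact/subsetPset/ndF/leq_maxl.
    - by move: y Fky; exact/subsetPset/ndF/leq_maxr.
  by move=> [n _ []/= ? ?]; split; exists n.
move=> k; have [mF Fk] := Foo k; split; first exact: measurableX.
rewrite [ltLHS](_ : _ = lebesgue_measure (F k) * lebesgue_measure (F k))%E.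
  by rewrite lte_mul_pinfty// ge0_fin_numE.
exact: product_measure1E.
Qed.

HB.instance Definition _ (R : realType) :=
  Measure_isSigmaFinite.Build _ _ _ (@plane_leb R) (@plane_leb_sigma_finite R).

(** * Lebesgue measure on the plane *)

Section plane_measure.
Context {R : realType}.
Local Notation BR := (measurableTypeR R).
Local Notation leb := (@lebesgue_measure R).
Local Notation mu := (@plane_leb R).

(** Half-open intervals determine the Lebesgue measure, and the pushforward by a translation gives
    them the right length. *)
Lemma lebesgue_measure_translate (c : R) (A : set R) : measurable A ->
  leb ((fun x => x + c) @^-1` A) = leb A.
Proof.
move=> mA.
have mf : measurable_fun setT (fun x : BR => (x + c : BR)).
  exact: measurable_funD.
rewrite -[LHS]/(pushforward leb (fun x : BR => (x + c : BR)) A).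
apply/esym/lebesgue_measure_unique => //= _ [[a b]] _ <-.
rewrite /pushforward.
have -> : (fun x => x + c) @^-1` `]a, b] = `](a - c), (b - c)]%classic.
  by apply/seteqP; split => x /=; rewrite !in_itv /= ltrBlDr lerBrDr.
rewrite /= !lebesgue_measure_itv/= !lte_fin ltrD2r -!EFinB.
by case: ifP => // _; congr (_%:E); ring.
Qed.

(** The product measure is defined through vertical sections; shears and slices along the first axis
    need the horizontal ones. *)
Lemma plane_leb2E (A : set (BR * BR)) : measurable A -> mu A = (leb \x^ leb)%E A.
Proof.
move=> mA; apply: product_measure_unique => // B C mB mC /=.
by rewrite product_measure2E.
Qed.

(** Every horizontal section is merely translated. Shears are the building blocks below: two compose
    to a translation, three to a rotation. *)
Lemma plane_leb_shear1 (f : BR -> BR) (A : set (BR * BR)) :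
  measurable_fun setT f -> measurable A ->
  mu ((fun x => (x.1 + f x.2, x.2)) @^-1` A) = mu A.
Proof.
move=> mf mA.
have mT : measurable_fun setT (fun x : BR * BR => ((x.1 + f x.2 : BR), (x.2 : BR))).
  apply: measurable_fun_pair; last exact: measurable_snd.
  by apply: measurable_funD => //; exact: measurableT_comp.
have mTA : measurable ((fun x : BR * BR => ((x.1 + f x.2 : BR), (x.2 : BR))) @^-1` A).
  by rewrite -[_ @^-1` _]setTI; exact: mT.
rewrite (plane_leb2E mA) (plane_leb2E mTA).
apply: eq_integral => y _ /=.
rewrite -(lebesgue_measure_translate (f y) (measurable_ysection y mA)).
congr (leb _); apply/seteqP; split => x /=; rewrite /ysection /= !inE //.
Qed.

Lemma plane_leb_shear2 (f : BR -> BR) (A : set (BR * BR)) :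
  measurable_fun setT f -> measurable A ->
  mu ((fun x => (x.1, x.2 + f x.1)) @^-1` A) = mu A.
Proof.
move=> mf mA.
apply: eq_integral => x _ /=.
rewrite -(lebesgue_measure_translate (f x) (measurable_xsection x mA)).
congr (leb _); apply/seteqP; split => y /=; rewrite /xsection /= !inE //.
Qed.

End plane_measure.

Lemma ge0_integral_measure_preserving d d' (X : measurableType d)
    (Y : measurableType d') (R : realType) (m : {measure set X -> \bar R})
    (m' : {measure set Y -> \bar R}) (phi : X -> Y) (f : Y -> \bar R) :
  measurable_fun setT phi ->
  (forall A, measurable A -> m (phi @^-1` A) = m' A) ->
  measurable_fun setT f -> (forall y, 0 <= f y)%E ->
  (\int[m]_x f (phi x) = \int[m']_y f y)%E.
Proof.
move=> mphi mm' mf f0.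
rewrite -[LHS]/(\int[m]_(x in phi @^-1` setT) (f \o phi) x)%E.
rewrite -ge0_integral_pushforward//.
by apply: eq_measure_integral => A mA _; exact: mm'.
Qed.

(** * Borel sets, the completed measure and Borel hulls *)

Section lebesgue_borel.
Context {R : realType}.
Local Notation BR := (measurableTypeR R).
Local Notation mu := (@plane_leb R).
Local Open Scope ereal_scope.

(** Balls of the max norm are products of intervals; countably many of them, with rational centres
    and radii [1 / (n + 1)], exhaust an open set. *)
Lemma open_measurable2 (U : set (R * R)) : open U ->
  measurable (U : set (BR * BR)).
Proof.
move=> oU.
pose box (p : rat * rat * nat) : set (BR * BR) :=
  [set z | (ball (ratr p.1.1 : R) (p.2.+1%:R^-1) z.1) /\
           (ball (ratr p.1.2 : R) (p.2.+1%:R^-1) z.2)].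
have mbox p : measurable (box p).
  rewrite /box [X in measurable X](_ : _ =
    (ball (ratr p.1.1 : R) (p.2.+1%:R^-1)) `*` (ball (ratr p.1.2 : R) (p.2.+1%:R^-1))) //.
  by apply: measurableX; apply: measurable_ball.
have -> : U = \bigcup_(p in [set p | box p `<=` U]) box p.
  apply/seteqP; split => [z Uz|z [p /= pU]]; last by apply: pU.
  have /nbhs_ballP[e /= e0 eU] : nbhs z U by exact: open_nbhs_nbhs.
  have [n ne] : exists n : nat, (n.+1%:R^-1 < e / 2)%R.
    have := near_infty_natSinv_lt (PosNum (divr_gt0 e0 (ltr0Sn R 1))).
    by move=> [n _ /(_ n (leqnn n))] /= ?; exists n.
  have in0 : (0 < n.+1%:R^-1 :> R)%R by rewrite invr_gt0.
  have ne2 : (n.+1%:R^-1 + n.+1%:R^-1 <= e)%R by rewrite (splitr e) lerD// ltW.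
  have H (x : R) : exists q : rat, ball (ratr q : R) n.+1%:R^-1 x.
    have [|q] := @rat_in_itvoo R (x - n.+1%:R^-1) (x + n.+1%:R^-1).
      by rewrite ltrBlDr -addrA ltrDl addr_gt0.
    rewrite in_itv/= => /andP[h1 h2]; exists q.
    by rewrite /ball/= ltr_distlC ltrBlDr h2 /= -ltrBlDr.
  have [q1 h1] := H z.1; have [q2 h2] := H z.2.
  exists (q1, q2, n); last by [].
  move=> w /= [w1 w2]; apply: eU; split => /=.
    exact: le_ball ne2 _ (ball_triangle (ball_sym h1) w1).
  exact: le_ball ne2 _ (ball_triangle (ball_sym h2) w2).
rewrite bigcup_mkcond; apply: countable_bigcupT_measurable => // p.
by case: ifP.
Qed.

Lemma continuous_measurable2 (f : R * R -> R) : continuous f ->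
  measurable_fun setT (f : BR * BR -> BR).
Proof.
move=> /continuousP cf; apply: (measurability _ (RGenOpens.measurableE R)).
move=> _ [_ [a [b ->] <-]]; rewrite setTI; apply: open_measurable2.
exact/cf/interval_open.
Qed.

Lemma leb2_borelE (A : set (BR * BR)) : measurable A -> leb2 R A = mu A.
Proof. by move=> mA; rewrite /leb2 /= /completed_measure_extension measurable_mu_extE. Qed.

Lemma borel_lmeasurable (A : set (BR * BR)) : measurable A -> lmeasurable A.
Proof. by move=> mA; exact: caratheodory_measurable_mu_ext. Qed.

Lemma leb2_complete (N : set (Leb2 R)) : (leb2 R).-negligible N -> measurable N.
Proof. exact: measure_is_complete_caratheodory. Qed.

Lemma measurable_id_Leb2 : measurable_fun setT (id : Leb2 R -> BR * BR).
Proof. by move=> _ A mA; rewrite setTI; exact: borel_lmeasurable. Qed.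

Lemma measurable_fun_Leb2 d (U : measurableType d) (f : BR * BR -> U) :
  measurable_fun setT f -> measurable_fun setT (f : Leb2 R -> U).
Proof. by move=> mf; exact: measurableT_comp mf measurable_id_Leb2. Qed.

Lemma ge0_integral_leb2 (f : BR * BR -> \bar R) : measurable_fun setT f ->
  (forall x, 0 <= f x) -> \int[leb2 R]_x f x = \int[mu]_x f x.
Proof.
move=> mf f0.
apply: (ge0_integral_measure_preserving measurable_id_Leb2) => // A mA.
exact: leb2_borelE.
Qed.

Lemma integral_leb2 (D : set (BR * BR)) (f : BR * BR -> \bar R) :
  measurable D -> measurable_fun setT f ->
  \int[leb2 R]_(x in (D : set (Leb2 R))) f x = \int[mu]_(x in D) f x.
Proof.
move=> mD mf; rewrite integral_mkcond [RHS]integral_mkcond integralE [RHS]integralE.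
have mfD : measurable_fun setT (f \_ D).
  by apply/(measurable_restrictT f mD); exact: measurable_funTS.
congr (_ - _); apply: ge0_integral_leb2 => //.
  exact: measurable_funepos.
exact: measurable_funeneg.
Qed.

(** The completed measure is an infimum over countable Borel covers; intersecting covers of excess
    [1 / (n + 1)] attains it. *)
Lemma outer_borel_hull (E : set (BR * BR)) : leb2 R E < +oo ->
  exists F : set (BR * BR), [/\ measurable F, E `<=` F & mu F <= leb2 R E].
Proof.
move=> Efin.
have cov n : exists F : set (BR * BR), [/\ measurable F, E `<=` F &
    mu F <= leb2 R E + n.+1%:R^-1%:E].
  have fE : leb2 R E \is a fin_num by rewrite ge0_fin_numE// outer_measure_ge0.
  have n0 : (0 < n.+1%:R^-1 :> R)%R by rewrite invr_gt0.
  have [_ /= [A [mA EA] <-] Alt] := lb_ereal_inf_adherent n0 fE.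
  exists (\bigcup_k A k); split => //; first by apply: bigcupT_measurable.
  apply: le_trans (ltW Alt).
  by apply: measure_sigma_subadditive => //; exact: bigcupT_measurable.
pose F n := projT1 (cid (cov n)).
have mF n : measurable (F n) by rewrite /F; case: cid => ? [].
have EF n : E `<=` F n by rewrite /F; case: cid => ? [].
have Fle n : mu (F n) <= leb2 R E + n.+1%:R^-1%:E by rewrite /F; case: cid => ? [].
exists (\bigcap_n F n); split; [exact: bigcapT_measurable|exact: sub_bigcap|].
apply/lee_addgt0Pr => _/posnumP[e]; near \oo => n.
apply: (@le_trans _ _ (mu (F n))).
  apply: le_measure; rewrite ?inE//; first exact: bigcapT_measurable.
  exact: bigcap_inf.
rewrite (le_trans (Fle n))// leeD// lee_fin ltW//.
by near: n; apply: near_infty_natSinv_lt.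
Unshelve. all: by end_near. Qed.

Lemma leb2_null_hull (E : set (BR * BR)) : leb2 R E = 0 ->
  exists F : set (BR * BR), [/\ measurable F, E `<=` F & mu F = 0].
Proof.
move=> E0; have [|F [mF EF]] := @outer_borel_hull E; first by rewrite E0.
by rewrite E0 measure_le0 => /eqP; exists F.
Qed.

(** Subtracting measures requires finite ones, so [E] is cut along sigma-finite pieces [S n] and the
    hulls of the pieces are united. *)
Lemma borel_hull (E : set (BR * BR)) : lmeasurable E ->
  exists F : set (BR * BR), [/\ measurable F, E `<=` F & leb2 R (F `\` E) = 0].
Proof.
move=> mE.
have /sigma_finiteP[S [US _ mS]] := sigma_finiteT mu.
have Sfin n : leb2 R (S n) < +oo.
  by have [mSn Soo] := mS n; rewrite (leb2_borelE mSn).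
have mSl n : measurable (S n : set (Leb2 R)).
  by have [mSn _] := mS n; exact: borel_lmeasurable.
have H n : exists F : set (BR * BR),
    [/\ measurable F, E `&` S n `<=` F & leb2 R (F `\` (E `&` S n)) = 0].
  have mES : measurable (E `&` S n : set (Leb2 R)) by exact: measurableI.
  have fin : leb2 R (E `&` S n) < +oo.
    apply: le_lt_trans (Sfin n); apply: le_measure; rewrite ?inE//.
  have [F [mF EF Fle]] := outer_borel_hull fin; exists F; split => //.
  have mFl : measurable (F : set (Leb2 R)) by exact: borel_lmeasurable.
  rewrite -leb2_borelE// in Fle.
  rewrite measureD//; last by apply: le_lt_trans Fle fin.
  rewrite setIidr//; apply/eqP; rewrite eq_le; apply/andP; split.
    by rewrite leeBlDr ?add0e// ge0_fin_numE.
  by rewrite leeBrDr ?add0e ?ge0_fin_numE//; apply: le_measure; rewrite ?inE.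
pose F n := projT1 (cid (H n)).
have mF n : measurable (F n) by rewrite /F; case: cid => ? [].
have EF n : E `&` S n `<=` F n by rewrite /F; case: cid => ? [].
have F0 n : leb2 R (F n `\` (E `&` S n)) = 0 by rewrite /F; case: cid => ? [].
exists (\bigcup_n F n); split; first exact: bigcupT_measurable.
  by move=> x Ex; have : setT x by []; rewrite US => -[n _ Sx]; exists n => //; apply: EF.
have mFl n : measurable (F n : set (Leb2 R)) by exact: borel_lmeasurable.
have mFES n : measurable (F n `\` (E `&` S n) : set (Leb2 R)).
  by apply: measurableD => //; exact: measurableI.
apply/eqP; rewrite eq_le measure_ge0 andbT.
apply: (@le_trans _ _ (leb2 R (\bigcup_n (F n `\` (E `&` S n))))).
  apply: le_measure; rewrite ?inE.
  - by apply: measurableD => //; exact: bigcupT_measurable.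
  - exact: bigcupT_measurable.
  - by move=> x [[n _ Fx] Ex]; exists n => //; split => // -[].
apply: (@le_trans _ _ (\sum_(n <oo) leb2 R (F n `\` (E `&` S n)))).
  by apply: measure_sigma_subadditive => //; exact: bigcupT_measurable.
by rewrite eseries0.
Qed.

End lebesgue_borel.

(** * The nonlocal term on Borel sets and modulo null sets *)

Section nonlocal_borel.
Context {R : realType}.
Local Notation BR := (measurableTypeR R).
Local Notation mu := (@plane_leb R).

Lemma continuous_enorm : continuous (@enorm R).
Proof.
move=> z; apply: (@continuous_comp _ _ _ (fun z : R * R => z.1 ^+ 2 + z.2 ^+ 2)).
  apply: (@cvgD _ R^o).
  apply: (@continuous_comp _ _ _ (fst : R * R -> R) (fun t : R => t ^+ 2)).
    exact: cvg_fst.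
  exact: exprn_continuous.
  apply: (@continuous_comp _ _ _ (snd : R * R -> R) (fun t : R => t ^+ 2)).
    exact: cvg_snd.
  exact: exprn_continuous.
exact: sqrt_continuous.
Qed.

Lemma measurable_enorm : measurable_fun setT (@enorm R : BR * BR -> BR).
Proof. exact: continuous_measurable2 continuous_enorm. Qed.

Definition jump_kernel (delta : R) (z : R * R) : R :=
  cutoff delta (enorm z) / enorm z ^+ 3.

Lemma jump_kernelE (delta : R) z : 0 < delta ->
  jump_kernel delta z = if delta < enorm z then (enorm z ^+ 3)^-1 else 0.
Proof.
move=> d0; rewrite /jump_kernel /cutoff indicE mem_setE /= in_itv/= andbT.
rewrite ltr_pdivlMr// mul1r; case: ifP => _; first by rewrite mul1r.
by rewrite mul0r.
Qed.

Lemma jump_kernel_ge0 (delta : R) z : 0 <= jump_kernel delta z.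
Proof. by rewrite divr_ge0// exprn_ge0// sqrtr_ge0. Qed.

Lemma measurable_jump_kernel (delta : R) : 0 < delta ->
  measurable_fun setT (jump_kernel delta : BR * BR -> BR).
Proof.
(* Writing [max t delta] under the power leaves the kernel unchanged where the indicator is nonzero
   and removes the pole, so this factor is continuous. *)
move=> d0; pose k (t : R) := \1_(`]delta, +oo[) t * (Order.max t delta ^+ 3)^-1 : R.
have -> : jump_kernel delta = k \o (@enorm R).
  apply/funext => z; rewrite jump_kernelE//= /k indicE mem_setE in_itv/= andbT.
  by case: ltP => h; rewrite ?mul1r ?mul0r// max_l// ltW.
apply: measurableT_comp; last exact: measurable_enorm.
apply: measurable_funM; first exact: measurable_indic.
apply: continuous_measurable_fun => t.
apply: (@continuousV _ _ (fun t : R => Order.max t delta ^+ 3 : R) t).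
  by rewrite expf_neq0// gt_eqF// lt_max d0 orbT.
apply: (@continuous_comp _ _ _ (fun t : R => Order.max t delta : R) (fun t : R => t ^+ 3)).
  by apply: (@continuous_max R R id (cst delta)) => //; exact: cvg_cst.
exact: exprn_continuous.
Qed.

Lemma plane_leb_translate (c : R * R) (A : set (BR * BR)) : measurable A ->
  mu ((fun x => x + c) @^-1` A) = mu A.
Proof.
move=> mA; pose A' : set (BR * BR) := (fun x => (x.1, x.2 + (cst c.2 x.1 : BR))) @^-1` A.
have mA' : measurable A'.
  rewrite -[A']setTI; apply: (measurable_fun_pair measurable_fst) => //.
  by apply: measurable_funD => //; exact: measurable_snd.
rewrite -(plane_leb_shear2 (@measurable_cst _ _ BR BR setT c.2) mA).
rewrite -(plane_leb_shear1 (@measurable_cst _ _ BR BR setT c.1) mA').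
by [].
Qed.

Lemma measurable_translate (c : R * R) :
  measurable_fun setT (fun x : BR * BR => (x : R * R) + c : BR * BR).
Proof.
apply: (@measurable_fun_pair _ _ _ (BR * BR)%type BR BR (fun x => x.1 + c.1) (fun x => x.2 + c.2)).
  by apply: measurable_funD => //; exact: measurable_fst.
by apply: measurable_funD => //; exact: measurable_snd.
Qed.

Lemma measurable_plane_add :
  measurable_fun setT (fun p : (BR * BR) * (BR * BR) => (p.1 : R * R) + p.2 : BR * BR).
Proof.
apply: (@measurable_fun_pair _ _ _ ((BR * BR) * (BR * BR))%type BR BR
  (fun p => p.1.1 + p.2.1) (fun p => p.1.2 + p.2.2)).
  apply: measurable_funD => //.
    exact: (measurableT_comp measurable_fst measurable_fst).
  exact: (measurableT_comp measurable_fst measurable_snd).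
apply: measurable_funD => //.
  exact: (measurableT_comp measurable_snd measurable_fst).
exact: (measurableT_comp measurable_snd measurable_snd).
Qed.

Definition jump (delta : R) (A : set (R * R)) (x z : R * R) : R :=
  `|\1_A (x + z) - \1_A x| ^+ 2 * jump_kernel delta z.

Lemma jump_ge0 delta A x z : 0 <= jump delta A x z.
Proof. by rewrite mulr_ge0 ?jump_kernel_ge0// exprn_ge0. Qed.

Lemma measurable_jump delta (A : set (BR * BR)) : 0 < delta -> measurable A ->
  measurable_fun setT (fun p : (BR * BR) * (BR * BR) => jump delta A p.1 p.2 : BR).
Proof.
move=> d0 mA; apply: measurable_funM; last first.
  exact: (measurableT_comp (measurable_jump_kernel d0) measurable_snd).
apply: measurable_funX; apply: measurableT_comp => //.
have mi : measurable_fun setT (\1_A : BR * BR -> BR) by exact: measurable_indic.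
apply: measurable_funB; first exact: (measurableT_comp mi measurable_plane_add).
exact: (measurableT_comp mi measurable_fst).
Qed.

Lemma measurable_jump_at delta (A : set (BR * BR)) x : 0 < delta -> measurable A ->
  measurable_fun setT (fun z : BR * BR => jump delta A x z : BR).
Proof.
move=> d0 mA; exact: (measurableT_comp (measurable_jump d0 mA) (measurable_pair1 x)).
Qed.

Lemma nonlocal_Leb2E delta A :
  nonlocal delta A = (\int[leb2 R]_x \int[leb2 R]_z (jump delta A x z)%:E)%E.
Proof. by []. Qed.

(** For Borel sets the integrand is jointly measurable for the Borel product, which opens the double
    integral to Tonelli. *)
Lemma nonlocal_borelE delta (A : set (BR * BR)) : 0 < delta -> measurable A ->
  nonlocal delta A = (\int[mu]_x \int[mu]_z (jump delta A x z)%:E)%E.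
Proof.
move=> d0 mA; rewrite nonlocal_Leb2E.
have mF : measurable_fun setT
    (fun p : (BR * BR) * (BR * BR) => (jump delta A p.1 p.2)%:E).
  by apply/measurable_EFinP; exact: measurable_jump.
under eq_integral.
  move=> x _; rewrite (@ge0_integral_leb2 _ (fun z => (jump delta A x z)%:E)); first over.
    by apply/measurable_EFinP; exact: measurable_jump_at.
  by move=> z; rewrite lee_fin jump_ge0.
rewrite (@ge0_integral_leb2 _ (fun x => (\int[mu]_z (jump delta A x z)%:E)%E))//.
  by apply: (@measurable_fun_fubini_tonelli_F _ _ _ _ _ mu
    (fun p => (jump delta A p.1 p.2)%:E)) => //= p; rewrite lee_fin jump_ge0.
by move=> x; apply: integral_ge0 => z _; rewrite lee_fin jump_ge0.
Qed.

Lemma nonlocal_null_eq delta (A B : set (R * R)) : 0 < delta ->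
  measurable (B : set (BR * BR)) -> A `<=` B -> leb2 R (B `\` A) = 0%E ->
  nonlocal delta A = nonlocal delta B.
Proof.
move=> d0 mB AB /leb2_null_hull[N [mN BAN N0]].
have eqAB y : ~ N y -> \1_A y = \1_B y :> R.
  move=> Ny; rewrite !indicE; congr (_%:R); congr nat_of_bool; apply/idP/idP; rewrite !inE.
    exact: AB.
  by move=> By; apply: contrapT => Ay; apply: Ny; apply: BAN.
have mFB : measurable_fun setT
    (fun p : (BR * BR) * (BR * BR) => (jump delta B p.1 p.2)%:E).
  by apply/measurable_EFinP; exact: measurable_jump.
have F0 A' x z : (0 <= (jump delta A' x z)%:E)%E by rewrite lee_fin jump_ge0.
have inner x : ~ N x ->
    (\int[leb2 R]_z (jump delta B x z)%:E = \int[leb2 R]_z (jump delta A x z)%:E)%E.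
  move=> Nx.
  have mB' : measurable_fun setT (fun z : Leb2 R => (jump delta B x z)%:E).
    by apply: measurable_fun_Leb2; apply/measurable_EFinP; exact: measurable_jump_at.
  have aeq : ae_eq (leb2 R) setT (fun z : Leb2 R => (jump delta B x z)%:E)
      (fun z : Leb2 R => (jump delta A x z)%:E).
    (* For [x] outside [N] the two integrands differ at most where [x + z] lies in [N], and this set
       of [z] is a translate of a null set. *)
    pose Nx' : set (BR * BR) := (fun z => z + x) @^-1` N.
    have mNx' : measurable Nx'.
      by rewrite -[Nx']setTI; exact: measurable_translate.
    exists Nx'; split.
    - exact: borel_lmeasurable.
    - by rewrite (leb2_borelE mNx') /Nx' plane_leb_translate.
    - move=> z /= h; apply: contrapT => zN; apply: h => _.
      by rewrite /jump (eqAB x)// (eqAB (x + z))// addrC.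
  have mA' := ae_measurable_fun (@leb2_complete _) aeq mB'.
  exact: (@ge0_ae_eq_integral _ _ _ (leb2 R) setT _ _ measurableT mB' mA'
    (fun z _ => F0 B x z) (fun z _ => F0 A x z) aeq).
have mIB : measurable_fun setT (fun x : Leb2 R => \int[leb2 R]_z (jump delta B x z)%:E)%E.
  under eq_fun.
    move=> x; rewrite (@ge0_integral_leb2 _ (fun z => (jump delta B x z)%:E)); first over.
      by apply/measurable_EFinP; exact: measurable_jump_at.
    by [].
  apply: measurable_fun_Leb2.
  by apply: (@measurable_fun_fubini_tonelli_F _ _ _ _ _ mu
    (fun p => (jump delta B p.1 p.2)%:E)) => //= p.
have aeq : ae_eq (leb2 R) setT (fun x : Leb2 R => \int[leb2 R]_z (jump delta B x z)%:E)%E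
    (fun x : Leb2 R => \int[leb2 R]_z (jump delta A x z)%:E)%E.
  exists N; split; [exact: borel_lmeasurable|by rewrite (leb2_borelE mN)|].
  by move=> x /= h; apply: contrapT => zN; apply: h => _; exact: inner.
rewrite !nonlocal_Leb2E; symmetry.
apply: (@ge0_ae_eq_integral _ _ _ (leb2 R) setT _ _ measurableT mIB _ _ _ aeq).
- exact: (ae_measurable_fun (@leb2_complete _) aeq mIB).
- by move=> x _; apply: integral_ge0.
- by move=> x _; apply: integral_ge0.
Qed.

End nonlocal_borel.

Lemma integral_split d (T : measurableType d) (R : realType)
    (m : {measure set T -> \bar R}) (A B : set T) (f : T -> \bar R) :
  measurable A -> measurable B -> B `<=` A -> measurable_fun setT f ->
  (\int[m]_(x in A) f x = \int[m]_(x in A `\` B) f x + \int[m]_(x in B) f x)%E.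
Proof.
move=> mA mB BA mf.
rewrite -{1}(setDUK BA) setUC integral_setU//; first exact: measurableD.
  exact: measurable_funTS.
by apply/disj_setPS => x [[_ nB]].
Qed.

Lemma integral_null_split d (T : measurableType d) (R : realType)
    (m : {measure set T -> \bar R}) (A B : set T) (f : T -> \bar R) :
  measurable A -> measurable B -> A `<=` B -> m (B `\` A) = 0%E ->
  measurable_fun setT f ->
  (\int[m]_(x in A) f x = \int[m]_(x in B) f x)%E.
Proof.
move=> mA mB AB BA0 mf; rewrite (integral_split m mB mA AB mf).
rewrite (null_set_integral (measurableD mB mA) _ BA0) ?add0e//.
exact: measurable_funTS.
Qed.

(** * Perimeter *)

Section fields.
Context {R : realType}.
Local Notation BR := (measurableTypeR R).
Local Notation leb := (@lebesgue_measure R).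
Local Notation mu := (@plane_leb R).
Implicit Types phi : R * R -> R * R.

Definition square (L : R) : set (R * R) := `[- L, L]%classic `*` `[- L, L]%classic.

Lemma measurable_square L : measurable (square L : set (BR * BR)).
Proof. by apply: measurableX; exact: measurable_itv. Qed.

Lemma plane_leb_rect (A B : set BR) : measurable A -> measurable B ->
  mu (A `*` B) = (leb A * leb B)%E.
Proof. exact: product_measure1E. Qed.

Lemma plane_leb_square_lty L : (mu (square L) < +oo)%E.
Proof.
rewrite plane_leb_rect; [|exact: measurable_itv|exact: measurable_itv].
rewrite lte_mul_pinfty// ?ge0_fin_numE//= lebesgue_measure_itv/=.
  by case: ifP => _; rewrite ?ltry// -EFinB ltry.
by case: ifP => _; rewrite ?ltry// -EFinB ltry.
Qed.

Lemma C1_continuous_divergence phi : C1 phi -> continuous (divergence phi).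
Proof.
move=> [_ c] x; apply: (@cvgD _ R^o).
  apply: (@continuous_comp _ _ _ (fun x => 'D_((1, 0) : R * R) phi x) fst).
    exact: c.
  exact: cvg_fst.
apply: (@continuous_comp _ _ _ (fun x => 'D_((0, 1) : R * R) phi x) snd).
  exact: c.
exact: cvg_snd.
Qed.

Lemma measurable_divergence phi : C1 phi ->
  measurable_fun setT (divergence phi : BR * BR -> BR).
Proof. by move=> /C1_continuous_divergence; exact: continuous_measurable2. Qed.

Lemma derive_outside_support phi v x : ~ closure [set x | phi x != 0] x ->
  'D_v phi x = 0.
Proof.
move=> nx.
have near0 : \forall y \near x, phi y = cst 0 y.
  move/existsNP : nx => [B /not_implyP[xB /set0P/negP]].
  rewrite negbK => /eqP AB0; apply: filterS xB => y By; apply: contrapT => /eqP py.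
  by have : ([set x | phi x != 0] `&` B) y by []; rewrite AB0.
by rewrite (near_eq_derive _ near0) derive_cst.
Qed.

Lemma divergence_outside_support phi x : ~ closure [set x | phi x != 0] x ->
  divergence phi x = 0.
Proof. by move=> nx; rewrite /divergence !derive_outside_support//= addr0. Qed.

(** Bounded with bounded support, the divergence is integrable even over sets of infinite area. *)
Lemma divergence_bounded phi : C1 phi -> compactly_supported phi ->
  exists M L, forall x, `|divergence phi x| <= M * \1_(square L) x.
Proof.
move=> cphi sphi.
have [L0 [_ HL]] := compact_bounded sphi.
have [M0 [_ HM]] : bounded_set (divergence phi @` closure [set x | phi x != 0]).
  apply/compact_bounded/continuous_compact => //.
  exact/continuous_subspaceT/C1_continuous_divergence.
exists (`|M0| + 1), (`|L0| + 1) => x.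
have [sx|nsx] := pselect (closure [set x | phi x != 0] x); last first.
  by rewrite divergence_outside_support// normr0 mulr_ge0// addr_ge0.
have Lx : `|x| <= `|L0| + 1 by apply: HL => //; rewrite (le_lt_trans (ler_norm _))// ltrDl.
rewrite indicE mem_set ?mulr1.
  by apply: HM; [rewrite (le_lt_trans (ler_norm _))// ltrDl|exists x].
rewrite /square /= !in_itv/= -!ler_norml.
by move: Lx; rewrite prod_normE ge_max => /andP[].
Qed.

Lemma integrable_divergence phi (A : set (R * R)) : C1 phi ->
  compactly_supported phi -> lmeasurable A ->
  (leb2 R).-integrable (A : set (Leb2 R)) (fun x => (divergence phi x)%:E).
Proof.
move=> cphi sphi mA; have [M [L ML]] := divergence_bounded cphi sphi.
apply: (@integrableS _ _ _ (leb2 R) setT) => //.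
apply: (@le_integrable _ _ _ (leb2 R) setT measurableT _ (fun x => M%:E * (\1_(square L) x)%:E)%E).
- apply/measurable_EFinP; apply: measurable_fun_Leb2; exact: measurable_divergence.
- by move=> x _; rewrite -EFinM lee_fin (le_trans (ML x))// ler_norm.
- have mS : measurable (square L : set (Leb2 R)).
    by apply: borel_lmeasurable; exact: measurable_square.
  apply: integrableZl => //; apply/integrableP; split.
    by apply/measurable_EFinP; exact: measurable_indic.
  under eq_integral do rewrite gee0_abs ?lee_fin//.
  rewrite integral_indic// setIT leb2_borelE; last exact: measurable_square.
  exact: plane_leb_square_lty.
Qed.

Lemma perimeter_ge0 (A : set (R * R)) : (0 <= perimeter A)%E.
Proof.
apply: ereal_sup_ubound; exists (cst 0).
  split.
  - by split=> [x|v]; [exact: differentiable_cst|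
      under eq_fun do rewrite derive_cst; exact: cst_continuous].
  - rewrite /compactly_supported (_ : [set x | _] = set0) ?closure0; last first.
      by apply/seteqP; split => x //=; rewrite eqxx.
    exact: compact0.
  - by move=> x; rewrite /enorm /= expr0n addr0 sqrtr0.
rewrite integral0_eq// => x _.
by rewrite /divergence !derive_cst /= addr0.
Qed.

Lemma perimeter_null_eq (A B : set (R * R)) : lmeasurable A -> lmeasurable B ->
  A `<=` B -> leb2 R (B `\` A) = 0%E -> perimeter A = perimeter B.
Proof.
move=> mA mB AB BA0; congr ereal_sup; apply/seteqP.
suff H phi : C1 phi ->
    (\int[leb2 R]_(x in (A : set (Leb2 R))) (divergence phi x)%:E =
     \int[leb2 R]_(x in (B : set (Leb2 R))) (divergence phi x)%:E)%E.
  split=> _ [phi hphi <-]; exists phi => //; first by rewrite H//; case: hphi.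
  by rewrite -H//; case: hphi.
move=> cphi.
have mphi : measurable_fun setT (fun x : Leb2 R => (divergence phi x)%:E).
  apply/measurable_EFinP; apply: measurable_fun_Leb2; exact: measurable_divergence.
exact: integral_null_split mA mB AB BA0 mphi.
Qed.

Lemma C1N phi : C1 phi -> C1 (fun x => - phi x).
Proof.
move=> [dphi cphi]; split => [x|v]; first exact: differentiableN.
rewrite (_ : (fun x => _) = (fun x => - 'D_v phi x)).
  by move=> x; apply: cvgN; exact: cphi.
by apply/funext => x; rewrite deriveN//; exact: diff_derivable.
Qed.

Lemma divergenceN phi x : C1 phi -> divergence (fun x => - phi x) x = - divergence phi x.
Proof.
move=> [dphi _]; rewrite /divergence !deriveN; try exact: diff_derivable.
by rewrite /= opprD.
Qed.

(** Testing the difference with [phi] amounts to testing [A] with [phi] and [B] with [- phi], and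
    both fields are admissible. *)
Lemma perimeter_setD (A B : set (R * R)) : lmeasurable A -> lmeasurable B ->
  B `<=` A -> (perimeter (A `\` B) <= perimeter A + perimeter B)%E.
Proof.
move=> mA mB BA; apply: ge_ereal_sup => _ [phi [cphi sphi lephi] <-].
have mAB : lmeasurable (A `\` B) by exact: measurableD.
have mphi : measurable_fun setT (fun x : Leb2 R => (divergence phi x)%:E).
  apply/measurable_EFinP; apply: measurable_fun_Leb2; exact: measurable_divergence.
have H : (\int[leb2 R]_(x in (A : set (Leb2 R))) (divergence phi x)%:E =
     \int[leb2 R]_(x in (A `\` B : set (Leb2 R))) (divergence phi x)%:E +
     \int[leb2 R]_(x in (B : set (Leb2 R))) (divergence phi x)%:E)%E.
  exact: integral_split mA mB BA mphi.
have fB : (\int[leb2 R]_(x in (B : set (Leb2 R))) (divergence phi x)%:E)%E \is a fin_num.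
  exact/integrable_fin_num/integrable_divergence.
have -> : (\int[leb2 R]_(x in (A `\` B : set (Leb2 R))) (divergence phi x)%:E =
    \int[leb2 R]_(x in (A : set (Leb2 R))) (divergence phi x)%:E +
    \int[leb2 R]_(x in (B : set (Leb2 R))) (divergence (fun x => - phi x) x)%:E)%E.
  under [X in (_ + X)%E]eq_integral do rewrite divergenceN// EFinN.
  rewrite integralN; last exact/integrable_add_def/integrable_divergence.
  by rewrite H addeK.
apply: leeD; apply: ereal_sup_ubound; first by exists phi.
exists (fun x => - phi x); last by [].
split; first exact: C1N.
  rewrite /compactly_supported (_ : [set x | _] = [set x | phi x != 0]); first exact: sphi.
  by apply/seteqP; split => x /=; rewrite oppr_eq0.
by move=> x; rewrite /enorm /= !sqrrN; exact: lephi.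
Qed.

End fields.

(** * Perimeter of a disk *)

Section disk.
Context {R : realType}.
Local Notation BR := (measurableTypeR R).
Local Notation leb := (@lebesgue_measure R).
Local Notation mu := (@plane_leb R).
Implicit Types (f g : R * R -> R) (rho : R).

Lemma disk0E rho (x : R * R) : 0 < rho ->
  disk 0%R rho x <-> x.1 ^+ 2 + x.2 ^+ 2 < rho ^+ 2.
Proof.
move=> r0; rewrite /disk /= subr0 /enorm.
rewrite -{1}(ger0_norm (ltW r0)) -sqrtr_sqr ltr_sqrt// exprn_gt0//.
Qed.

Lemma measurable_disk rho : measurable (disk 0%R rho : set (BR * BR)).
Proof.
have -> : disk 0%R rho = (@enorm R) @^-1` `]-oo, rho[%classic.
  by apply/seteqP; split => x; rewrite /disk /= subr0 in_itv.
by rewrite -[_ @^-1` _]setTI; exact: measurable_enorm.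
Qed.

Lemma disk_sub_square rho : 0 < rho -> disk 0%R rho `<=` square rho.
Proof.
move=> r0 x /(disk0E _ r0) xr; rewrite /square /= !in_itv/= -!ler_norml.
have h (a b : R) : a ^+ 2 + b ^+ 2 < rho ^+ 2 -> `|a| <= rho.
  move=> ab; rewrite -(ger0_norm (ltW r0)) -ler_sqr ?nnegrE// !real_normK ?num_real//.
  by have := sqr_ge0 b; lra.
by split; [exact: h xr|apply: (h _ x.1); rewrite addrC].
Qed.

Lemma continuous_square_bounded g L : continuous g ->
  exists M, forall x, square L x -> `|g x| <= M.
Proof.
move=> cg.
have cS : compact (square L) by apply: compact_setX; exact: segment_compact.
have [M0 [_ HM]] : bounded_set (g @` square L).
  by apply: compact_bounded; apply: continuous_compact => //; exact: continuous_subspaceT.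
exists (`|M0| + 1) => x Lx.
by apply: HM; [rewrite (le_lt_trans (ler_norm _))// ltrDl|exists x].
Qed.

Lemma integrable_disk g rho : 0 < rho -> continuous g ->
  mu.-integrable setT (fun x => (\1_(disk 0%R rho) x * g x)%:E).
Proof.
move=> r0 cg; have [M HM] := continuous_square_bounded rho cg.
apply: (@le_integrable _ _ _ mu setT measurableT _ (fun x => M%:E * (\1_(square rho) x)%:E)%E).
- apply/measurable_EFinP; apply: measurable_funM; last exact: continuous_measurable2.
  by apply: measurable_indic; exact: measurable_disk.
- move=> x _; rewrite -EFinM lee_fin !normrM indicE.
  have [xD|xD] := boolP (x \in disk 0%R rho); last by rewrite normr0 mul0r mulr_ge0.
  have xS : square rho x by apply: disk_sub_square => //; rewrite -in_setE.
  rewrite normr1 mul1r indicE mem_set// normr1 mulr1.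
  exact: le_trans (HM _ xS) (ler_norm _).
- apply: integrableZl => //; apply/integrableP; split.
    by apply/measurable_EFinP; apply: measurable_indic; exact: measurable_square.
  under eq_integral do rewrite gee0_abs ?lee_fin//.
  rewrite integral_indic//; last exact: measurable_square.
  by rewrite setIT; exact: plane_leb_square_lty.
Qed.

(** Half the length of the horizontal chord at height [y]. Outside the disk the radicand is negative
    and [Num.sqrt] returns 0, which keeps the function continuous on the whole line. *)
Definition chord rho (y : R) : R := Num.sqrt (rho ^+ 2 - y ^+ 2).

Lemma continuous_chord rho : continuous (chord rho).
Proof.
move=> y; apply: (@continuous_comp _ _ _ (fun y : R => rho ^+ 2 - y ^+ 2) Num.sqrt);
  last exact: sqrt_continuous.
by apply: (@cvgB _ R^o); [exact: cvg_cst|exact: exprn_continuous].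
Qed.

Lemma disk_section rho (x y : R) : 0 < rho -> `|y| < rho ->
  disk 0%R rho (x, y) <-> x \in `](- chord rho y), (chord rho y)[.
Proof.
move=> r0 yr; rewrite disk0E//= in_itv/= -ltr_norml /chord -sqrtr_sqr ltr_sqrt.
  by rewrite ltrBrDr.
by rewrite subr_gt0 -real_normK ?num_real// ltr_sqr ?nnegrE// ltW.
Qed.

Lemma disk_section0 rho (x y : R) : 0 < rho -> rho <= `|y| -> ~ disk 0%R rho (x, y).
Proof.
move=> r0 yr; rewrite disk0E//= => h.
have : rho ^+ 2 <= y ^+ 2 by rewrite -(real_normK (num_real y)) ler_sqr ?nnegrE// ltW.
by have := sqr_ge0 x; lra.
Qed.

Lemma continuous_path2 f (a b : R -> R) : continuous f -> continuous a ->
  continuous b -> continuous (fun t => f (a t, b t)).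
Proof.
move=> cf ca cb t; apply: (@continuous_comp _ _ _ (fun t => (a t, b t)) f); last exact: cf.
exact: (@cvg_pair _ _ _ _ (nbhs (a t)) (nbhs (b t)) _ _ _ a b (ca t) (cb t)).
Qed.

(** Fubini along horizontal chords, then the fundamental theorem of calculus on each chord. Folding
    [y] onto [[0, rho]] leaves one quarter of the circle, where the substitutions by [sin] and [cos]
    are monotone. *)
Lemma integral_disk_x f g rho : 0 < rho -> continuous f -> continuous g ->
  (forall x y : R, is_derive x 1 (fun t => f (t, y)) (g (x, y))) ->
  (\int[mu]_(x in disk 0%R rho) (g x)%:E =
   \int[leb]_(y in `[0%R, rho]) (f (chord rho y, y) - f (- chord rho y, y)
     + (f (chord rho y, - y) - f (- chord rho y, - y)))%:E)%E.
Proof.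
move=> r0 cf cg df.
pose H y := f (chord rho y, y) - f (- chord rho y, y).
have cN : continuous (fun y => - chord rho y).
  by move=> y; apply: (@cvgN _ R^o); exact: continuous_chord.
have cH : continuous H.
  move=> y; apply: (@cvgB _ R^o).
    exact: (continuous_path2 cf (@continuous_chord rho) (fun x => cvg_id)).
  exact: (continuous_path2 cf cN (fun x => cvg_id)).
transitivity (\int[mu]_x (\1_(disk 0%R rho) x * g x)%:E)%E.
  rewrite integral_mkcond; apply: eq_integral => x _.
  by rewrite patchE indicE; case: ifP; rewrite ?mul1r ?mul0r.
rewrite -[LHS]/(\int[leb \x leb]_x (\1_(disk 0%R rho) x * g x)%:E)%E.
rewrite -(@integral21_prod_meas1 _ _ _ _ _ leb leb _ (integrable_disk r0 cg)).
transitivity (\int[leb]_(y in `](- rho)%R, rho[) (H y)%:E)%E.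
  rewrite [RHS]integral_mkcond; apply: eq_integral => y _.
  rewrite patchE mem_setE in_itv/= -ltr_norml.
  case: ltP => yr; last first.
    apply: integral0_eq => x _; rewrite indicE memNset ?mul0r//.
    exact: disk_section0.
  have s0 : 0 < chord rho y.
    by rewrite sqrtr_gt0 subr_gt0 -(real_normK (num_real y)) ltr_sqr ?nnegrE// ltW.
  transitivity (\int[leb]_(x in `](- chord rho y)%R, (chord rho y)[) (g (x, y))%:E)%E.
    rewrite [RHS]integral_mkcond; apply: eq_integral => x _.
    rewrite patchE mem_setE indicE; case: ifPn => h.
      by rewrite mem_set ?mul1r//; apply/disk_section.
    by rewrite memNset ?mul0r//; apply/disk_section => //; apply/negP.
  have cgy : continuous (fun t => g (t, y)).
    exact: (continuous_path2 cg (fun x => cvg_id) (fun x => cvg_cst _)).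
  have cfy : continuous (fun t => f (t, y)).
    exact: (continuous_path2 cf (fun x => cvg_id) (fun x => cvg_cst _)).
  rewrite -(@integral_itv_bndoo _ _ _ _ true false); last first.
    by apply/measurable_EFinP; apply: measurable_funTS; exact: continuous_measurable_fun.
  rewrite (@continuous_FTC2 _ (fun t => g (t, y)) (fun t => f (t, y))) ?EFinB//.
  - by rewrite gtrN.
  - exact: continuous_subspaceT.
  - split; first by move=> x _.
    + by apply: cvg_at_right_filter; exact: cfy.
    + by apply: cvg_at_left_filter; exact: cfy.
  - by move=> x _; rewrite derive1E derive_val.
have cHN : continuous (fun y => H (- y)).
  by move=> y; apply: continuous_comp; [exact: opp_continuous|exact: cH].
have mH (A : set BR) : measurable A -> measurable_fun A (fun y => (H y)%:E).
  by move=> mA; apply/measurable_EFinP; apply: measurable_funTS; exact: continuous_measurable_fun.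
have mHN (A : set BR) : measurable A -> measurable_fun A (fun y => (H (- y))%:E).
  by move=> mA; apply/measurable_EFinP; apply: measurable_funTS; exact: continuous_measurable_fun.
have iH : leb.-integrable `[0%R, rho] (fun y => (H y)%:E).
  by apply: continuous_compact_integrable; [exact: segment_compact|exact: continuous_subspaceT].
have iHN : leb.-integrable `[0%R, rho] (fun y => (H (- y))%:E).
  by apply: continuous_compact_integrable; [exact: segment_compact|exact: continuous_subspaceT].
transitivity (\int[leb]_(y in `[0%R, rho]) (H y)%:E +
    \int[leb]_(y in `[0%R, rho]) (H (- y))%:E)%E; last first.
  rewrite -integralD//; apply: eq_integral => y _; rewrite -EFinD /H.
  by rewrite /chord sqrrN.
have E0 : `](- rho), rho[%classic = `](- rho), 0[%classic `|` `[0, rho[%classic :> set R.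
  by rewrite -itv_bndbnd_setU// bnd_simp; lra.
rewrite {1}E0 integral_setU//=; last 2 first.
- by apply: measurable_funTS; exact: mH.
- by apply/disj_setPS => y [/=]; rewrite !in_itv/=; lra.
rewrite addeC; congr (_ + _)%E.
  by rewrite integral_itv_bndo_bndc//; apply: measurable_funTS; exact: mH.
rewrite -(@integral_itv_bndoo _ _ _ _ true false); last first.
  by apply: measurable_funTS; exact: mH.
rewrite -{1}oppr0 (@integration_by_substitution_oppr _ H 0 rho)//; first exact: ltW.
exact: continuous_subspaceT.
Qed.

End disk.

Lemma integral_measure_preserving d d' (X : measurableType d)
    (Y : measurableType d') (R : realType) (m : {measure set X -> \bar R})
    (m' : {measure set Y -> \bar R}) (phi : X -> Y) (f : Y -> \bar R) :
  measurable_fun setT phi ->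
  (forall A, measurable A -> m (phi @^-1` A) = m' A) ->
  measurable_fun setT f ->
  (\int[m]_x f (phi x) = \int[m']_y f y)%E.
Proof.
move=> mphi mm' mf; rewrite integralE [RHS]integralE; congr (_ - _)%E.
  rewrite -(ge0_integral_measure_preserving mphi mm' (measurable_funepos mf))//.
  by apply: eq_integral => x _; rewrite !funeposE.
rewrite -(ge0_integral_measure_preserving mphi mm' (measurable_funeneg mf))//.
by apply: eq_integral => x _; rewrite !funenegE.
Qed.

(** * Divergence theorem on the disk, its perimeter and its area *)

Section disk_divergence.
Context {R : realType}.
Local Notation BR := (measurableTypeR R).
Local Notation leb := (@lebesgue_measure R).
Local Notation mu := (@plane_leb R).
Implicit Types (f g : R * R -> R) (rho : R).

Lemma plane_leb_swap (A : set (BR * BR)) : measurable A ->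
  mu ((fun x => (x.2, x.1)) @^-1` A) = mu A.
Proof.
move=> mA; rewrite (plane_leb2E mA); apply: eq_integral => x _ /=.
by congr (leb _); apply/seteqP; split => y; rewrite /xsection /ysection /= !inE.
Qed.

Lemma continuous_plane_swap f : continuous f -> continuous (fun x => f (x.2, x.1)).
Proof.
move=> cf x; apply: (@continuous_comp _ _ _ (fun x : R * R => (x.2, x.1)) f); last exact: cf.
exact: (@cvg_pair _ _ _ _ (nbhs x.2) (nbhs x.1) _ _ _ snd fst cvg_snd cvg_fst).
Qed.

Lemma integral_disk_y f g rho : 0 < rho -> continuous f -> continuous g ->
  (forall x y : R, is_derive y 1 (fun t => f (x, t)) (g (x, y))) ->
  (\int[mu]_(x in disk 0%R rho) (g x)%:E =
   \int[leb]_(x in `[0%R, rho]) (f (x, chord rho x) - f (x, - chord rho x)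
     + (f (- x, chord rho x) - f (- x, - chord rho x)))%:E)%E.
Proof.
move=> r0 cf cg df.
have := @integral_disk_x _ (fun x => f (x.2, x.1)) (fun x => g (x.2, x.1)) rho r0
  (continuous_plane_swap cf) (continuous_plane_swap cg) (fun x y => df y x).
move=> /= <-; rewrite integral_mkcond [RHS]integral_mkcond.
have mg : measurable_fun setT (fun x : BR * BR => (g x)%:E).
  by apply/measurable_EFinP; exact: continuous_measurable2.
have mgD : measurable_fun setT ((fun x : BR * BR => (g x)%:E) \_ (disk 0%R rho)).
  by apply/(measurable_restrictT _ (measurable_disk rho)); exact: measurable_funTS.
rewrite -(integral_measure_preserving (@measurable_swap _ _ BR BR) plane_leb_swap mgD).
apply: eq_integral => x _; rewrite !patchE /=.
congr (if _ then _ else _); apply/idP/idP; rewrite !inE !disk0E//= addrC//.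
Qed.

Lemma derivable_cvg_bounds (F : R -> R) a b : (forall x, derivable F x 1) ->
  derivable_oo_LRcontinuous F a b.
Proof.
move=> dF; have cF : continuous F.
  by move=> x; exact/differentiable_continuous/derivable1_diffP.
split; first by move=> x _.
  exact/cvg_at_right_filter/cF.
exact/cvg_at_left_filter/cF.
Qed.

Lemma integral_sin_subst (G : R -> R) rho : 0 < rho -> continuous G ->
  (\int[leb]_(y in `[0%R, rho]) (G y)%:E =
   \int[leb]_(t in `[0%R, (pi / 2)%R]) (G (rho * sin t) * (rho * cos t))%:E)%E.
Proof.
move=> r0 cG; pose F t : R := rho * sin t.
have dF (t : R) : is_derive t 1 F (rho * cos t).
  rewrite -[rho * cos t]/(rho *: cos t); exact: is_deriveZ.
have F'E : (derive1 F) = (fun t => rho * cos t).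
  by apply/funext => t; rewrite derive1E derive_val.
have cF' : continuous (derive1 F).
  rewrite F'E => t; apply: (@cvgM _ _ _ _ (cst rho)); [exact: cvg_cst|exact: continuous_cos].
transitivity (\int[leb]_(y in `[F 0%R, F (pi / 2)%R]) (G y)%:E)%E.
  by rewrite /F sin0 mulr0 sin_pihalf mulr1.
rewrite integration_by_substitution_increasing.
- by apply: eq_integral => t _; rewrite /= F'E.
- by rewrite divr_ge0// pi_ge0.
- move=> x y /itvP hx /itvP hy xy; rewrite ltr_pM2l// ltr_sin// in_itv/= ?hx ?hy andbT.
    by rewrite (le_trans _ (_ : 0 <= x)) ?hx// oppr_le0 divr_ge0 ?pi_ge0.
  by rewrite (le_trans _ (_ : 0 <= y)) ?hy// oppr_le0 divr_ge0 ?pi_ge0.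
- by move=> x _; exact: cF'.
- by apply/cvg_ex; exists ((derive1 F) 0); apply: cvg_at_right_filter; exact: cF'.
- by apply/cvg_ex; exists ((derive1 F) (pi / 2)); apply: cvg_at_left_filter; exact: cF'.
- by apply: derivable_cvg_bounds => x; have [] := dF x.
- exact: continuous_subspaceT.
Qed.

(** Used for vertical chords, as the substitution by [sin] is for horizontal ones: in both the
    boundary point is [(rho cos t, rho sin t)], so the two fluxes can be added under one
    integral. *)
Lemma integral_cos_subst (G : R -> R) rho : 0 < rho -> continuous G ->
  (\int[leb]_(y in `[0%R, rho]) (G y)%:E =
   \int[leb]_(t in `[0%R, (pi / 2)%R]) (G (rho * cos t) * (rho * sin t))%:E)%E.
Proof.
move=> r0 cG; pose F t : R := rho * cos t.
have dF (t : R) : is_derive t 1 F (rho * - sin t).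
  rewrite -[rho * _]/(rho *: - sin t); exact: is_deriveZ.
have F'E : (derive1 F) = (fun t => rho * - sin t).
  by apply/funext => t; rewrite derive1E derive_val.
have cF' : continuous (derive1 F).
  rewrite F'E => t; apply: (@cvgM _ _ _ _ (cst rho)); first exact: cvg_cst.
  by apply: (@cvgN _ R^o); exact: continuous_sin.
transitivity (\int[leb]_(y in `[F (pi / 2)%R, F 0%R]) (G y)%:E)%E.
  by rewrite /F cos0 mulr1 cos_pihalf mulr0.
rewrite integration_by_substitution_decreasing.
- by apply: eq_integral => t _; congr EFin; rewrite F'E !fctE; ring.
- by rewrite divr_ge0// pi_ge0.
- have p2 : (pi / 2 <= pi :> R) by have := pi_ge0 R; lra.
  move=> x y; rewrite !in_itv/= => /andP[hx1 hx2] /andP[hy1 hy2] xy.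
  rewrite ltr_pM2l// ltr_cos// in_itv/=.
    by apply/andP; split; lra.
  by apply/andP; split; lra.
- by move=> x _; exact: cF'.
- by apply/cvg_ex; exists ((derive1 F) 0); apply: cvg_at_right_filter; exact: cF'.
- by apply/cvg_ex; exists ((derive1 F) (pi / 2)); apply: cvg_at_left_filter; exact: cF'.
- by apply: derivable_cvg_bounds => x; have [] := dF x.
- exact: continuous_subspaceT.
Qed.

Lemma chord_sin rho t : 0 < rho -> t \in `[0, (pi / 2)] ->
  chord rho (rho * sin t) = rho * cos t.
Proof.
move=> r0; rewrite in_itv/= => /andP[t0 t1].
have c0 : 0 <= cos t by apply: cos_ge0_pihalf; apply/andP; split; lra.
rewrite /chord exprMn -{1}[rho ^+ 2]mulr1 -mulrBr.
by rewrite -(cos2Dsin2 t) addrK -exprMn sqrtr_sqr ger0_norm// mulr_ge0// ltW.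
Qed.

Lemma chord_cos rho t : 0 < rho -> t \in `[0, (pi / 2)] ->
  chord rho (rho * cos t) = rho * sin t.
Proof.
move=> r0; rewrite in_itv/= => /andP[t0 t1].
have s0 : 0 <= sin t by apply: sin_ge0_pi; apply/andP; split; lra.
rewrite /chord exprMn -{1}[rho ^+ 2]mulr1 -mulrBr.
by rewrite -(cos2Dsin2 t) addrAC subrr add0r -exprMn sqrtr_sqr ger0_norm// mulr_ge0// ltW.
Qed.

Implicit Types phi : R * R -> R * R.

Lemma is_derive_of_cvg (f : R -> R) (x l : R) :
  h^-1 *: (f (h *: 1 + x) - f x) @[h --> 0^'] --> l -> is_derive x 1 f l.
Proof.
move=> fl; apply: DeriveDef; first by apply/cvg_ex; exists l.
exact/cvg_lim.
Qed.

Lemma C1_partial_x phi : C1 phi -> forall x y : R,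
  is_derive x 1 (fun t : R => (phi (t, y)).1) ('D_((1, 0) : R * R) phi (x, y)).1.
Proof.
move=> [dphi _] x y; apply: is_derive_of_cvg.
have /(_ (dphi _)) D := @diff_derivable _ _ _ phi (x, y) ((1, 0) : R * R).
rewrite (_ : (fun h : R => _) = fst \o (fun h : R =>
    h^-1 *: (phi (h *: ((1, 0) : R * R) + (x, y)) - phi (x, y)))).
  exact: (@cvg_comp _ _ _ _ fst _ _ _ D cvg_fst).
apply/funext => h /=.
have -> : h *: ((1, 0) : R * R) + (x, y) = (h *: 1 + x, y) by
  apply: injective_projections; rewrite /= ?scaler0 ?add0r.
by [].
Qed.

Lemma C1_partial_y phi : C1 phi -> forall x y : R,
  is_derive y 1 (fun t : R => (phi (x, t)).2) ('D_((0, 1) : R * R) phi (x, y)).2.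
Proof.
move=> [dphi _] x y; apply: is_derive_of_cvg.
have /(_ (dphi _)) D := @diff_derivable _ _ _ phi (x, y) ((0, 1) : R * R).
rewrite (_ : (fun h : R => _) = snd \o (fun h : R =>
    h^-1 *: (phi (h *: ((0, 1) : R * R) + (x, y)) - phi (x, y)))).
  exact: (@cvg_comp _ _ _ _ snd _ _ _ D cvg_snd).
apply/funext => h /=.
have -> : h *: ((0, 1) : R * R) + (x, y) = (x, h *: 1 + y) by
  apply: injective_projections; rewrite /= ?scaler0 ?add0r.
by [].
Qed.

(* Outward flux density on the circle, summed over the four reflections of [t]. *)
Definition flux (phi : R * R -> R * R) rho t : R :=
  cos t * ((phi (rho * cos t, rho * sin t)).1 - (phi (- (rho * cos t), rho * sin t)).1
   + ((phi (rho * cos t, - (rho * sin t))).1 - (phi (- (rho * cos t), - (rho * sin t))).1))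
  + sin t * ((phi (rho * cos t, rho * sin t)).2 - (phi (rho * cos t, - (rho * sin t))).2
   + ((phi (- (rho * cos t), rho * sin t)).2 - (phi (- (rho * cos t), - (rho * sin t))).2)).

Lemma C1_continuous phi : C1 phi -> continuous phi.
Proof. by move=> [d _] x; exact: differentiable_continuous. Qed.

Lemma disk_divergence phi rho : 0 < rho -> C1 phi ->
  (\int[mu]_(x in disk 0%R rho) (divergence phi x)%:E =
   \int[leb]_(t in `[0%R, (pi / 2)%R]) (rho * flux phi rho t)%:E)%E.
Proof.
move=> r0 cphi; have [_ cD] := cphi.
have c1 : continuous (fun x => (phi x).1).
  move=> x; apply: (@continuous_comp _ _ _ phi fst); first exact: C1_continuous.
  exact: cvg_fst.
have c2 : continuous (fun x => (phi x).2).
  move=> x; apply: (@continuous_comp _ _ _ phi snd); first exact: C1_continuous.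
  exact: cvg_snd.
have cd1 : continuous (fun x => ('D_((1, 0) : R * R) phi x).1).
  move=> x; apply: (@continuous_comp _ _ _ (fun x => 'D_((1, 0) : R * R) phi x) fst).
    exact: cD.
  exact: cvg_fst.
have cd2 : continuous (fun x => ('D_((0, 1) : R * R) phi x).2).
  move=> x; apply: (@continuous_comp _ _ _ (fun x => 'D_((0, 1) : R * R) phi x) snd).
    exact: cD.
  exact: cvg_snd.
have iD g : continuous g -> mu.-integrable (disk 0%R rho) (fun x => (g x)%:E).
  move=> cg; apply/integrable_mkcond; first exact: measurable_disk.
  apply: eq_integrable (integrable_disk r0 cg) => // x _.
  by rewrite patchE indicE; case: ifP; rewrite ?mul1r ?mul0r.
rewrite (_ : (fun x => _) = (fun x => (('D_((1, 0) : R * R) phi x).1)%:E +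
    (('D_((0, 1) : R * R) phi x).2)%:E)%E) ?integralD//; last 3 first.
- exact: measurable_disk.
- exact: iD.
- exact: iD.
rewrite (integral_disk_x r0 c1 cd1 (C1_partial_x cphi)).
rewrite (integral_disk_y r0 c2 cd2 (C1_partial_y cphi)).
pose G1 y := (phi (chord rho y, y)).1 - (phi (- chord rho y, y)).1
  + ((phi (chord rho y, - y)).1 - (phi (- chord rho y, - y)).1).
pose G2 x := (phi (x, chord rho x)).2 - (phi (x, - chord rho x)).2
  + ((phi (- x, chord rho x)).2 - (phi (- x, - chord rho x)).2).
have cs := @continuous_chord _ rho.
have csN : continuous (fun y => - chord rho y).
  by move=> y; apply: (@cvgN _ R^o); exact: cs.
have ci : continuous (fun y : R => y) by move=> y; exact: cvg_id.
have cN : continuous (fun y : R => - y) by exact: opp_continuous.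
have p1 (a b : R -> R) y : continuous a -> continuous b ->
    (phi (a t, b t)).1 @[t --> y] --> (phi (a y, b y)).1.
  by move=> ca cb; exact: (continuous_path2 c1 ca cb).
have p2 (a b : R -> R) y : continuous a -> continuous b ->
    (phi (a t, b t)).2 @[t --> y] --> (phi (a y, b y)).2.
  by move=> ca cb; exact: (continuous_path2 c2 ca cb).
have cG1 : continuous G1.
  by move=> y; apply: (@cvgD _ R^o); apply: (@cvgB _ R^o); exact: p1.
have cG2 : continuous G2.
  by move=> y; apply: (@cvgD _ R^o); apply: (@cvgB _ R^o); exact: p2.
rewrite (integral_sin_subst r0 cG1) (integral_cos_subst r0 cG2).
have crs : continuous (fun t : R => rho * sin t).
  by move=> t; apply: (@cvgM _ _ _ _ (cst rho)); [exact: cvg_cst|exact: continuous_sin].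
have crc : continuous (fun t : R => rho * cos t).
  by move=> t; apply: (@cvgM _ _ _ _ (cst rho)); [exact: cvg_cst|exact: continuous_cos].
have iG (G a b : R -> R) : continuous G -> continuous a -> continuous b ->
    leb.-integrable `[0%R, (pi / 2)%R] (fun t => (G (a t) * b t)%:E).
  move=> cG ca cb; apply: continuous_compact_integrable; first exact: segment_compact.
  apply: continuous_subspaceT => t; apply: (@cvgM R R); last exact: cb.
  by apply: continuous_comp; [exact: ca|exact: cG].
rewrite -integralD//; last 2 first.
- exact: iG.
- exact: iG.
apply: eq_integral => t; rewrite inE => ht; rewrite -EFinD; congr EFin.
rewrite /G1 /G2 chord_sin// chord_cos// /flux; ring.
Qed.

(** At each of the four reflected points the field is paired with a unit normal; expanding the
    square of their difference bounds the pairing by 1. *)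
Lemma flux_le phi rho t : t \in `[0, (pi / 2)] -> (forall x, enorm (phi x) <= 1) ->
  flux phi rho t <= 4.
Proof.
rewrite in_itv/= => /andP[t0 t1] H.
have cs := cos2Dsin2 t.
have c0 : 0 <= cos t by apply: cos_ge0_pihalf; apply/andP; split; lra.
have s0 : 0 <= sin t by apply: sin_ge0_pi; apply/andP; split; lra.
have K x (a b : R) : a ^+ 2 + b ^+ 2 = 1 -> a * (phi x).1 + b * (phi x).2 <= 1.
  move=> ab; have := H x; rewrite /enorm => Hx.
  have h1 : (phi x).1 ^+ 2 + (phi x).2 ^+ 2 <= 1.
    have := sqr_sqrtr (addr_ge0 (sqr_ge0 (phi x).1) (sqr_ge0 (phi x).2)).
    by move=> <-; rewrite expr_le1// sqrtr_ge0.
  by have := sqr_ge0 (a - (phi x).1); have := sqr_ge0 (b - (phi x).2); nra.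
have k1 := K (rho * cos t, rho * sin t) (cos t) (sin t) cs.
have k2 := K (- (rho * cos t), rho * sin t) (- cos t) (sin t).
have k3 := K (rho * cos t, - (rho * sin t)) (cos t) (- sin t).
have k4 := K (- (rho * cos t), - (rho * sin t)) (- cos t) (- sin t).
rewrite !sqrrN in k2 k3 k4.
by move: (k2 cs) (k3 cs) (k4 cs) k1; rewrite /flux; lra.
Qed.

Lemma continuous_flux phi rho : C1 phi -> continuous (flux phi rho).
Proof.
move=> cphi.
have c1 : continuous (fun x => (phi x).1).
  move=> x; apply: (@continuous_comp _ _ _ phi fst); first exact: C1_continuous.
  exact: cvg_fst.
have c2 : continuous (fun x => (phi x).2).
  move=> x; apply: (@continuous_comp _ _ _ phi snd); first exact: C1_continuous.
  exact: cvg_snd.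
have crs : continuous (fun t : R => rho * sin t).
  by move=> t; apply: (@cvgM _ _ _ _ (cst rho)); [exact: cvg_cst|exact: continuous_sin].
have crc : continuous (fun t : R => rho * cos t).
  by move=> t; apply: (@cvgM _ _ _ _ (cst rho)); [exact: cvg_cst|exact: continuous_cos].
have crsN : continuous (fun t : R => - (rho * sin t)).
  by move=> t; apply: (@cvgN _ R^o); exact: crs.
have crcN : continuous (fun t : R => - (rho * cos t)).
  by move=> t; apply: (@cvgN _ R^o); exact: crc.
have p1 (a b : R -> R) y : continuous a -> continuous b ->
    (phi (a t, b t)).1 @[t --> y] --> (phi (a y, b y)).1.
  by move=> ca cb; exact: (continuous_path2 c1 ca cb).
have p2 (a b : R -> R) y : continuous a -> continuous b ->
    (phi (a t, b t)).2 @[t --> y] --> (phi (a y, b y)).2.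
  by move=> ca cb; exact: (continuous_path2 c2 ca cb).
move=> t; apply: (@cvgD _ R^o); apply: (@cvgM R R).
- exact: continuous_cos.
- by apply: (@cvgD _ R^o); apply: (@cvgB _ R^o); exact: p1.
- exact: continuous_sin.
- by apply: (@cvgD _ R^o); apply: (@cvgB _ R^o); exact: p2.
Qed.

Lemma integral_quarter_cst (c : R) :
  (\int[leb]_(t in `[0%R, (pi / 2)%R]) (cst c%:E t) = (c * (pi / 2))%:E)%E.
Proof.
have p0 : 0 < pi / 2 :> R by rewrite divr_gt0// pi_gt0.
by rewrite integral_cst//= lebesgue_measure_itv/= lte_fin p0 oppr0 adde0.
Qed.

Lemma perimeter_disk rho : 0 < rho ->
  (perimeter (disk 0%R rho) <= (2 * pi * rho)%:E)%E.
Proof.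
move=> r0; apply: ge_ereal_sup => _ [phi [cphi _ lephi] <-].
rewrite (@integral_leb2 _ (disk 0%R rho) (fun x => (divergence phi x)%:E)); last 2 first.
- exact: measurable_disk.
- by apply/measurable_EFinP; exact: measurable_divergence.
rewrite (disk_divergence r0 cphi).
(* The flux density is at most 4 and the quarter turn has length [pi / 2]. *)
have -> : 2 * pi * rho = 4 * rho * (pi / 2) by field.
rewrite -integral_quarter_cst; apply: le_integral => //.
- apply: continuous_compact_integrable; first exact: segment_compact.
  apply: continuous_subspaceT => t; apply: (@cvgM _ _ _ _ (cst rho)).
    exact: cvg_cst.
  exact: continuous_flux.
- apply: continuous_compact_integrable; first exact: segment_compact.
  by apply: continuous_subspaceT => t; exact: cvg_cst.
- move=> t; rewrite inE => ht; rewrite lee_fin mulrC ler_pM2r//.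
  exact: flux_le.
Qed.

(** Divergence theorem for the identity field: its divergence is 2 and its flux density is
    constant. *)
Lemma plane_leb_disk rho : 0 < rho -> mu (disk 0%R rho) = (pi * rho ^+ 2)%:E.
Proof.
move=> r0.
have cid : C1 (id : R * R -> R * R).
  split=> [x|v].
    by apply: (@linear_differentiable _ _ _ idfun) => y; exact: cvg_id.
  rewrite (_ : (fun x => _) = cst v); first exact: cst_continuous.
  by apply/funext => x; rewrite derive_id.
have := disk_divergence r0 cid.
rewrite (_ : (fun x : R * R => (divergence id x)%:E) = cst 2%:E); last first.
  by apply/funext => x; rewrite /divergence !derive_id.
rewrite (_ : (fun t : R => _) = cst (4 * rho ^+ 2)%:E); last first.
  apply/funext => t; congr EFin; rewrite /flux /=.
  have -> : 4 * rho ^+ 2 = 4 * rho ^+ 2 * (cos t ^+ 2 + sin t ^+ 2).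
    by rewrite cos2Dsin2 mulr1.
  ring.
rewrite integral_cst//; last exact: measurable_disk.
rewrite integral_quarter_cst.
have fin : mu (disk 0%R rho) \is a fin_num.
  rewrite ge0_fin_numE//; apply: le_lt_trans (plane_leb_square_lty rho).
  by apply: le_measure; rewrite ?inE;
    [exact: measurable_disk|exact: measurable_square|exact: disk_sub_square].
move=> h; have {h} : (2%:E * mu (disk 0%R rho) = (4 * rho ^+ 2 * (pi / 2))%:E)%E := h.
move: fin; case: (mu (disk 0%R rho)) => [a| |] // _ [h]; congr EFin; lra.
Qed.

End disk_divergence.

(** * Lunes *)

Section rotation.
Context {R : realType}.
Local Notation BR := (measurableTypeR R).
Local Notation mu := (@plane_leb R).

Definition rotation (c s : R) (x : R * R) : R * R :=
  (c * x.1 - s * x.2, s * x.1 + c * x.2).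

Lemma measurable_rotation c s :
  measurable_fun setT (rotation c s : BR * BR -> BR * BR).
Proof.
have m1 (k : R) : measurable_fun setT (fun x : BR * BR => k * x.1 : BR).
  by apply: measurable_funM => //; exact: measurable_fst.
have m2 (k : R) : measurable_fun setT (fun x : BR * BR => k * x.2 : BR).
  by apply: measurable_funM => //; exact: measurable_snd.
apply: (@measurable_fun_pair _ _ _ (BR * BR)%type BR BR (fun x => c * x.1 - s * x.2)
  (fun x => s * x.1 + c * x.2)).
  exact: (measurable_funB (m1 c) (m2 s)).
exact: (measurable_funD (m1 s) (m2 c)).
Qed.

Lemma enorm_rotation c s x : c ^+ 2 + s ^+ 2 = 1 -> enorm (rotation c s x) = enorm x.
Proof.
move=> cs; rewrite /enorm /rotation /=; congr Num.sqrt.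
rewrite -[RHS]mul1r -cs; ring.
Qed.

(* A rotation which is not a multiple of the identity is a product of three shears. *)
Lemma plane_leb_rotation_shears c s (A : set (BR * BR)) :
  c ^+ 2 + s ^+ 2 = 1 -> s != 0 -> measurable A ->
  mu (rotation c s @^-1` A) = mu A.
Proof.
(* For [c = cos theta] and [s = sin theta] this is [- tan (theta / 2)], the factor of the two outer
   shears. *)
move=> cs s0 mA; pose a := (c - 1) / s.
have ml (k : R) : measurable_fun setT (fun x : BR => k * x : BR).
  by apply: measurable_funM.
have mS1 : measurable ((fun x : BR * BR => (x.1 + (a * x.2 : BR), x.2)) @^-1` A).
  rewrite -[_ @^-1` _]setTI; apply: (@measurable_fun_pair _ _ _ (BR * BR)%type BR BR) => //.
  by apply: measurable_funD => //; exact: (measurableT_comp (ml a)).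
have mS2 : measurable ((fun x : BR * BR => (x.1, x.2 + (s * x.1 : BR))) @^-1`
    ((fun x : BR * BR => (x.1 + (a * x.2 : BR), x.2)) @^-1` A)).
  rewrite -[_ @^-1` _]setTI; apply: (@measurable_fun_pair _ _ _ (BR * BR)%type BR BR) => //.
  by apply: measurable_funD => //; exact: (measurableT_comp (ml s)).
rewrite -(plane_leb_shear1 (ml a) mA) -(plane_leb_shear2 (ml s) mS1)
  -(plane_leb_shear1 (ml a) mS2).
congr (mu _); apply/seteqP; rewrite /preimage /= /rotation /a.
have E (x : BR * BR) : (c * x.1 - s * x.2, s * x.1 + c * x.2) =
  (x.1 + (c - 1) / s * x.2 + (c - 1) / s * (x.2 + s * (x.1 + (c - 1) / s * x.2)),
     x.2 + s * (x.1 + (c - 1) / s * x.2)).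
  have s2 : s ^+ 2 = 1 - c ^+ 2 by lra.
  congr pair; last by field.
  apply: (mulfI s0); rewrite mulrBr.
  have -> : s * (s * x.2) = (1 - c ^+ 2) * x.2 by rewrite -s2; ring.
  by field.
by split => x /=; rewrite E.
Qed.

Lemma plane_leb_rotation c s (A : set (BR * BR)) :
  c ^+ 2 + s ^+ 2 = 1 -> measurable A -> mu (rotation c s @^-1` A) = mu A.
Proof.
move=> cs mA; have [s0|] := eqVneq s 0; last by move=> ?; exact: plane_leb_rotation_shears.
move: cs; rewrite s0 expr0n addr0 => /eqP; rewrite sqrf_eq1 => /orP[|] /eqP ->.
  congr (mu _); apply/seteqP; split => -[x y];
    by rewrite /preimage /rotation /= !mul1r !mul0r subr0 add0r.
(* The half turn is not covered by the shears; it is the quarter turn applied twice. *)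
have q1 : (0 : R) ^+ 2 + 1 ^+ 2 = 1 by rewrite expr0n expr1n add0r.
have mA1 : measurable (rotation 0 1 @^-1` A).
  by rewrite -[_ @^-1` _]setTI; exact: measurable_rotation.
rewrite -(plane_leb_rotation_shears q1 (oner_neq0 _) mA).
rewrite -(plane_leb_rotation_shears q1 (oner_neq0 _) mA1).
congr (mu _); apply/seteqP; split => -[x y];
  by rewrite /preimage /rotation /= !(mul1r, mul0r, sub0r, subr0, addr0, add0r, mulN1r).
Qed.

Definition lune rho (z : R * R) : set (R * R) :=
  disk 0 rho `&` [set x | ~ disk 0 rho (x + z)].

Lemma measurable_lune rho z : measurable (lune rho z : set (BR * BR)).
Proof.
apply: measurableI; first exact: measurable_disk.
apply: measurableC.
rewrite -[X in measurable X]setTI; apply: (measurable_translate z) => //.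
exact: measurable_disk.
Qed.

(** The lune contains the strip of width [t] lying along the right arc at heights
    [|y| < rho - t / 2], which a shear turns into the rectangle [Q] of area [t (2 rho - t)]. At
    these heights [chord rho y] exceeds [t / 2], so the strip does not reach the left arc and stays
    inside the disk. *)
Lemma lune_horizontal rho t : 0 < t -> t <= 2 * rho ->
  ((t * (2 * rho - t))%:E <= mu (lune rho (t, 0%R)))%E.
Proof.
move=> t0 t2; have r0 : 0 < rho by lra.
pose Q : set (BR * BR) := `[- t, 0[%classic `*` `](- (rho - t / 2)), (rho - t / 2)[%classic.
have mQ : measurable Q by apply: measurableX; exact: measurable_itv.
have mc : measurable_fun setT (fun y : BR => - chord rho y : BR).
  by apply: measurableT_comp => //; apply: continuous_measurable_fun; exact: continuous_chord.
apply: (@le_trans _ _ (mu ((fun x => (x.1 + (- chord rho x.2 : BR), x.2)) @^-1` Q))).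
  rewrite (plane_leb_shear1 mc mQ) /Q plane_leb_rect; [|exact: measurable_itv|exact: measurable_itv].
  rewrite !lebesgue_measure_itv/= !lte_fin.
  have -> : - t < 0 by lra.
  case: ltP => h; rewrite -?EFinB -?EFinM ?mule0 lee_fin; [lra|].
  by rewrite mulr0 pmulr_rle0//; lra.
apply: le_measure; rewrite ?inE.
- rewrite -[_ @^-1` _]setTI; apply: (@measurable_fun_pair _ _ _ (BR * BR)%type BR BR) => //.
  apply: measurable_funD => //; exact: (measurableT_comp mc).
- exact: measurable_lune.
- move=> [x y] [] /=; rewrite !in_itv/= => /andP[h1 h2] /andP[h3 h4].
  have yr : y ^+ 2 < rho ^+ 2 - rho * t + t ^+ 2 / 4 by nra.
  have c2 : chord rho y ^+ 2 = rho ^+ 2 - y ^+ 2 by rewrite sqr_sqrtr//; nra.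
  have c0 : 0 <= chord rho y by exact: sqrtr_ge0.
  have c3 : t / 2 < chord rho y by nra.
  split; first by rewrite disk0E//=; nra.
  by move=> /(disk0E _ r0) /=; rewrite addr0; nra.
Qed.

(** The rotation that takes [(|z|, 0)] to [z] preserves area and the disk, and reduces the claim to
    a horizontal shift. *)
Lemma lune_ge rho z : enorm z <= 2 * rho ->
  ((enorm z * (2 * rho - enorm z))%:E <= mu (lune rho z))%E.
Proof.
move=> z2; have := sqrtr_ge0 (z.1 ^+ 2 + z.2 ^+ 2); rewrite -/(enorm z) le_eqVlt.
move=> /predU1P[<-|z0]; first by rewrite mul0r.
set t := enorm z in z0 z2 *.
have cs : (z.1 / t) ^+ 2 + (z.2 / t) ^+ 2 = 1.
  rewrite !expr_div_n -mulrDl -(sqr_sqrtr (addr_ge0 (sqr_ge0 z.1) (sqr_ge0 z.2))).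
  by rewrite -/(enorm z) -/t divff// expf_neq0// gt_eqF.
rewrite -(plane_leb_rotation cs (measurable_lune rho z)).
apply: le_trans (lune_horizontal z0 z2) _.
rewrite le_eqVlt; apply/orP; left; apply/eqP; congr (mu _).
have E x : rotation (z.1 / t) (z.2 / t) x + z = rotation (z.1 / t) (z.2 / t) (x + (t, 0)).
  have tn : t != 0 by rewrite gt_eqF.
  by apply: injective_projections; rewrite /rotation /=; field.
apply/seteqP; split => x; rewrite /lune /disk /= E !subr0 !enorm_rotation//.
Qed.

End rotation.

(** * Radial integrals by annuli *)

Section annuli.
Context {R : realType}.
Local Notation BR := (measurableTypeR R).
Local Notation mu := (@plane_leb R).

Lemma enorm_ge0 (x : R * R) : 0 <= enorm x.
Proof. exact: sqrtr_ge0. Qed.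

Lemma diskE rho (x : R * R) : disk 0 rho x <-> enorm x < rho.
Proof. by rewrite /disk /= subr0. Qed.

Lemma subset_disk (a b : R) : a <= b -> disk 0 a `<=` disk (0 : R * R) b.
Proof. by move=> ab x /diskE xa; apply/diskE; exact: lt_le_trans xa ab. Qed.

Lemma plane_leb_annulus (a b : R) : 0 < a -> a <= b ->
  mu (disk 0 b `\` disk 0 a) = (pi * (b ^+ 2 - a ^+ 2))%:E.
Proof.
move=> a0 ab; have b0 : 0 < b by lra.
have ma := @measurable_disk R a; have mb := @measurable_disk R b.
rewrite measureD//; last by rewrite [ltLHS](plane_leb_disk b0) ltry.
rewrite setIidr; last exact: subset_disk.
by rewrite [X in (X - _)%E](plane_leb_disk b0) [X in (_ - X)%E](plane_leb_disk a0) -EFinB mulrBr.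
Qed.

(* The lower bound [|z| (2 rho - |z|)] on the area of [lune rho z], over [|z|^3]. *)
Definition radial_bound rho (z : R * R) : R := (2 * rho - enorm z) / enorm z ^+ 2.

Lemma measurable_radial_bound rho a : 0 < a ->
  measurable_fun (disk 0 rho `\` disk 0 a) (radial_bound rho : BR * BR -> BR).
Proof.
move=> a0.
pose h (t : R) := (2 * rho - t) * (Order.max t a ^+ 2)^-1 : R.
apply: (@eq_measurable_fun _ _ _ _ _ (h \o (@enorm R))) => [z|].
  rewrite inE => -[_ /diskE/negP]; rewrite -leNgt => az.
  by rewrite /h /= max_l.
apply: measurable_funTS; apply: measurableT_comp; last exact: measurable_enorm.
apply: continuous_measurable_fun => t; apply: (@cvgM R R).
  by apply: (@cvgB _ R^o); [exact: cvg_cst|exact: cvg_id].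
apply: (@continuousV _ _ (fun t : R => Order.max t a ^+ 2 : R) t).
  by rewrite expf_neq0// gt_eqF// lt_max a0 orbT.
apply: (@continuous_comp _ _ _ (fun t : R => Order.max t a : R) (fun t : R => t ^+ 2)).
  by apply: (@continuous_max R R id (cst a)); [exact: cvg_id|exact: cvg_cst].
exact: exprn_continuous.
Qed.

(** [radial_bound rho] decreases with [|z|] inside the disk, so its value at the outer radius [b]
    bounds it from below. *)
Lemma annulus_radial_bound rho a b : 0 < a -> a <= b -> b <= rho ->
  ((pi * (b ^+ 2 - a ^+ 2) * ((2 * rho - b) / b ^+ 2))%:E <=
   \int[mu]_(z in disk 0%R b `\` disk 0%R a) (radial_bound rho z)%:E)%E.
Proof.
move=> a0 ab br; have b0 : 0 < b by lra.
have mA : measurable (disk 0 b `\` disk 0 a : set (BR * BR)).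
  by apply: measurableD; exact: measurable_disk.
rewrite mulrC EFinM -(plane_leb_annulus a0 ab) -integral_cst//.
apply: ge0_le_integral => //.
- by move=> z _; rewrite lee_fin divr_ge0 ?sqr_ge0//; lra.
- apply/measurable_EFinP; have H := @measurable_funS _ _ (BR * BR)%type BR _ _ (radial_bound rho)
    (measurableD (@measurable_disk R rho) (@measurable_disk R a))
    (@setSD _ (disk 0 a) _ _ (subset_disk br)) (@measurable_radial_bound rho _ a0).
  exact: H.
- move=> z [/diskE zb /diskE/negP]; rewrite -leNgt => az.
  have z0 : 0 < enorm z by lra.
  rewrite lee_fin /radial_bound ler_pM//.
  + lra.
  + by rewrite invr_ge0 sqr_ge0.
  + lra.
  + by rewrite lef_pV2 ?posrE ?exprn_gt0// ler_sqr ?nnegrE; lra.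
Qed.

(** A lower Riemann sum over annuli with radii in geometric progression. The factor [p ^+ (2 j)] of
    the area cancels against the squared radius in the denominator, so each annulus contributes
    almost equally: this is the source of the logarithm. *)
Lemma annuli_radial_bound rho p n : 0 < rho -> 0 < p -> p < 1 ->
  ((\sum_(j < n) pi * (1 - p ^+ 2) * rho * (2 - p ^+ j))%:E <=
   \int[mu]_(z in disk 0%R rho `\` disk 0%R (rho * p ^+ n)) (radial_bound rho z)%:E)%E.
Proof.
move=> r0 p0 p1; elim: n => [|n IH].
  by rewrite big_ord0 expr0 mulr1 setDv integral_set0.
have pn0 m : 0 < p ^+ m by rewrite exprn_gt0.
have pn1 m : p ^+ m <= 1 by rewrite exprn_ile1// ltW.
have le1 : rho * p ^+ n.+1 <= rho * p ^+ n.
  by rewrite ler_pM2l// exprS ler_piMl// ltW.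
have le2 : rho * p ^+ n <= rho by rewrite ler_piMr// ltW.
have mD a b : measurable (disk 0 b `\` disk 0 a : set (BR * BR)).
  by apply: measurableD; exact: measurable_disk.
have -> : disk 0 rho `\` disk 0 (rho * p ^+ n.+1) =
    (disk 0 rho `\` disk 0 (rho * p ^+ n)) `|`
    (disk 0 (rho * p ^+ n) `\` disk 0 (rho * p ^+ n.+1)) :> set (R * R).
  apply/seteqP; split => [x [xr xn]|x].
    by have [h|h] := pselect (disk 0 (rho * p ^+ n) x); [right|left].
  move=> [[xr xn]|[xn xn1]]; split => //.
    by move/(subset_disk le1).
  exact: (subset_disk le2).
have dis : [disjoint disk 0 rho `\` disk 0 (rho * p ^+ n) &
    disk 0 (rho * p ^+ n) `\` disk 0 (rho * p ^+ n.+1)].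
  by apply/disj_setPS => x [[_ h1] [h2 _]].
have mf : measurable_fun ((disk 0 rho `\` disk 0 (rho * p ^+ n)) `|`
    (disk 0 (rho * p ^+ n) `\` disk 0 (rho * p ^+ n.+1)))
    (fun z : BR * BR => (radial_bound rho z)%:E).
  apply/measurable_EFinP.
  have a0 : 0 < rho * p ^+ n.+1 by rewrite mulr_gt0.
  apply: (measurable_funS _ _ (@measurable_radial_bound rho _ a0)); first exact: mD.
  move=> x [[xr xn]|[xn xn1]]; split => //.
    by move/(subset_disk le1).
  exact: (subset_disk le2).
rewrite ge0_integral_setU//; last first.
  move=> x h; have /diskE xr : disk 0 rho x.
    by move: h => [[xr xn]|[xn xn1]] //; exact: (subset_disk le2).
  by rewrite lee_fin divr_ge0 ?sqr_ge0//; lra.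
rewrite big_ord_recr /= EFinD; apply: leeD; first exact: IH.
have a0 : 0 < rho * p ^+ n.+1 by rewrite mulr_gt0.
apply: le_trans (annulus_radial_bound a0 le1 le2).
rewrite lee_fin le_eqVlt; apply/orP; left; apply/eqP.
have pn := lt0r_neq0 (pn0 n); have rn := lt0r_neq0 r0.
rewrite (exprS p n); field.
by rewrite pn rn.
Qed.

(** The left side is [(1 + p) (1 - p ^+ n)]; the bound is uniform in the ratio and in the number of
    annuli. *)
Lemma geometric_sum_bound (p : R) n : 0 < p -> p < 1 ->
  (1 - p ^+ 2) * (\sum_(j < n) p ^+ j) <= 2.
Proof.
move=> p0 p1; have := subrX1 p n; set S := (\sum_(j < n) _) => h.
have pn0 : 0 < p ^+ n by rewrite exprn_gt0.
have -> : (1 - p ^+ 2) * S = (1 + p) * (1 - p ^+ n).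
  by rewrite -[1 - p ^+ n]opprB h; ring.
have pn1 : p ^+ n <= 1 by rewrite exprn_ile1// ltW.
nra.
Qed.

Lemma one_sub_exp_ge (x : R) : 0 <= x -> x - x ^+ 2 <= 1 - expR (- x).
Proof.
move=> x0; rewrite expRN.
have e1 := expR_ge1Dx x; have e0 : 0 < expR x by exact: expR_gt0.
have : (expR x)^-1 <= (1 + x)^-1 by rewrite lef_pV2// posrE; lra.
have : (1 + x)^-1 <= 1 - x + x ^+ 2.
  rewrite -[leLHS]mul1r ler_pdivrMr; last by lra.
  have -> : (1 - x + x ^+ 2) * (1 + x) = 1 + x ^+ 3 by ring.
  by rewrite lerDl exprn_ge0.
lra.
Qed.

(** In polar coordinates the integral is [2 pi rho (2 ln (rho / a) - 1 + a / rho)]. Replacing the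
    lower order terms by [- 3] leaves room for the discretisation error and keeps the coefficient of
    the logarithm sharp. *)
Lemma radial_bound_integral rho a : 0 < a -> a < rho ->
  ((2 * pi * rho * (2 * ln (rho / a) - 3))%:E <=
   \int[mu]_(z in disk 0%R rho `\` disk 0%R a) (radial_bound rho z)%:E)%E.
Proof.
have aux (l u v : R) : 2 * l - 1 <= u -> v <= 2 -> 4 * l - 6 <= 2 * u - v by lra.
move=> a0 ar; have r0 : 0 < rho by lra.
set L := ln (rho / a).
have ra1 : 1 < rho / a by rewrite ltr_pdivlMr// mul1r.
have L0 : 0 < L by rewrite ln_gt0.
(* So many annuli that the quadratic error [4 L ^+ 2 / n] in [n (1 - p ^+ 2)] is at most 1. *)
pose n := (Num.bound (4 * L ^+ 2)).+1.
have nL : 4 * L ^+ 2 <= n%:R.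
  have := archi_boundP (mulr_ge0 (ler0n R 4) (sqr_ge0 L)).
  by rewrite /n -natr1; lra.
have n0 : 0 < n%:R :> R by rewrite ltr0n.
(* The [n]-th root of [a / rho]: exactly [n] annuli fill the gap between the two radii. *)
pose p := expR (- (L / n%:R)).
have p0 : 0 < p by exact: expR_gt0.
have p1 : p < 1 by rewrite expR_lt1 oppr_lt0 divr_gt0.
have pn : rho * p ^+ n = a.
  rewrite /p -expRM_natl.
  have -> : n%:R * - (L / n%:R) = - L by field; rewrite gt_eqF.
  rewrite expRN lnK ?posrE ?divr_gt0//; field.
  by rewrite !gt_eqF.
have := @annuli_radial_bound rho p n r0 p0 p1; rewrite pn; apply: le_trans.
rewrite lee_fin -mulr_sumr sumrB sumr_const card_ord.
have gs := geometric_sum_bound n p0 p1.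
set S := (\sum_(j < n) _) in gs *.
have h : 2 * L - 1 <= n%:R * (1 - p ^+ 2).
  have -> : p ^+ 2 = expR (- (2 * L / n%:R)).
    by rewrite /p -expRM_natl; congr expR; field; rewrite gt_eqF.
  have x0 : 0 <= 2 * L / n%:R by rewrite divr_ge0 ?ltW// mulr_gt0.
  apply: (@le_trans _ _ (n%:R * (2 * L / n%:R - (2 * L / n%:R) ^+ 2))).
    have -> : n%:R * (2 * L / n%:R - (2 * L / n%:R) ^+ 2) = 2 * L - 4 * L ^+ 2 / n%:R.
      by field; rewrite gt_eqF.
    by rewrite lerD2l lerN2 ler_pdivrMr// mul1r.
  by rewrite ler_pM2l// one_sub_exp_ge.
have pr0 : 0 < pi * rho by rewrite mulr_gt0 ?pi_gt0.
have -> : 2 * pi * rho * (2 * L - 3) = pi * rho * (4 * L - 6) by ring.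
have -> : pi * (1 - p ^+ 2) * rho * (2 *+ n - S) =
    pi * rho * (2 * (n%:R * (1 - p ^+ 2)) - (1 - p ^+ 2) * S).
  by rewrite -mulr_natr; ring.
by rewrite ler_pM2l//; exact: aux.
Qed.

(** Dyadic decomposition: between the radii [2 ^+ k delta] and [r k] the kernel is at most [c k],
    and [c k] times the area of the disk of radius [r k] is a geometric sequence of ratio 1/2. *)
Lemma jump_kernel_integral_lty delta : 0 < delta ->
  (\int[mu]_z (jump_kernel delta z)%:E < +oo)%E.
Proof.
move=> d0.
pose c k : R := ((2 ^+ k * delta) ^+ 3)^-1.
pose r k : R := 2 ^+ k.+1 * delta.
have r0 k : 0 < r k by rewrite mulr_gt0// exprn_gt0.
have c0 k : 0 < c k by rewrite invr_gt0 exprn_gt0// mulr_gt0// exprn_gt0.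
have mD k : measurable (disk 0 (r k) : set (BR * BR)) by exact: measurable_disk.
have mf k : measurable_fun setT (fun z : BR * BR => (c k * \1_(disk 0 (r k)) z)%:E).
  apply/measurable_EFinP.
  exact: (@measurable_funM _ _ _ _ (cst (c k)) _ (measurable_cst _) (measurable_indic (mD k))).
have f0 k (z : R * R) : (0 <= (c k * \1_(disk 0 (r k)) z)%:E)%E.
  by rewrite lee_fin mulr_ge0// ltW.
apply: (@le_lt_trans _ _ (\int[mu]_z \sum_(k <oo) (c k * \1_(disk 0%R (r k)) z)%:E)%E).
  apply: ge0_le_integral => //.
  - by move=> z _; rewrite lee_fin jump_kernel_ge0.
  - by apply/measurable_EFinP; exact: measurable_jump_kernel.
  - exact: ge0_emeasurable_sum.
  - move=> z _; rewrite jump_kernelE//; case: ifPn => [dz|_]; last exact: nneseries_ge0.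
    have ex : exists k, enorm z < r k.
      exists (Num.bound (enorm z / delta)).
      rewrite -ltr_pdivrMr//.
      apply: lt_trans (archi_boundP _) _; first by rewrite divr_ge0 ?enorm_ge0// ltW.
      by rewrite -natrX ltr_nat (leq_trans (ltn_expl _ (ltnSn 1)))// leq_exp2l.
    (* Minimality of [k] bounds [|z|] below by the preceding radius; for [k = 0] the cutoff
       [delta < |z|] takes over. *)
    case: (ex_minnP ex) => k zk kmin.
    apply: (@le_trans _ _ (c k * \1_(disk 0 (r k)) z)%:E).
      rewrite lee_fin indicE mem_set ?mulr1; last by apply/diskE.
      have zpos : 0 < enorm z by lra.
      have kz : 2 ^+ k * delta <= enorm z.
        case: (k) kmin => [_|m km]; first by rewrite expr0 mul1r ltW.
        rewrite leNgt; apply/negP => h; have := km m h; by rewrite ltnn.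
      rewrite lef_pV2 ?posrE ?exprn_gt0// ?mulr_gt0 ?exprn_gt0//.
      by rewrite lerXn2r// nnegrE ltW// mulr_gt0 ?exprn_gt0.
    rewrite (@nneseriesD1 R (fun k => (c k * \1_(disk 0 (r k)) z)%:E) k xpredT)//=.
    by rewrite leeDl// nneseries_ge0.
rewrite integral_nneseries//.
rewrite (eq_eseriesr (g := fun k => (8 * pi / delta / (2 ^ (k + 1))%:R)%:E)); last first.
  move=> k _.
  rewrite (_ : (fun z => _) = (fun z => (c k)%:E * (\1_(disk 0 (r k)) z)%:E)%E)
    ?ge0_integralZl//.
  - rewrite integral_indic// setIT [X in (_ * X)%E](plane_leb_disk (r0 k)) -EFinM; congr EFin.
    rewrite /c /r addn1 natrX !(exprS 2 k); field.
    by rewrite gt_eqF// gt_eqF// exprn_gt0.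
  - by apply/measurable_EFinP; exact: measurable_indic.
  - by rewrite lee_fin ltW.
have := @cvg_geometric_eseries_half R (8 * pi / delta) 0.
move/cvg_lim => ->//; exact: ltry.
Qed.

End annuli.

(** * Separable test functions *)

Section separable.
Context {R : realType}.
Implicit Types (a b : R -> R) (f g phi psi : R * R -> R).

Definition C1_line a : Prop :=
  (forall x, derivable a x 1) /\ continuous (derive1 a).

Lemma C1_line_is_derive a : C1_line a -> forall x : R, is_derive x 1 a (derive1 a x).
Proof. by move=> [da _] x; rewrite derive1E; exact: derivableP. Qed.

Lemma is_derive_C1_line a a' : (forall x : R, is_derive x 1 a (a' x)) ->
  continuous a' -> C1_line a.
Proof.
move=> da ca'; split=> [x|]; first by have [] := da x.
rewrite (_ : derive1 a = a')//; apply/funext => x; rewrite derive1E.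
exact: derive_val.
Qed.

Lemma C1_line_continuous a : C1_line a -> continuous a.
Proof.
by move=> [da _] x; exact/differentiable_continuous/derivable1_diffP.
Qed.

Lemma C1_line_cst (c : R) : C1_line (cst c).
Proof.
apply: (@is_derive_C1_line _ (cst 0) (fun x => is_derive_cst c x 1)).
exact: cst_continuous.
Qed.

Lemma C1_lineM a b : C1_line a -> C1_line b -> C1_line (fun x => a x * b x).
Proof.
move=> ca cb; have [_ ca'] := ca; have [_ cb'] := cb.
have Da := C1_line_is_derive ca; have Db := C1_line_is_derive cb.
apply: (@is_derive_C1_line _ (fun x => a x * derive1 b x + b x * derive1 a x)
  (fun x => is_deriveM (Da x) (Db x))).
move=> x.
apply: (@cvgD _ R^o).
  by apply: (@cvgM R R); [exact: C1_line_continuous|exact: cb'].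
by apply: (@cvgM R R); [exact: C1_line_continuous|exact: ca'].
Qed.

Lemma C1_line_shift a (s : R) : C1_line a -> C1_line (fun x => a (x - s)).
Proof.
move=> ca.
have D (x : R) : is_derive x 1 (fun x => a (x - s)) (derive1 a (x - s)).
  have := C1_line_is_derive ca (x - s) => D.
  have := @is_derive1_comp _ a (fun x => x - s) x _ 1 D.
  rewrite mulr1; apply.
  exact: (is_derive_shift x 1 (- s)).
apply: (is_derive_C1_line D).
move=> x; apply: (@continuous_comp _ _ _ (fun x : R => x - s) (derive1 a)).
  2: by case: ca => _; apply.
by apply: (@cvgB _ R^o); [exact: cvg_id|exact: cvg_cst].
Qed.

(** Since [a] vanishes on the negative axis it is integrable on every ray []-oo, x]], and one
    integral with fixed lower end serves all [x]. *)
Lemma antiderivative_halfline a : continuous a -> (forall x : R, x <= 0 -> a x = 0) ->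
  exists A : R -> R, forall x : R, is_derive x 1 A (a x).
Proof.
move=> ca a0.
have int u : (@lebesgue_measure R).-integrable `]-oo, u] (EFin \o a).
  have : (@lebesgue_measure R).-integrable `[0, u] (EFin \o a).
    by apply: continuous_compact_integrable; [exact: segment_compact|exact: continuous_subspaceT].
  move/integrable_mkcond => H; apply/integrable_mkcond; first exact: measurable_itv.
  apply: eq_integrable (H _) => //.
  move=> x _; rewrite !patchE !mem_setE !in_itv/=; case: ifPn => [/andP[_ ->//]|].
  rewrite negb_and -ltNge => /orP[x0|/negbTE ->//].
  by case: ifP => // _; rewrite /= a0// ltW.
exists (fun x => \int[@lebesgue_measure R]_(t in `]-oo, x]) a t) => x.
have [] := @continuous_FTC1 _ a -oo%O x (x + 1) _ (int _) _ (ca x).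
- by rewrite ltrDl.
- by rewrite ltNyr.
- by move=> dA <-; rewrite derive1E; exact: derivableP.
Qed.

(** After subtraction of [a 0] the function splits into a part living on the positive axis and one
    on the negative axis, which is reflected; the subtracted constant returns as the linear term. *)
Lemma C1_line_antiderivative a : continuous a ->
  exists2 A, C1_line A & forall x : R, is_derive x 1 A (a x).
Proof.
move=> ca.
have [|x x0|A1 D1] := @antiderivative_halfline (fun x => a (Order.max x 0) - a 0).
- move=> x; apply: (@cvgB _ R^o); last exact: cvg_cst.
  apply: (@continuous_comp _ _ _ (fun x : R => Order.max x 0) a); last exact: ca.
  by apply: (@continuous_max R R id (cst 0)); [exact: cvg_id|exact: cvg_cst].
- by rewrite max_r// subrr.
have [|x x0|A2 D2] := @antiderivative_halfline (fun x => a (- Order.max x 0) - a 0).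
- move=> x; apply: (@cvgB _ R^o); last exact: cvg_cst.
  apply: (@continuous_comp _ _ _ (fun x : R => - Order.max x 0) a); last exact: ca.
  apply: (@cvgN _ R^o).
  by apply: (@continuous_max R R id (cst 0)); [exact: cvg_id|exact: cvg_cst].
- by rewrite max_r// oppr0 subrr.
have D (x : R) : is_derive x 1 (fun x => A1 x - A2 (- x) + a 0 * x) (a x).
  have D2N : is_derive x 1 (fun x => A2 (- x)) ((a (- Order.max (- x) 0) - a 0) * - 1).
    exact: (@is_derive1_comp _ A2 -%R x _ _ (D2 (- x)) (is_deriveN (is_derive_id x 1))).
  have Dl : is_derive x 1 (fun x => a 0 * x) (a 0 * 1).
    by rewrite -[a 0 * 1]/(a 0 *: 1); apply: is_deriveZ.
  apply: is_derive_eq (is_deriveD (is_deriveB (D1 x) D2N) Dl) _.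
  rewrite mulrN1 opprK mulr1; case: (leP x 0) => x0.
    by rewrite max_l ?oppr_ge0// opprK; ring.
  by rewrite max_r ?oppr_le0 ?ltW// oppr0; ring.
by exists (fun x => A1 x - A2 (- x) + a 0 * x) => //; exact: is_derive_C1_line D ca.
Qed.

(* Partial antiderivatives of such functions are C1 without differentiating under
   an integral sign. *)
Inductive separable : (R * R -> R) -> Prop :=
| separable_prod a b : C1_line a -> C1_line b ->
    separable (fun x => a x.1 * b x.2)
| separable_add f g : separable f -> separable g ->
    separable (fun x => f x + g x).

Lemma separable_cst (c : R) : separable (cst c).
Proof.
have -> : cst c = (fun x : R * R => cst c x.1 * cst 1 x.2).
  by apply/funext => x /=; rewrite mulr1.
by apply: separable_prod; exact: C1_line_cst.
Qed.

Lemma separableM f g : separable f -> separable g -> separable (fun x => f x * g x).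
Proof.
move=> sf sg; elim: sf => [a b ca cb|f1 f2 _ H1 _ H2]; last first.
  under eq_fun do rewrite mulrDl; exact: separable_add.
elim: sg => [a' b' ca' cb'|g1 g2 _ H1 _ H2]; last first.
  under eq_fun do rewrite mulrDr; exact: separable_add.
under eq_fun do rewrite mulrACA.
exact: (separable_prod (C1_lineM ca ca') (C1_lineM cb cb')).
Qed.

Lemma separableZ (k : R) f : separable f -> separable (fun x => k * f x).
Proof. by move=> sf; exact: (separableM (separable_cst k) sf). Qed.

Lemma separableB f g : separable f -> separable g -> separable (fun x => f x - g x).
Proof.
move=> sf sg; under eq_fun do rewrite -mulN1r.
by apply: separable_add => //; exact: separableZ.
Qed.

Lemma separable_shift (s : R) f : separable f -> separable (fun x => f (x.1 - s, x.2)).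
Proof.
elim=> [a b ca cb|f1 f2 _ H1 _ H2]; last exact: separable_add.
exact: (separable_prod (C1_line_shift s ca) cb).
Qed.

Lemma separable_swap f : separable f -> separable (fun x => f (x.2, x.1)).
Proof.
elim=> [a b ca cb|f1 f2 _ H1 _ H2]; last exact: separable_add.
under eq_fun do rewrite /= mulrC; exact: separable_prod.
Qed.

Lemma separable_antiderivative f : separable f ->
  exists2 F, separable F & forall x y : R, is_derive x 1 (fun t => F (t, y)) (f (x, y)).
Proof.
elim=> [a b ca cb|f1 f2 _ [F1 s1 D1] _ [F2 s2 D2]]; last first.
  exists (fun x => F1 x + F2 x); first exact: separable_add.
  by move=> x y; exact: is_deriveD.
have [A cA dA] := C1_line_antiderivative (C1_line_continuous ca).
exists (fun x => A x.1 * b x.2); first exact: separable_prod.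
move=> x y /=; apply: is_derive_eq (is_deriveM (dA x) (is_derive_cst (b y) x 1)) _.
by rewrite scaler0 add0r mulrC.
Qed.

Definition C1_scalar f : Prop :=
  (forall x, differentiable f x) /\ (forall v : R * R, continuous (fun x => 'D_v f x)).

Lemma derive_line a (x u : R) : derivable a x 1 -> 'D_u a x = u * derive1 a x.
Proof.
move=> da; rewrite deriveE; last exact/derivable1_diffP.
by rewrite deriv1E.
Qed.

Lemma separable_C1 f : separable f -> C1_scalar f.
Proof.
elim=> [a b [da ca] [db cb]|f1 f2 _ [d1 c1] _ [d2 c2]]; last first.
  split=> [x|v]; first exact: differentiableD.
  rewrite (_ : (fun x => _) = (fun x => 'D_v f1 x + 'D_v f2 x)).
    by move=> x; apply: (@cvgD _ R^o); [exact: c1|exact: c2].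
  by apply/funext => x; rewrite deriveD//; exact: diff_derivable.
have ca' : continuous a by exact: C1_line_continuous.
have cb' : continuous b by exact: C1_line_continuous.
have dfst (x : R * R) : differentiable (fun x : R * R => a x.1) x.
  apply: (@differentiable_comp _ _ _ _ fst a).
    by apply: linear_differentiable => y; exact: cvg_fst.
  exact/derivable1_diffP.
have dsnd (x : R * R) : differentiable (fun x : R * R => b x.2) x.
  apply: (@differentiable_comp _ _ _ _ snd b).
    by apply: linear_differentiable => y; exact: cvg_snd.
  exact/derivable1_diffP.
split=> [x|v]; first exact: differentiableM.
rewrite (_ : (fun x => _) = (fun x => a x.1 * (v.2 * derive1 b x.2)
    + b x.2 * (v.1 * derive1 a x.1))); last first.
  apply/funext => x; rewrite deriveM; [|exact: diff_derivable|exact: diff_derivable].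
  have -> : 'D_v (fun x : R * R => a x.1) x = 'D_(v.1) a x.1 by [].
  have -> : 'D_v (fun x : R * R => b x.2) x = 'D_(v.2) b x.2 by [].
  by rewrite !derive_line.
move=> x.
have c1 (h : R -> R) : continuous h -> h y.1 @[y --> x] --> h x.1.
  by move=> ch; apply: (@continuous_comp _ _ _ fst h); [exact: cvg_fst|exact: ch].
have c2 (h : R -> R) : continuous h -> h y.2 @[y --> x] --> h x.2.
  by move=> ch; apply: (@continuous_comp _ _ _ snd h); [exact: cvg_snd|exact: ch].
have k2 : v.2 * derive1 b y.2 @[y --> x] --> v.2 * derive1 b x.2.
  exact: (cvgM (cvg_cst v.2) (c2 _ cb)).
have k1 : v.1 * derive1 a y.1 @[y --> x] --> v.1 * derive1 a x.1.
  exact: (cvgM (cvg_cst v.1) (c1 _ ca)).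
exact: (@cvgD _ R^o _ _ _ _ _ _ _ (cvgM (c1 a ca') k2) (cvgM (c2 b cb') k1)).
Qed.

Lemma separable_continuous f : separable f -> continuous f.
Proof. by move=> /separable_C1[d _] x; exact: differentiable_continuous. Qed.

Lemma derive_pair0 f v (x : R * R) : derivable f x v ->
  'D_v (fun x => (f x, 0 : R)) x = ('D_v f x, 0).
Proof.
move=> df; apply: cvg_lim => //.
rewrite (_ : (fun h : R => _) = (fun h : R => (h^-1 *: (f (h *: v + x) - f x), 0 : R))).
  exact: (@cvg_pair _ _ _ _ (nbhs ('D_v f x)) (nbhs (0 : R)) _ _ _ _ (cst 0) df (cvg_cst _)).
apply/funext => h; apply: injective_projections => //=.
by rewrite subrr scaler0.
Qed.

Lemma derive_0pair f v (x : R * R) : derivable f x v ->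
  'D_v (fun x => (0 : R, f x)) x = (0, 'D_v f x).
Proof.
move=> df; apply: cvg_lim => //.
rewrite (_ : (fun h : R => _) = (fun h : R => (0 : R, h^-1 *: (f (h *: v + x) - f x)))).
  exact: (@cvg_pair _ _ _ _ (nbhs (0 : R)) (nbhs ('D_v f x)) _ _ _ (cst 0) _ (cvg_cst _) df).
apply/funext => h; apply: injective_projections => //=.
by rewrite subrr scaler0.
Qed.

Lemma C1_pair0 f : C1_scalar f -> C1 (fun x => (f x, 0 : R)).
Proof.
move=> [df cf]; split=> [x|v].
  by apply: differentiable_pair => //; exact: differentiable_cst.
rewrite (_ : (fun x => _) = (fun x => ('D_v f x, 0 : R))).
  by move=> x; exact: (@cvg_pair _ _ _ _ (nbhs ('D_v f x)) (nbhs (0 : R)) _ _ _ _ (cst 0) (cf v x) (cvg_cst _)).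
by apply/funext => x; rewrite derive_pair0//; exact: diff_derivable.
Qed.

Lemma C1_0pair f : C1_scalar f -> C1 (fun x => (0 : R, f x)).
Proof.
move=> [df cf]; split=> [x|v].
  by apply: differentiable_pair => //; exact: differentiable_cst.
rewrite (_ : (fun x => _) = (fun x => (0 : R, 'D_v f x))).
  by move=> x; exact: (@cvg_pair _ _ _ _ (nbhs (0 : R)) (nbhs ('D_v f x)) _ _ _ (cst 0) _ (cvg_cst _) (cf v x)).
by apply/funext => x; rewrite derive_0pair//; exact: diff_derivable.
Qed.

End separable.

(** * One-variable profiles: bumps and ramps *)

Section cutoff.
Context {R : realType}.

(** Squaring the positive part makes it continuously differentiable. *)
Definition sqr_pos (u : R) : R := Order.max u 0 ^+ 2.

Lemma is_derive_sqr_pos (u : R) : is_derive u 1 sqr_pos (2 * Order.max u 0).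
Proof.
apply: is_derive_of_cvg.
apply/cvgrPdist_le => e e0; near=> h.
have h0 : h != 0 by near: h; exact: nbhs_dnbhs_neq.
have hp : 0 < `|h| by rewrite normr_gt0.
have he : `|h| <= e by near: h; apply: dnbhs0_le.
apply: le_trans he.
rewrite -[h *: 1]/(h * 1) mulr1 -[_ *: _]/(h^-1 * _).
(* The difference quotient differs from the claimed derivative by at most [|h|]. *)
have -> : 2 * Order.max u 0 - h^-1 * (sqr_pos (h + u) - sqr_pos u) =
    h^-1 * (2 * h * Order.max u 0 - (sqr_pos (h + u) - sqr_pos u)) by field.
rewrite normrM normfV ler_pdivrMl// -normrM -expr2 (ger0_norm (sqr_ge0 h)).
rewrite /sqr_pos ler_norml; case: (leP u 0); case: (leP (h + u) 0) => h1 h2;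
  apply/andP; split; nra.
Unshelve. all: by end_near. Qed.

Definition bump (L x : R) : R := sqr_pos (1 - (x / L) ^+ 2).

Lemma C1_line_bump (L : R) : C1_line (bump L).
Proof.
have D (x : R) : is_derive x 1 (fun x => 1 - (x / L) ^+ 2) (- (2 * (x / L) / L)).
  have Dl : is_derive x 1 (fun x => x / L) L^-1.
    under eq_fun do rewrite mulrC.
    have := is_deriveZ L^-1 (is_derive_id x (1 : R)).
    by rewrite -[L^-1 *: 1]/(L^-1 * 1) mulr1.
  have Dm := is_deriveM Dl Dl.
  apply: is_derive_eq (is_deriveB (is_derive_cst (1 : R) x 1) Dm) _.
  by rewrite sub0r -![_ *: _]/(_ * _); congr (- _); ring.
have D' (x : R) := @is_derive1_comp _ sqr_pos (fun x => 1 - (x / L) ^+ 2) x _ _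
  (is_derive_sqr_pos (1 - (x / L) ^+ 2)) (D x).
apply: (is_derive_C1_line D') => x.
have cl : continuous (fun x : R => x / L).
  by move=> y; apply: cvgM; [exact: cvg_id|exact: cvg_cst].
have cq : continuous (fun x : R => 1 - (x / L) ^+ 2).
  move=> y; apply: (@cvgB _ R^o); first exact: cvg_cst.
  exact: (cvgM (cl y) (cl y)).
have cm : continuous (fun x : R => Order.max (1 - (x / L) ^+ 2) 0).
  by move=> y; apply: (@continuous_max R R (fun x => 1 - (x / L) ^+ 2) (cst 0));
    [exact: cq|exact: cvg_cst].
have k1 : 2 * Order.max (1 - (y / L) ^+ 2) 0 @[y --> x] --> 2 * Order.max (1 - (x / L) ^+ 2) 0.
  exact: cvgM (cvg_cst _) (cm x).
have k2 : - (2 * (y / L) / L) @[y --> x] --> - (2 * (x / L) / L).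
  apply: (@cvgN _ R^o); exact: cvgM (cvgM (cvg_cst _) (cl x)) (cvg_cst _).
exact: cvgM k1 k2.
Qed.

Lemma bump_ge0 L x : 0 <= bump L x. Proof. exact: sqr_ge0. Qed.

Lemma bump_le1 L x : bump L x <= 1.
Proof.
rewrite /bump /sqr_pos expr_le1//; last by rewrite le_max lexx orbT.
by rewrite ge_max ler01 andbT gerBl sqr_ge0.
Qed.

Lemma bump_outside L x : 0 < L -> L < `|x| -> bump L x = 0.
Proof.
move=> L0 xL; rewrite /bump /sqr_pos max_r ?expr0n// subr_le0.
rewrite -(real_normK (num_real (x / L))) exprn_ege1// normrM normfV (gtr0_norm L0).
by rewrite ler_pdivlMr// mul1r ltW.
Qed.

(** The value 3/4 is chosen so that the product of two bumps still exceeds 1/2 on the inner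
    square. *)
Lemma bump_inside M x : 0 < M -> `|x| <= M -> 3 / 4 <= bump (4 * M) x.
Proof.
move=> M0 xM; rewrite /bump /sqr_pos.
have h : (x / (4 * M)) ^+ 2 <= 1 / 16.
  rewrite expr_div_n ler_pdivrMr ?exprn_gt0 ?mulr_gt0//.
  have : x ^+ 2 <= M ^+ 2 by rewrite -(real_normK (num_real x)) lerXn2r ?nnegrE// ltW.
  by rewrite exprMn; lra.
rewrite max_l; last by lra.
have := sqr_ge0 (x / (4 * M)); nra.
Qed.

(* Decreases in [x] and tends to 1 at every [x <= c], including [x = c], since the
   inner exponent is then at most [- n]. *)
Definition ramp (n : nat) (c x : R) : R :=
  expR (- expR (n%:R * (n%:R * (x - c) - 1))).

Lemma C1_line_ramp n c : C1_line (ramp n c).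
Proof.
have D (x : R) : is_derive x 1 (fun x => n%:R * (n%:R * (x - c) - 1)) (n%:R * n%:R).
  have D1 : is_derive x 1 (fun x => x - c) 1 := is_derive_shift x 1 (- c).
  have D2 : is_derive x 1 (fun x => n%:R * (x - c)) n%:R.
    by have := is_deriveZ n%:R D1; rewrite -[n%:R *: 1]/(n%:R * 1) mulr1.
  have D3 := is_deriveB D2 (is_derive_cst (1 : R) x 1).
  by have := is_deriveZ n%:R D3; rewrite subr0.
have D1 (x : R) := @is_derive1_comp _ expR (fun x => n%:R * (n%:R * (x - c) - 1)) x _ _
  (is_derive_expR _) (D x).
have D2 (x : R) := is_deriveN (D1 x).
have D3 (x : R) := @is_derive1_comp _ expR
  (fun x => - expR (n%:R * (n%:R * (x - c) - 1))) x _ _ (is_derive_expR _) (D2 x).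
apply: (is_derive_C1_line D3) => x.
have cd (f : R -> R) (df : R) : is_derive x 1 f df -> f y @[y --> x] --> f x.
  by move=> [d _]; exact/differentiable_continuous/derivable1_diffP.
apply: cvgM; first exact: (cd _ _ (D3 x)).
apply: (@cvgN _ R^o); apply: cvgM; last exact: cvg_cst.
exact: (cd _ _ (D1 x)).
Qed.

Lemma ramp_ge0 n c x : 0 <= ramp n c x. Proof. exact: expR_ge0. Qed.

Lemma ramp_le1 n c x : ramp n c x <= 1.
Proof. by rewrite -expR0 ler_expR oppr_le0 expR_ge0. Qed.

Lemma expRN_le_inv (u : R) : 0 <= u -> expR (- u) <= (1 + u)^-1.
Proof.
move=> u0; rewrite expRN lef_pV2 ?posrE ?expR_gt0//; last by rewrite ltr_pwDl.
exact: expR_ge1Dx.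
Qed.

Lemma cvg_ramp c x : ramp n c x @[n --> \oo] --> (\1_(`]-oo, c]) x : R).
Proof.
apply/cvgrPdist_le => e e0.
have [N _ HN] : \forall n \near \oo, n.+1%:R^-1 < e :> R.
  exact: (near_infty_natSinv_lt (PosNum e0)).
have bnd n : (1 + n%:R : R)^-1 = n.+1%:R^-1 by rewrite -natr1 addrC.
have [xc|xc] := leP x c.
  exists N => // n /= Nn; apply: le_trans (ltW (HN n Nn)).
  rewrite indicE mem_setE in_itv/= xc -[true%:R]/(1 : R) ger0_norm;
    last by rewrite subr_ge0 ramp_le1.
  rewrite /ramp; set y := expR (_ * _).
  have h1 : 1 - y <= expR (- y) by exact: expR_ge1Dx.
  apply: (@le_trans _ _ y); first by lra.
  apply: (@le_trans _ _ (expR (- n%:R))).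
    rewrite ler_expR mulrBr mulr1 gerDr.
    by rewrite mulr_ge0_le0// mulr_ge0_le0// subr_le0.
  by rewrite -bnd expRN_le_inv.
(* From this index on [n (x - c) - 1] is at least 1, so the inner exponent is at least [n]. *)
have [k kx] : exists k : nat, 2 / (x - c) <= k%:R.
  exists (Num.bound (2 / (x - c))); apply: ltW; apply: archi_boundP.
  by rewrite divr_ge0// subr_ge0 ltW.
exists (maxn N k) => // n /=; rewrite geq_max => /andP[Nn kn].
apply: le_trans (ltW (HN n Nn)).
rewrite indicE memNset; last by rewrite /= in_itv/= leNgt xc.
rewrite sub0r normrN ger0_norm ?ramp_ge0//.
have xc0 : 0 < x - c by rewrite subr_gt0.
have h2 : 2 <= n%:R * (x - c).
  rewrite -ler_pdivrMr// (le_trans kx)// ler_nat//.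
have n0 : 0 <= n%:R :> R by [].
have h3 : n%:R <= n%:R * (n%:R * (x - c) - 1) by rewrite ler_peMr//; lra.
apply: (@le_trans _ _ (expR (- n%:R))); last by rewrite -bnd expRN_le_inv.
rewrite ler_expR lerN2; apply: le_trans h3 _.
by apply: le_trans (expR_ge1Dx _); rewrite lerDr.
Qed.

End cutoff.

(** * Density of separable functions in L1 of a finite measure *)

Section approximation.
Context {R : realType}.
Local Notation BR := (measurableTypeR R).
Context (m : {measure set (BR * BR) -> \bar R}).
Context (mfin : (m setT < +oo)%E).
Implicit Types (A B : set (BR * BR)) (f g : R * R -> R).

(** The range condition [0 <= f <= 1] is part of the class because the closure under intersections,
    realised by products, relies on it. *)
Definition approximable A : Prop := measurable A /\
  forall e : R, 0 < e -> exists f, [/\ separable f, forall x, 0 <= f x <= 1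
    & (\int[m]_x `|\1_A x - f x|%:E <= e%:E)%E].

Lemma measurable_separable f : separable f -> measurable_fun setT (f : BR * BR -> BR).
Proof. by move=> sf; exact: continuous_measurable2 (separable_continuous sf). Qed.

Lemma measurable_approx_error A f : measurable A -> separable f ->
  measurable_fun setT (fun x : BR * BR => `|\1_A x - f x|%:E).
Proof.
move=> mA sf; apply/measurable_EFinP; apply: measurableT_comp => //.
by apply: measurable_funB; [exact: measurable_indic|exact: measurable_separable].
Qed.

Lemma approximableC A : approximable A -> approximable (~` A).
Proof.
move=> [mA HA]; split; first exact: measurableC.
move=> e e0; have [f [sf f01 fe]] := HA e e0.
exists (fun x => 1 - f x); split.
- exact: separableB (separable_cst 1) sf.
- by move=> x; have := f01 x; lra.
- apply: le_trans fe; rewrite le_eqVlt; apply/orP; left; apply/eqP.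
  apply: eq_integral => x _; congr EFin; rewrite -normrN; congr `|_|.
  rewrite !indicE in_setC; case: (x \in A) => /=; ring.
Qed.

Lemma approximableI A B : approximable A -> approximable B -> approximable (A `&` B).
Proof.
move=> [mA HA] [mB HB]; split; first exact: measurableI.
move=> e e0; have e2 : 0 < e / 2 by rewrite divr_gt0.
have [f [sf f01 fe]] := HA _ e2; have [g [sg g01 ge]] := HB _ e2.
exists (fun x => f x * g x); split; first exact: separableM.
  by move=> x; have := f01 x; have := g01 x; nra.
apply: (@le_trans _ _ (\int[m]_x (`|\1_A x - f x|%:E + `|\1_B x - g x|%:E))%E).
  apply: ge0_le_integral => //.
  - apply: measurable_approx_error; [exact: measurableI|exact: separableM].
  - by apply: emeasurable_funD; exact: measurable_approx_error.
  - move=> x _; rewrite -EFinD lee_fin indicI.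
    have h (u v a b : R) : 0 <= u <= 1 -> 0 <= b <= 1 ->
        `|u * v - a * b| <= `|u - a| + `|v - b|.
      move=> u01 b01; have -> : u * v - a * b = u * (v - b) + b * (u - a) by ring.
      apply: le_trans (ler_normD _ _) _; rewrite addrC !normrM lerD//.
        by rewrite ler_piMl// ger0_norm; lra.
      by rewrite ler_piMl// ger0_norm; lra.
    by apply: h => //; rewrite indicE; case: (_ \in _); rewrite ?ler01 ?lexx.
rewrite ge0_integralD//; try exact: measurable_approx_error.
by apply: le_trans (leeD fe ge) _; rewrite -EFinD -splitr.
Qed.

Lemma approximable0 : approximable set0.
Proof.
split=> // e e0; exists (cst 0); split; first exact: separable_cst.
  by move=> x; rewrite lexx ler01.
by rewrite integral0_eq ?lee_fin ?ltW// => x _; rewrite indic0 subrr normr0.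
Qed.

(** Finite unions come from complements and intersections; since the measure is finite, a finite
    union misses arbitrarily little of the whole. *)
Lemma approximable_bigcup (F : nat -> set (BR * BR)) :
  (forall n, approximable (F n)) -> approximable (\bigcup_n F n).
Proof.
move=> HF.
have mF n : measurable (F n) by have [] := HF n.
have mU : measurable (\bigcup_n F n) by exact: bigcupT_measurable.
split=> // e e0; have e2 : 0 < e / 2 by rewrite divr_gt0.
pose B n := \bigcup_(i < n) F i.
have HB n : approximable (B n).
  elim: n => [|n IH]; first by rewrite /B bigcup_mkord big_ord0; exact: approximable0.
  rewrite /B bigcup_mkord big_ord_recr/= -bigcup_mkord.
  rewrite -[X in approximable X]setCK setCU; apply: approximableC.
  by apply: approximableI; apply: approximableC.
have mB n : measurable (B n) by have [] := HB n.
have UB : \bigcup_n F n = \bigcup_n B n.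
  apply/seteqP; split => [x [n _ Fx]|x [n _ [i _ Fx]]]; last by exists i.
  by exists n.+1 => //; exists n => /=.
have ndB : nondecreasing_seq B.
  move=> i j ij; apply/subsetPset => x [k /= ki Fx]; exists k => //=.
  exact: leq_trans ki ij.
have cB : m (B n) @[n --> \oo] --> m (\bigcup_n F n).
  by rewrite UB; apply: nondecreasing_cvg_mu => //; rewrite -UB.
have fU : m (\bigcup_n F n) \is a fin_num.
  rewrite ge0_fin_numE//; apply: le_lt_trans mfin.
  by apply: le_measure; rewrite ?inE.
have [n Bn] : exists n, (m (\bigcup_n F n) - (e / 2)%:E < m (B n))%E.
  apply/not_existsP => H.
  have : (m (\bigcup_n F n) <= m (\bigcup_n F n) - (e / 2)%:E)%E.
    rewrite -{1}(cvg_lim _ cB)//; apply: lime_le; first by apply/cvg_ex; eexists; exact: cB.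
    by apply: nearW => n; rewrite leNgt; apply/negP; exact: H.
  by rewrite leeBrDr// leNgt lteDl// lte_fin e2.
have [f [sf f01 fe]] := (HB n).2 _ e2.
exists f; split => //.
have BU : B n `<=` \bigcup_n F n by move=> x [i _ Fx]; exists i.
have mUB : measurable (\bigcup_n F n `\` B n) by exact: measurableD.
apply: (@le_trans _ _ (\int[m]_x ((\1_(\bigcup_n F n `\` B n) x)%:E + `|\1_(B n) x - f x|%:E))%E).
  apply: ge0_le_integral => //.
  - exact: measurable_approx_error.
  - apply: emeasurable_funD; last exact: measurable_approx_error.
    by apply/measurable_EFinP; exact: measurable_indic.
  - move=> x _; rewrite -EFinD lee_fin.
    have -> : \1_(\bigcup_n F n) x = \1_(\bigcup_n F n `\` B n) x + \1_(B n) x :> R.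
      rewrite !indicE in_setD.
      have [xB|xB] := boolP (x \in B n); last by rewrite andbT addr0.
      by rewrite andbF add0r mem_set//; apply: BU; rewrite -in_setE.
    rewrite -addrA; apply: le_trans (ler_normD _ _) _.
    by rewrite ger0_norm.
rewrite ge0_integralD//; last 2 first.
- by apply/measurable_EFinP; exact: measurable_indic.
- exact: measurable_approx_error.
have mUBe : (m (\bigcup_n F n `\` B n) <= (e / 2)%:E)%E.
  rewrite measureD//; last by rewrite -ge0_fin_numE.
  rewrite setIidr//; move: Bn.
  have fB : m (B n) \is a fin_num.
    rewrite ge0_fin_numE//; apply: le_lt_trans mfin.
    by apply: le_measure; rewrite ?inE.
  by rewrite lteBlDr// leeBlDr// => /ltW; rewrite addeC.
rewrite integral_indic// setIT.
by apply: le_trans (leeD mUBe fe) _; rewrite -EFinD -splitr.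
Qed.

Lemma approximable_of_cvg A (f_ : nat -> R * R -> R) : measurable A ->
  (forall n, separable (f_ n)) -> (forall n x, 0 <= f_ n x <= 1) ->
  (forall x, f_ n x @[n --> \oo] --> (\1_A x : R)) -> approximable A.
Proof.
move=> mA sf f01 fA; split=> // e e0.
have i1 : m.-integrable setT (cst 1%:E : BR * BR -> \bar R).
  apply/integrableP; split; first exact: measurable_cst.
  under eq_integral do rewrite /= normr1.
  by rewrite integral_cst// mul1e.
have c0 (x : BR * BR) : setT x -> `|\1_A x - f_ n x|%:E @[n --> \oo] --> (cst 0%E x : \bar R).
  move=> _; apply: cvg_EFin; first by apply: nearW.
  have <- : `|\1_A x - \1_A x| = 0 :> R by rewrite subrr normr0.
  apply: cvg_norm; apply: (@cvgB _ R^o); first exact: cvg_cst.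
  exact: fA.
have := @dominated_cvg _ _ _ m setT measurableT
  (fun n x => `|\1_A x - f_ n x|%:E) (cst 0%E) (cst 1%:E)
  (fun n => measurable_approx_error mA (sf n)) c0 _ i1 _.
rewrite integral0_eq// => H.
have {}H : (\int[m]_x `|\1_A x - f_ n x|%:E)%E @[n --> \oo] --> 0%E.
  apply: H => // n x _; rewrite /= lee_fin normr_id.
  have := f01 n x; rewrite indicE; case: (_ \in _) => /= h; rewrite ler_norml; lra.
have /fine_cvgP[fin Hf] := H.
have /cvgrPdist_le/(_ _ e0) Hd := Hf.
have [n [fn hn]] : exists n, (\int[m]_x `|\1_A x - f_ n x|%:E)%E \is a fin_num /\
    `|0 - fine (\int[m]_x `|\1_A x - f_ n x|%:E)%E| <= e.
  near \oo => n; exists n; split; first by near: n.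
  by near: n.
exists (f_ n); split => //.
rewrite -(fineK fn) lee_fin; apply: le_trans hn.
by rewrite sub0r normrN ler_norm.
Unshelve. all: by end_near. Qed.

(** Rays generate the Borel sets of the line, and the indicator of a ray is a pointwise limit of
    ramps. *)
Lemma approximable_strip_x (A : set BR) : measurable A -> approximable (A `*` setT).
Proof.
have mray c : measurable (`]-oo, c]%classic : set BR) by exact: measurable_itv.
rewrite [X in X A -> _]RGenOInfty.measurableE; move: A.
apply: smallest_sub.
  split=> [|B HB|F HF].
  - by rewrite set0X; exact: approximable0.
  - have -> : (setT `\` B) `*` setT = ~` (B `*` setT) :> set (BR * BR).
      by apply/seteqP; split => -[x y] /=; [move=> [[_ h] _] [/h //]|move=> h; split => //; split => // hB; apply: h].
    exact: approximableC.
  - have -> : (\bigcup_k F k) `*` setT = \bigcup_k (F k `*` setT) :> set (BR * BR).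
      by apply/seteqP; split => -[x y] /=; [move=> [[k _ Fx] _]; exists k|move=> [k _ [Fx _]]; split => //; exists k].
    exact: approximable_bigcup.
move=> _ [c ->] /=.
have -> : `]c, +oo[ `*` setT = ~` (`]-oo, c] `*` setT) :> set (BR * BR).
  apply/seteqP; split => -[x y] /=; rewrite !in_itv/= andbT.
    by move=> [cx _] [+ _]; rewrite leNgt cx.
  by move=> h; split => //; rewrite ltNge; apply/negP => xc; apply: h.
apply: approximableC.
apply: (@approximable_of_cvg _ (fun n x => ramp n c x.1 * cst 1 x.2)).
- by apply: measurableX.
- by move=> n; apply: separable_prod; [exact: C1_line_ramp|exact: C1_line_cst].
- by move=> n x /=; rewrite mulr1 ramp_ge0 ramp_le1.
- move=> x /=; under eq_fun do rewrite mulr1.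
  have -> : \1_(`]-oo, c] `*` setT) x = \1_(`]-oo, c]) x.1 :> R.
    by rewrite !indicE; congr (_%:R); congr nat_of_bool; apply/idP/idP; rewrite !inE => // -[].
  exact: cvg_ramp.
Qed.

Lemma approximable_strip_y (A : set BR) : measurable A -> approximable (setT `*` A).
Proof.
have mray c : measurable (`]-oo, c]%classic : set BR) by exact: measurable_itv.
rewrite [X in X A -> _]RGenOInfty.measurableE; move: A.
apply: smallest_sub.
  split=> [|B HB|F HF].
  - by rewrite setX0; exact: approximable0.
  - have -> : setT `*` (setT `\` B) = ~` (setT `*` B) :> set (BR * BR).
      by apply/seteqP; split => -[x y] /=; [move=> [_ [_ h]] [_ /h //]|move=> h; split => //; split => // hB; apply: h].
    exact: approximableC.
  - have -> : setT `*` (\bigcup_k F k) = \bigcup_k (setT `*` F k) :> set (BR * BR).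
      by apply/seteqP; split => -[x y] /=; [move=> [_ [k _ Fx]]; exists k|move=> [k _ [_ Fx]]; split => //; exists k].
    exact: approximable_bigcup.
move=> _ [c ->] /=.
have -> : setT `*` `]c, +oo[ = ~` (setT `*` `]-oo, c]) :> set (BR * BR).
  apply/seteqP; split => -[x y] /=; rewrite !in_itv/= andbT.
    by move=> [_ cx] [_]; rewrite leNgt cx.
  by move=> h; split => //; rewrite ltNge; apply/negP => xc; apply: h.
apply: approximableC.
apply: (@approximable_of_cvg _ (fun n x => cst 1 x.1 * ramp n c x.2)).
- by apply: measurableX.
- by move=> n; apply: separable_prod; [exact: C1_line_cst|exact: C1_line_ramp].
- by move=> n x /=; rewrite mul1r ramp_ge0 ramp_le1.
- move=> x /=; under eq_fun do rewrite mul1r.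
  have -> : \1_(setT `*` `]-oo, c]) x = \1_(`]-oo, c]) x.2 :> R.
    by rewrite !indicE; congr (_%:R); congr nat_of_bool; apply/idP/idP; rewrite !inE => // -[].
  exact: cvg_ramp.
Qed.

(** The approximable sets form a sigma-algebra that contains the rectangles, as intersections of two
    strips. *)
Lemma separable_approximation A : measurable A -> approximable A.
Proof.
rewrite [X in X A -> _]measurable_prod_measurableType; move: A.
apply: smallest_sub.
  split=> [|B HB|F HF]; first exact: approximable0.
    by rewrite setTD; exact: approximableC.
  exact: approximable_bigcup.
move=> _ [B mB [B' mB' <-]].
have -> : B `*` B' = (B `*` setT) `&` (setT `*` B') :> set (BR * BR).
  by apply/seteqP; split => -[x y] /=; [move=> [h1 h2]|move=> [[h1 _] [_ h2]]].
by apply: approximableI; [exact: approximable_strip_x|exact: approximable_strip_y].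
Qed.

End approximation.

(** * Perimeter and translations *)

Section translation.
Context {R : realType}.
Local Notation BR := (measurableTypeR R).
Local Notation mu := (@plane_leb R).
Implicit Types (f : R * R -> R) (Om : set (R * R)) (h : R * R).

Definition shift_diff Om h : set (R * R) := [set x | \1_Om (x + h) != \1_Om x :> R].

Lemma measurable_indic_shift Om h : measurable (Om : set (BR * BR)) ->
  measurable_fun setT (fun x : BR * BR => \1_Om ((x : R * R) + h) : BR).
Proof.
move=> mO; exact: (measurableT_comp (measurable_indic (mO)) (measurable_translate h)).
Qed.

Lemma measurable_shift_diff Om h : measurable (Om : set (BR * BR)) ->
  measurable (shift_diff Om h : set (BR * BR)).
Proof.
move=> mO; have m := measurable_funB (measurable_indic_shift h mO)
  (@measurable_indic _ _ R setT Om mO).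
rewrite (_ : shift_diff Om h = (fun x => \1_Om (x + h) - \1_Om x : R) @^-1` (~` [set 0])).
  by rewrite -[X in measurable X]setTI; apply: m => //; exact: measurableC.
by apply/seteqP; split => x /=; rewrite /shift_diff /= -subr_eq0 => /eqP.
Qed.

Lemma compact_square (L : R) : compact (square L).
Proof. by apply: compact_setX; exact: segment_compact. Qed.

Lemma compactly_supported_square (phi : R * R -> R * R) (L : R) :
  (forall x, ~ square L x -> phi x = 0) -> compactly_supported phi.
Proof.
move=> H; apply: (@subclosed_compact _ _ (square L)).
- exact: closed_closure.
- exact: compact_square.
- have cS : closed (square L).
    by apply: compact_closed; [exact: norm_hausdorff|exact: compact_square].
  rewrite ((closure_id _).1 cS); apply: closure_subset => x /= /eqP px.
  by apply: contrapT => nx; apply: px; exact: H.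
Qed.

Lemma integrable_square f (L : R) : continuous f ->
  (forall x, ~ square L x -> f x = 0) -> mu.-integrable setT (fun x => (f x)%:E).
Proof.
move=> cf f0; have [M HM] := continuous_square_bounded L cf.
apply: (@le_integrable _ _ _ mu setT measurableT _ (fun x => M%:E * (\1_(square L) x)%:E)%E).
- by apply/measurable_EFinP; exact: continuous_measurable2.
- move=> x _; rewrite -EFinM lee_fin.
  have [xS|xS] := pselect (square L x); last by rewrite f0// normr0.
  by rewrite indicE mem_set// mulr1 (le_trans (HM _ xS))// ler_norm.
- apply: integrableZl => //; apply/integrableP; split.
    by apply/measurable_EFinP; apply: measurable_indic; exact: measurable_square.
  under eq_integral do rewrite gee0_abs ?lee_fin//.
  rewrite integral_indic//; last exact: measurable_square.
  by rewrite setIT; exact: plane_leb_square_lty.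
Qed.

Lemma integrable_mul_indic f (g : R * R -> R) : (forall x, `|g x| <= 1) ->
  measurable_fun setT (g : BR * BR -> BR) ->
  mu.-integrable setT (fun x => (f x)%:E) ->
  mu.-integrable setT (fun x => (f x * g x)%:E).
Proof.
move=> g1 mg fi; apply: (@le_integrable _ _ _ mu setT measurableT _ (fun x => (f x)%:E)) => //.
  apply/measurable_EFinP; apply: measurable_funM => //.
  by apply/measurable_EFinP; exact: measurable_int fi.
by move=> x _; rewrite lee_fin normrM ler_piMr.
Qed.

Lemma indic_norm_le1 Om x : `|\1_Om x : R| <= 1.
Proof. by rewrite indicE; case: (_ \in _); rewrite ?normr1 ?normr0. Qed.

(* Summation by parts: the translate is moved from the test function to the set. *)
Lemma translation_duality Om h f (phi : R * R -> R * R) (s p L : R) :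
  0 < s -> measurable (Om : set (BR * BR)) -> (perimeter Om <= p%:E)%E ->
  continuous f -> (forall x, ~ square L x -> f x = 0) ->
  C1 phi -> compactly_supported phi -> (forall x, enorm (phi x) <= 1) ->
  (forall x, divergence phi x = (f x - f (x - h)) / s) ->
  (\int[mu]_x (f x * (\1_Om x - \1_Om (x + h)))%:E <= (s * p)%:E)%E.
Proof.
move=> s0 mO Op cf f0 cphi sphi lephi dphi.
have H : (\int[leb2 R]_(x in (Om : set (Leb2 R))) (divergence phi x)%:E <= p%:E)%E.
  by apply: le_trans Op; apply: ereal_sup_ubound; exists phi.
move: H; rewrite (@integral_leb2 _ Om (fun x => (divergence phi x)%:E))//; last first.
  by apply/measurable_EFinP; exact: measurable_divergence.
have fi := integrable_square cf f0.
have mI : measurable_fun setT (\1_Om : BR * BR -> BR) by exact: measurable_indic.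
have mIh := measurable_indic_shift h mO.
have i1 := integrable_mul_indic (indic_norm_le1 Om) mI fi.
have i2 := integrable_mul_indic (fun x => indic_norm_le1 Om (x + h)) mIh fi.
have mf : measurable_fun setT (f : BR * BR -> BR) by exact: continuous_measurable2.
have mfh : measurable_fun setT (fun x : BR * BR => f ((x : R * R) - h) : BR).
  exact: (measurableT_comp mf (measurable_translate (- h))).
pose F (x : BR * BR) : \bar R := (f ((x : R * R) - h) * \1_Om x)%:E.
have mF : measurable_fun setT F by apply/measurable_EFinP; exact: measurable_funM.
have E2 : (\int[mu]_x F x = \int[mu]_x (f x * \1_Om (x + h))%:E)%E.
  rewrite -(integral_measure_preserving (measurable_translate h) (plane_leb_translate h) mF).
  by apply: eq_integral => x _; rewrite /F addrK.
have iF : mu.-integrable setT F.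
  apply/integrableP; split => //.
  have mF' : measurable_fun setT (fun x => `|F x|%E) by exact: measurableT_comp.
  rewrite -(ge0_integral_measure_preserving (measurable_translate h) (plane_leb_translate h) mF')//.
  under eq_integral do rewrite /F addrK.
  by have /integrableP[_] := i2.
have -> : (\int[mu]_(x in Om) (divergence phi x)%:E =
    s^-1%:E * \int[mu]_x (f x * (\1_Om x - \1_Om (x + h)))%:E)%E.
  under [in RHS]eq_integral do rewrite mulrBr EFinB.
  rewrite integralB//= -E2 -integralB// -integralZl//; last exact: integrableB.
  rewrite [LHS]integral_mkcond; apply: eq_integral => x _.
  rewrite patchE /F dphi indicE; case: (x \in Om) => /=.
    by rewrite !mulr1 -EFinB -EFinM mulrC.
  by rewrite !mulr0 subee// mule0.
by rewrite lee_pdivrMl.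
Qed.

Definition stepx (s : R) : R * R := (s, 0).
Definition stepy (s : R) : R * R := (0, s).

Lemma increment_mean_value (F : R -> R) (f : R -> R) (x s : R) : 0 < s ->
  (forall t : R, is_derive t 1 F (f t)) ->
  exists c, x - s <= c <= x /\ F x - F (x - s) = f c * s.
Proof.
move=> s0 D.
have cF : continuous F.
  by move=> t; have [d _] := D t; exact/differentiable_continuous/derivable1_diffP.
have ab : x - s < x by rewrite gtrBl.
have cw : {within `[x - s, x], continuous F} by exact: continuous_subspaceT.
have [c + cE] := @MVT _ F f (x - s) x ab (fun t _ => D t) cw.
rewrite in_itv/= => /andP[c1 c2]; exists c; split; first by rewrite !ltW.
by rewrite cE; congr (_ * _); ring.
Qed.

Lemma is_derive_eq_val (F : R -> R) (x a b : R) :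
  is_derive x 1 F a -> is_derive x 1 F b -> a = b.
Proof. by move=> [_ <-] [_ <-]. Qed.

Lemma increment_bounds f F (L s : R) (x : R * R) : 0 < s -> separable f ->
  (forall x, `|f x| <= 1) -> (forall x, ~ square L x -> f x = 0) ->
  (forall x y : R, is_derive x 1 (fun t => F (t, y)) (f (x, y))) ->
  `|F x - F (x.1 - s, x.2)| <= s /\
  (~ square (L + s) x -> F x - F (x.1 - s, x.2) = 0).
Proof.
move=> s0 sf f1 f0 D; case: x => x y /=.
have [c [/andP[c1 c2] cE]] := @increment_mean_value (fun t => F (t, y))
  (fun t => f (t, y)) x s s0 (fun t => D t y).
rewrite cE; split.
  by rewrite normrM (gtr0_norm s0) ler_piMl// ltW.
move=> nx; rewrite f0 ?mul0r// => -[/=]; rewrite !in_itv/= => /andP[h1 h2] /andP[h3 h4].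
by apply: nx; split; rewrite /= in_itv/=; apply/andP; split; lra.
Qed.

(** The field is [(psi, 0)] with [psi] the difference quotient of an antiderivative of [f] in the
    first variable: its divergence is the difference quotient of [f], and its size is controlled by
    [f] alone, not by the derivatives of [f]. *)
Lemma translation_duality_x Om f (s p L : R) : 0 < s ->
  measurable (Om : set (BR * BR)) -> (perimeter Om <= p%:E)%E ->
  separable f -> (forall x, `|f x| <= 1) -> (forall x, ~ square L x -> f x = 0) ->
  (\int[mu]_x (f x * (\1_Om x - \1_Om ((x : R * R) + stepx s)))%:E <= (s * p)%:E)%E.
Proof.
move=> s0 mO Op sf f1 f0.
have [F sF D] := separable_antiderivative sf.
have B x := @increment_bounds f F L s x s0 sf f1 f0 D.
pose psi x := s^-1 * (F x - F (x.1 - s, x.2)).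
have spsi : separable psi.
  by apply: separableZ; apply: separableB => //; exact: separable_shift.
have Cpsi := separable_C1 spsi.
have cphi := C1_pair0 Cpsi.
have [dpsi _] := Cpsi.
apply: (translation_duality s0 mO Op (separable_continuous sf) f0 cphi).
- apply: (@compactly_supported_square _ (L + s)) => x nx.
  by rewrite /psi (B x).2// mulr0.
- move=> x; rewrite /enorm /= expr0n addr0 sqrtr_sqr /psi normrM normfV (gtr0_norm s0).
  by rewrite ler_pdivrMl// mulr1; exact: (B x).1.
- move=> x; rewrite /divergence; rewrite [X in _ + X.2]derive_pair0; last exact: diff_derivable.
  rewrite addr0; case: x => x y.
  (* Both sides are the derivative of [psi] along the horizontal line: one by differentiability of
     the field, the other from the antiderivative. *)
  apply: (@is_derive_eq_val (fun t => psi (t, y)) x).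
    exact: (C1_partial_x cphi x y).
  have Dd : is_derive x 1 (fun t => F (t, y) - F (t - s, y)) (f (x, y) - f (x - s, y)).
    have := @is_derive1_comp _ (fun t => F (t, y)) (fun t => t - s) x _ 1 (D (x - s) y)
      (is_derive_shift x 1 (- s)).
    by rewrite mulr1 => Ds; exact: (is_deriveB (D x y) Ds).
  have -> : (f (x, y) - f ((x, y) - stepx s)) / s = s^-1 *: (f (x, y) - f (x - s, y)).
    rewrite mulrC; congr (_ *: (_ - f _)).
    by apply: injective_projections; rewrite /= ?subr0.
  exact: (is_deriveZ s^-1 Dd).
Qed.

(** The same construction after exchanging the coordinates. *)
Lemma translation_duality_y Om f (s p L : R) : 0 < s ->
  measurable (Om : set (BR * BR)) -> (perimeter Om <= p%:E)%E ->
  separable f -> (forall x, `|f x| <= 1) -> (forall x, ~ square L x -> f x = 0) ->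
  (\int[mu]_x (f x * (\1_Om x - \1_Om ((x : R * R) + stepy s)))%:E <= (s * p)%:E)%E.
Proof.
move=> s0 mO Op sf f1 f0.
pose g (x : R * R) := f (x.2, x.1).
have sg : separable g by exact: separable_swap.
have [F sF D] := separable_antiderivative sg.
have g0 x : ~ square L x -> g x = 0.
  by move=> nx; apply: f0 => -[h1 h2]; apply: nx; split.
have B x := @increment_bounds g F L s x s0 sg (fun x => f1 _) g0 D.
pose psi (x : R * R) := s^-1 * (F (x.2, x.1) - F (x.2 - s, x.1)).
have spsi : separable psi.
  apply: (@separable_swap _ (fun x => s^-1 * (F x - F (x.1 - s, x.2)))).
  apply: separableZ; apply: separableB; last exact: separable_shift.
  exact: sF.
have Cpsi := separable_C1 spsi.
have cphi := C1_0pair Cpsi.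
have [dpsi _] := Cpsi.
apply: (translation_duality s0 mO Op (separable_continuous sf) f0 cphi).
- apply: (@compactly_supported_square _ (L + s)) => x nx.
  rewrite /psi (B (x.2, x.1)).2 ?mulr0// => -[h1 h2].
  by apply: nx; split.
- move=> x; rewrite /enorm /= expr0n add0r sqrtr_sqr /psi normrM normfV (gtr0_norm s0).
  by rewrite ler_pdivrMl// mulr1; exact: (B (x.2, x.1)).1.
- move=> x; rewrite /divergence; rewrite [X in X.1 + _]derive_0pair; last exact: diff_derivable.
  rewrite add0r; case: x => x y.
  apply: (@is_derive_eq_val (fun t => psi (x, t)) y).
    exact: (C1_partial_y cphi x y).
  have Dd : is_derive y 1 (fun t => F (t, x) - F (t - s, x)) (g (y, x) - g (y - s, x)).
    have := @is_derive1_comp _ (fun t => F (t, x)) (fun t => t - s) y _ 1 (D (y - s) x)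
      (is_derive_shift y 1 (- s)).
    by rewrite mulr1 => Ds; exact: (is_deriveB (D y x) Ds).
  have -> : (f (x, y) - f ((x, y) - stepy s)) / s = s^-1 *: (g (y, x) - g (y - s, x)).
    rewrite mulrC; congr (_ *: (_ - f _)).
    by apply: injective_projections; rewrite /= ?subr0.
  exact: (is_deriveZ s^-1 Dd).
Qed.

End translation.

Lemma ge0_integral_mrestr_le d (T : measurableType d) (R : realType)
    (m : {measure set T -> \bar R}) (D : set T) (mD : measurable D) (f : T -> \bar R) :
  measurable_fun setT f -> (forall x, 0 <= f x)%E ->
  (\int[m]_(x in D) f x <= \int[mrestr m mD]_x f x)%E.
Proof.
move=> mf f0; apply: (@le_trans _ _ (\int[mrestr m mD]_(x in D) f x)%E).
  rewrite le_eqVlt; apply/orP; left; apply/eqP.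
  apply: eq_measure_integral => A mA AD.
  by rewrite /= /mrestr setIidl.
by apply: ge0_subset_integral.
Qed.

(** * From the duality estimate to the area of the shift difference *)

Section shift_bound.
Context {R : realType}.
Local Notation BR := (measurableTypeR R).
Local Notation mu := (@plane_leb R).
Implicit Types (f : R * R -> R) (Om : set (R * R)) (h : R * R).

(** The optimal test function is the sign of [\1_Om x - \1_Om (x + h)], which on the shift
    difference is [2 \1_A - 1]. A separable [th] close to [\1_A] replaces the indicator, and the
    cutoff [chi] gives compact support. The factor 2 pays for [chi >= 1/2] on the inner square, the
    factor 4 also for the coefficient 2 of [th]. *)
Lemma shift_diff_square_bound Om h (c M e : R) : 0 < M -> 0 < e ->
  measurable (Om : set (BR * BR)) ->
  (forall f L, separable f -> (forall x, `|f x| <= 1) ->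
    (forall x, ~ square L x -> f x = 0) ->
    (\int[mu]_x (f x * (\1_Om x - \1_Om ((x : R * R) + h)))%:E <= c%:E)%E) ->
  (mu (shift_diff Om h `&` square M) <= (2 * c + 4 * e)%:E)%E.
Proof.
move=> M0 e0 mO H.
set L := 4 * M.
have mS : measurable (square L : set (BR * BR)) by exact: measurable_square.
have mSM : measurable (square M : set (BR * BR)) by exact: measurable_square.
have mD := measurable_shift_diff h mO.
have mDM : measurable (shift_diff Om h `&` square M : set (BR * BR)) by exact: measurableI.
have mI : measurable_fun setT (\1_Om : BR * BR -> BR) by exact: measurable_indic.
have mIh := measurable_indic_shift h mO.
pose Oh : set (BR * BR) := (fun x => x + h) @^-1` Om.
have mOh : measurable Oh by rewrite -[Oh]setTI; exact: measurable_translate.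
pose A : set (BR * BR) := Om `\` Oh.
have mA : measurable A by exact: measurableD.
(* The approximation theorem asks for a finite measure; outside the square of side [2 L] the test
   function vanishes anyway. *)
pose m := mrestr mu mS.
have mfin : (m setT < +oo)%E.
  by rewrite /m /= /mrestr setTI; exact: plane_leb_square_lty.
have [_ /(_ e e0)[th [sth th01 the]]] := separable_approximation mfin mA.
pose chi (x : R * R) := bump L x.1 * bump L x.2.
have schi : separable chi by apply: separable_prod; exact: C1_line_bump.
pose f x := (2 * th x - 1) * chi x.
have sf : separable f.
  apply: separableM => //; apply: separableB; last exact: separable_cst.
  exact: separableZ.
have chi01 x : 0 <= chi x <= 1.
  rewrite mulr_ge0 ?bump_ge0//=.
  by have := bump_ge0 L x.1; have := bump_ge0 L x.2; have := bump_le1 L x.1;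
    have := bump_le1 L x.2; rewrite /chi; nra.
have L0 : 0 < L by rewrite mulr_gt0.
have chi0 x : ~ square L x -> chi x = 0.
  move=> nx; rewrite /chi.
  have [h1|h1] := leP `|x.1| L; last by rewrite bump_outside// mul0r.
  have [h2|h2] := leP `|x.2| L; last by rewrite (bump_outside _ h2)// mulr0.
  by exfalso; apply: nx; split; rewrite /= in_itv/= -ler_norml.
have chiM x : square M x -> 1 / 2 <= chi x.
  move=> [/=]; rewrite !in_itv/= -!ler_norml => h1 h2.
  have b1 := bump_inside M0 h1; have b2 := bump_inside M0 h2.
  by rewrite /chi -/L; nra.
have f1 x : `|f x| <= 1.
  have := th01 x; have := chi01 x; rewrite /f ler_norml => h1 h2.
  by apply/andP; split; nra.
have f0 x : ~ square L x -> f x = 0 by move=> nx; rewrite /f chi0// mulr0.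
have Hf := H f L sf f1 f0.
have fi := integrable_square (separable_continuous sf) f0.
have i1 := integrable_mul_indic (indic_norm_le1 Om) mI fi.
have i2 := integrable_mul_indic (fun x => indic_norm_le1 Om (x + h)) mIh fi.
have i3 : mu.-integrable setT (fun x => (f x * (\1_Om x - \1_Om (x + h)))%:E).
  apply: eq_integrable (integrableB measurableT i1 i2) => // x _.
  by rewrite mulrBr EFinB.
have mAth : measurable_fun setT (fun x : BR * BR => `|\1_A x - th x|%:E).
  exact: measurable_approx_error.
have errle : (\int[mu]_x (\1_(square L) x * `|\1_A x - th x|)%:E <= e%:E)%E.
  apply: le_trans the.
  apply: le_trans (ge0_integral_mrestr_le mu mS mAth _) => //.
  rewrite [leRHS]integral_mkcond le_eqVlt; apply/orP; left; apply/eqP.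
  by apply: eq_integral => x _; rewrite patchE indicE; case: ifP; rewrite ?mul1r ?mul0r.
have mE : measurable_fun setT (fun x : BR * BR => (\1_(square L) x * `|\1_A x - th x|)%:E).
  apply/measurable_EFinP; apply: measurable_funM; first exact: measurable_indic.
  exact/measurable_EFinP.
have iE : mu.-integrable setT (fun x => (\1_(square L) x * `|\1_A x - th x|)%:E).
  apply/integrableP; split=> //.
  under eq_integral do rewrite gee0_abs ?lee_fin ?mulr_ge0//.
  by apply: le_lt_trans errle _; exact: ltry.
have iDM : mu.-integrable setT (fun x => (\1_(shift_diff Om h `&` square M) x)%:E).
  apply/integrableP; split; first by apply/measurable_EFinP; exact: measurable_indic.
  under eq_integral do rewrite gee0_abs ?lee_fin//.
  rewrite integral_indic// setIT; apply: le_lt_trans (plane_leb_square_lty M).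
  by apply: le_measure; rewrite ?inE.
have key : (\int[mu]_x (\1_(shift_diff Om h `&` square M) x)%:E <=
   \int[mu]_x (2%:E * (f x * (\1_Om x - \1_Om (x + h)))%:E +
     4%:E * (\1_(square L) x * `|\1_A x - th x|)%:E))%E.
  apply: le_integral => //.
    by apply: integrableD => //; exact: integrableZl.
  move=> x _; rewrite -!EFinM -EFinD lee_fin.
  have hchi : chi x <= \1_(square L) x.
    rewrite indicE; have [xS|xS] := boolP (x \in square L).
      by have /andP[_] := chi01 x.
    by move: xS; rewrite notin_setE => /chi0 ->.
  apply: (@le_trans _ _ (2 * chi x * \1_(shift_diff Om h) x)).
    rewrite indicI /=; have [xM|xM] := pselect (square M x).
      rewrite [\1_(square M) x]indicE mem_set// mulr1.
      by rewrite ler_peMl ?indicE//; have := chiM _ xM; lra.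
    rewrite [\1_(square M) x]indicE memNset// mulr0.
    have /andP[c0 _] := chi01 x.
    by apply: mulr_ge0; [exact: mulr_ge0|rewrite indicE].
  have -> : \1_A x = (x \in Om)%:R * (1 - (x + h \in Om)%:R) :> R.
    rewrite indicE /A in_setD.
    have -> : (x \in Oh) = (x + h \in Om) by apply/idP/idP; rewrite !inE.
    by case: (x \in Om); case: (x + h \in Om) => /=; ring.
  have -> : \1_(shift_diff Om h) x = ((x + h \in Om) != (x \in Om))%:R :> R.
    rewrite indicE; congr (_%:R); congr nat_of_bool.
    have -> : (x \in shift_diff Om h) = (\1_Om (x + h) != \1_Om x :> R).
      by apply/idP/idP; rewrite inE.
    rewrite !indicE; case: (x \in Om); case: (x + h \in Om); rewrite /= ?eqxx//.
      by rewrite eq_sym oner_eq0.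
    by rewrite oner_eq0.
  have /andP[t0 t1] := th01 x; have /andP[c0 c1] := chi01 x.
  move: hchi; set q := \1_(square L) x; move=> hchi.
  have q1 : 0 <= q by rewrite /q indicE.
  rewrite !indicE /f.
  case: (x \in Om); case: (x + h \in Om) => /=.
  - by rewrite subrr !mulr0 add0r !mulr_ge0.
  - rewrite ?subr0 ?mulr1 ger0_norm ?subr_ge0//; clear -t0 t1 c0 c1 hchi; nra.
  - rewrite ?sub0r ?mul0r ?sub0r normrN ger0_norm//; clear -t0 t1 c0 c1 hchi; nra.
  - by rewrite subrr !mulr0 add0r !mulr_ge0.
move: key; rewrite integral_indic// setIT integralD//; [|exact: integrableZl|exact: integrableZl].
rewrite !integralZl// => key; apply: le_trans key _.
rewrite [leRHS]EFinD (EFinM 2 c) (EFinM 4 e).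
by apply: leeD; apply: lee_wpmul2l; rewrite ?lee_fin.
Qed.


End shift_bound.

(** * Shift differences of the whole plane and finiteness of the nonlocal term *)

Section finite_nonlocal.
Context {R : realType}.
Local Notation BR := (measurableTypeR R).
Local Notation mu := (@plane_leb R).
Implicit Types (f : R * R -> R) (Om : set (R * R)) (h w : R * R).

Lemma square_exhaustion : \bigcup_n square n%:R = [set: R * R].
Proof.
apply/seteqP; split => // x _.
pose t := `|x.1| + `|x.2|.
have tb : t < (Num.bound t)%:R by apply: archi_boundP; rewrite addr_ge0.
exists (Num.bound t) => //; split; rewrite /= in_itv/= -ler_norml (le_trans _ (ltW tb))//.
  by rewrite lerDl.
by rewrite lerDr.
Qed.

Lemma measure_le_of_squares (A : set (BR * BR)) (c : \bar R) : measurable A ->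
  (forall n, mu (A `&` square n.+1%:R) <= c)%E -> (mu A <= c)%E.
Proof.
move=> mA H.
have mAn n : measurable (A `&` square n.+1%:R : set (BR * BR)).
  by apply: measurableI => //; exact: measurable_square.
have AU : A = \bigcup_n (A `&` square n.+1%:R).
  rewrite -setI_bigcupr -[LHS]setIT; congr (_ `&` _); rewrite -square_exhaustion.
  apply/seteqP; split => x [n _ xn]; last by exists n.+1.
  exists n => //; move: xn; rewrite /square /= !in_itv/= -!ler_norml => -[h1 h2].
  by rewrite -natr1; split; lra.
have nd : nondecreasing_seq (fun n => A `&` square n.+1%:R).
  move=> i j ij; apply/subsetPset; apply: setIS => x; rewrite /square /= !in_itv/= -!ler_norml.
  have : i.+1%:R <= j.+1%:R :> R by rewrite ler_nat.
  by move=> ? [? ?]; split; lra.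
have cv : mu (A `&` square n.+1%:R) @[n --> \oo] --> mu (\bigcup_n (A `&` square n.+1%:R)).
  by apply: nondecreasing_cvg_mu => //; exact: bigcupT_measurable.
rewrite AU -(cvg_lim _ cv)//; apply: lime_le; first by apply/cvg_ex; eexists; exact: cv.
exact: nearW.
Qed.

(** The local bound does not depend on the square, so the squares may grow and the approximation
    error tend to zero. *)
Lemma shift_diff_bound Om h (c : R) : measurable (Om : set (BR * BR)) ->
  (forall f L, separable f -> (forall x, `|f x| <= 1) ->
    (forall x, ~ square L x -> f x = 0) ->
    (\int[mu]_x (f x * (\1_Om x - \1_Om ((x : R * R) + h)))%:E <= c%:E)%E) ->
  (mu (shift_diff Om h) <= (2 * c)%:E)%E.
Proof.
move=> mO H; apply: measure_le_of_squares => [|n]; first exact: measurable_shift_diff.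
apply/lee_addgt0Pr => e e0.
have n0 : 0 < n.+1%:R :> R by [].
have e4 : 0 < e / 4 by rewrite divr_gt0.
apply: le_trans (shift_diff_square_bound n0 e4 mO H) _.
rewrite -EFinD lee_fin; lra.
Qed.

Section bounds.
Context (Om : set (R * R)) (p : R).
Context (mO : measurable (Om : set (BR * BR))) (p0 : 0 < p)
  (Op : (perimeter Om <= p%:E)%E).

Lemma shift_diff_stepx s : 0 < s -> (mu (shift_diff Om (stepx s)) <= (2 * (s * p))%:E)%E.
Proof. by move=> s0; apply: shift_diff_bound => // f L *; exact: (@translation_duality_x _ _ _ _ _ L). Qed.

Lemma shift_diff_stepy s : 0 < s -> (mu (shift_diff Om (stepy s)) <= (2 * (s * p))%:E)%E.
Proof. by move=> s0; apply: shift_diff_bound => // f L *; exact: (@translation_duality_y _ _ _ _ _ L). Qed.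

Lemma shift_diff0 : shift_diff Om 0 = set0.
Proof. by apply/seteqP; split => x //=; rewrite /shift_diff /= addr0 eqxx. Qed.

Lemma shift_diffN h : mu (shift_diff Om (- h)) = mu (shift_diff Om h).
Proof.
rewrite -(plane_leb_translate h (measurable_shift_diff (- h) mO)).
congr (mu _); apply/seteqP; split => x; by rewrite /shift_diff /= addrK eq_sym.
Qed.

Lemma shift_diffD h w :
  (mu (shift_diff Om (h + w)%R) <= mu (shift_diff Om h) + mu (shift_diff Om w))%E.
Proof.
pose B : set (BR * BR) := (fun x => x + h) @^-1` (shift_diff Om w).
have mB : measurable B.
  by rewrite -[B]setTI; apply: measurable_translate => //; exact: measurable_shift_diff.
rewrite -(plane_leb_translate h (measurable_shift_diff w mO)) -/B.
have mh := measurable_shift_diff h mO.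
apply: le_trans (measureU2 mu mh mB) => //.
apply: le_measure; rewrite ?inE.
- exact: measurable_shift_diff.
- exact: measurableU.
- move=> x; rewrite /shift_diff /B /= addrA => xhw.
  have [e1|e1] := eqVneq (\1_Om (x + h) : R) (\1_Om x); last by left.
  by right; rewrite /shift_diff /= e1.
Qed.

(** The translation is performed along one axis after the other, and areas of shift differences obey
    a triangle inequality. *)
Lemma shift_diff_linear w :
  (mu (shift_diff Om w) <= (2 * p * (`|w.1| + `|w.2|))%:E)%E.
Proof.
have Hx s : (mu (shift_diff Om (stepx s)) <= (2 * p * `|s|)%:E)%E.
  have [s0|s0|->] := ltgtP s 0.
  - rewrite -shift_diffN (_ : - stepx s = stepx (- s)); last first.
      by apply: injective_projections; rewrite /= ?oppr0.
    apply: le_trans (shift_diff_stepx _) _; first by rewrite oppr_gt0.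
    by rewrite lee_fin ltr0_norm//; lra.
  - apply: le_trans (shift_diff_stepx s0) _.
    by rewrite lee_fin gtr0_norm//; lra.
  - by rewrite -[stepx 0]/(0 : R * R) shift_diff0 measure0 normr0 mulr0.
have Hy s : (mu (shift_diff Om (stepy s)) <= (2 * p * `|s|)%:E)%E.
  have [s0|s0|->] := ltgtP s 0.
  - rewrite -shift_diffN (_ : - stepy s = stepy (- s)); last first.
      by apply: injective_projections; rewrite /= ?oppr0.
    apply: le_trans (shift_diff_stepy _) _; first by rewrite oppr_gt0.
    by rewrite lee_fin ltr0_norm//; lra.
  - apply: le_trans (shift_diff_stepy s0) _.
    by rewrite lee_fin gtr0_norm//; lra.
  - by rewrite -[stepy 0]/(0 : R * R) shift_diff0 measure0 normr0 mulr0.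
have -> : w = stepx w.1 + stepy w.2.
  by apply: injective_projections; rewrite /= ?addr0 ?add0r.
apply: le_trans (shift_diffD _ _) _.
by rewrite /= addr0 add0r mulrDr EFinD; apply: leeD; [exact: Hx|exact: Hy].
Qed.

(* Isoperimetric bound from translations: if [A] is the shift difference and
   [m = |A|], then [|A `&` (A - h)| >= m / 2] for all [h] in a square of side
   [s = m / 16 p], while the integral of the left side over all [h] is [m ^ 2]. *)
Lemma shift_diff_uniform w : (mu (shift_diff Om w) <= (512 * p ^+ 2)%:E)%E.
Proof.
set A := shift_diff Om w.
have mA : measurable (A : set (BR * BR)) by exact: measurable_shift_diff.
have Afin : mu A \is a fin_num.
  by rewrite ge0_fin_numE//; apply: le_lt_trans (shift_diff_linear w) _; exact: ltry.
set m := fine (mu A).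
have mE : mu A = m%:E by rewrite fineK.
have m0 : 0 <= m by rewrite -lee_fin -mE.
rewrite mE lee_fin; move: m0; rewrite le_eqVlt => /predU1P[<-|m0].
  exact: mulr_ge0 (ler0n _ _) (sqr_ge0 p).
pose s := m / (16 * p).
have s0 : 0 < s by rewrite divr_gt0// mulr_gt0.
pose Q : set (BR * BR) := `]0, s]%classic `*` `]0, s]%classic.
have mQ : measurable Q by apply: measurableX; exact: measurable_itv.
have muQ : mu Q = (s ^+ 2)%:E.
  rewrite plane_leb_rect; [|exact: measurable_itv|exact: measurable_itv].
  by rewrite !lebesgue_measure_itv/= lte_fin s0 -EFinB subr0 -EFinM.
pose Ah h : set (BR * BR) := (fun x => x + h) @^-1` A.
have mAh h : measurable (Ah h) by rewrite -[Ah h]setTI; exact: measurable_translate.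
have overlap h : Q h -> ((m / 2)%:E <= mu (A `&` Ah h))%E.
  move=> [/=]; rewrite !in_itv/= => /andP[h1 h1s] /andP[h2 h2s].
  pose S : set (BR * BR) := shift_diff Om h.
  have mS : measurable S by exact: measurable_shift_diff.
  pose Sw : set (BR * BR) := (fun x => x + w) @^-1` S.
  have mSw : measurable Sw by rewrite -[Sw]setTI; exact: measurable_translate.
  (* Here [|h.1| + |h.2| <= 2 s], and [s] is chosen so that the linear bound [4 p s] equals
     [m / 4]. *)
  have Sle : (mu S <= (m / 4)%:E)%E.
    apply: le_trans (shift_diff_linear h) _; rewrite lee_fin !gtr0_norm//.
    have -> : m / 4 = 2 * p * (s + s) by rewrite /s; field; rewrite gt_eqF.
    by rewrite ler_pM2l ?mulr_gt0//; lra.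
  have Swle : (mu Sw <= (m / 4)%:E)%E 
    by rewrite /Sw (plane_leb_translate w mS); exact: Sle.
  have mI : measurable (A `&` Ah h : set (BR * BR)).
    exact: (measurableI _ _ mA (mAh h)).
  (* If [x] is in [A] but [x + h] is not, then membership in [Om] changes under the shift by [h]
     either at [x] or at [x + w]. *)
  have : (mu A <= mu (A `&` Ah h) + (mu S + mu Sw))%E.
    have mSS : measurable (S `|` Sw) by exact: measurableU.
    apply: (@le_trans _ _ (mu ((A `&` Ah h) `|` (S `|` Sw)))).
      apply: le_measure; rewrite ?inE//; first exact: measurableU.
      move=> x Ax; have [xh|xh] := pselect (Ah h x); first by left.
      right; have {}xh : \1_Om (x + h + w) = \1_Om (x + h) :> R.
        by apply/eqP; apply: contrapT => /negP; exact: xh.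
      have [e1|e1] := eqVneq (\1_Om (x + h) : R) (\1_Om x); last by left.
      right; rewrite /Sw /S /shift_diff /= addrAC xh e1 eq_sym.
      exact: Ax.
    apply: le_trans (measureU2 mu mI mSS) _ => //.
    by rewrite leeD2l//; exact: (measureU2 mu mS mSw).
  have : (mu S + mu Sw <= (m / 2)%:E)%E.
    by apply: le_trans (leeD Sle Swle) _; rewrite -EFinD lee_fin; lra.
  move=> h3 /le_trans/(_ (leeD2l _ h3)); rewrite mE.
  by rewrite -leeBlDr// -EFinB; apply: le_trans; rewrite lee_fin; lra.
pose F (q : (BR * BR) * (BR * BR)) : \bar R :=
  (\1_Q q.1 * (\1_A q.2 * \1_A ((q.2 : R * R) + q.1)))%:E.
have mF : measurable_fun setT F.
  apply/measurable_EFinP; apply: measurable_funM.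
    exact: (measurableT_comp (measurable_indic mQ) measurable_fst).
  apply: measurable_funM.
    exact: (measurableT_comp (measurable_indic mA) measurable_snd).
  have := measurableT_comp (measurable_indic mA)
    (measurableT_comp measurable_plane_add (@measurable_swap _ _ (BR * BR)%type (BR * BR)%type)).
  exact.
have F0 q : (0 <= F q)%E by rewrite lee_fin !mulr_ge0.
have lower : ((s ^+ 2 * (m / 2))%:E <= \int[mu]_h \int[mu]_x F (h, x))%E.
  have -> : ((s ^+ 2 * (m / 2))%:E = \int[mu]_h ((m / 2)%:E * (\1_Q h)%:E))%E.
    rewrite ge0_integralZl//; last 2 first.
    - by apply/measurable_EFinP; exact: measurable_indic.
    - by rewrite lee_fin; lra.
    by rewrite integral_indic// setIT [X in (_ * X)%E]muQ -EFinM mulrC.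
  apply: ge0_le_integral => //.
  - by move=> h _; rewrite -EFinM lee_fin mulr_ge0//; lra.
  - by apply: measurable_funeM; apply/measurable_EFinP; exact: measurable_indic.
  - exact: (@measurable_fun_fubini_tonelli_F _ _ _ _ _ mu _ mF).
  - move=> h _; rewrite /F /=; have [Qh|Qh] := pselect (Q h); last first.
      by rewrite indicE memNset// mule0; apply: integral_ge0 => x _; rewrite lee_fin mul0r.
    rewrite [\1_Q h]indicE mem_set// mule1; apply: le_trans (overlap h Qh) _.
    have mI : measurable (A `&` Ah h : set (BR * BR)).
    exact: (measurableI _ _ mA (mAh h)).
    rewrite -[leLHS](_ : (\int[mu]_x (\1_(A `&` Ah h) x)%:E)%E = _); last first.
      by rewrite integral_indic// setIT.
    rewrite le_eqVlt; apply/orP; left; apply/eqP; apply: eq_integral => x _.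
    by rewrite mul1r indicI.
(* With the restriction to [Q] dropped, the inner integral over [h] is at most the area of a
   translate of [A]. *)
have upper : (\int[mu]_x \int[mu]_h F (h, x) <= (m ^+ 2)%:E)%E.
  have -> : ((m ^+ 2)%:E = \int[mu]_x (m%:E * (\1_A x)%:E))%E.
    rewrite ge0_integralZl//; last 2 first.
    - by apply/measurable_EFinP; exact: measurable_indic.
    - by rewrite lee_fin ltW.
    by rewrite integral_indic// setIT [X in (_ * X)%E]mE -EFinM expr2.
  apply: ge0_le_integral => //.
  - by move=> x _; exact: integral_ge0.
  - exact: (@measurable_fun_fubini_tonelli_G _ _ _ _ _ mu _ mF).
  - by apply: measurable_funeM; apply/measurable_EFinP; exact: measurable_indic.
  - move=> x _.
    have mi : measurable_fun setT (fun h : BR * BR => (\1_(Ah x) h : R)%:E).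
      by apply/measurable_EFinP; exact: measurable_indic.
    apply: (@le_trans _ _ (\int[mu]_h ((\1_A x)%:E * (\1_(Ah x) h)%:E))%E).
      apply: ge0_le_integral => //.
      + by apply: measurableT_comp mF (measurable_pair2 x).
      + exact: measurable_funeM.
      + move=> h _; rewrite /F /= -EFinM lee_fin.
        have -> : \1_(Ah x) h = \1_A (x + h) :> R.
          rewrite !indicE /Ah; congr (_%:R); congr nat_of_bool.
          by apply/idP/idP; rewrite !inE /= addrC.
        by rewrite ler_piMl ?mulr_ge0// indicE; case: (_ \in _).
    rewrite ge0_integralZl// integral_indic// setIT.
    by rewrite [X in (_ * X)%E](plane_leb_translate x mA) mE muleC.
have := le_trans lower (le_trans _ upper).
rewrite -(@fubini_tonelli _ _ _ _ _ mu mu F mF F0) => /(_ (lexx _)).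
rewrite lee_fin => key.
(* The two bounds give [s ^+ 2 <= 2 m]; substituting [m = 16 p s] on the left of the goal turns this
   into a bound on [m] alone. *)
have sE : s * (16 * p) = m by rewrite /s divfK// gt_eqF// mulr_gt0.
have k2 : s ^+ 2 <= 2 * m.
  by rewrite -(ler_pM2r m0); move: key; lra.
have k3 : m ^+ 2 <= 512 * p ^+ 2 * m.
  have -> : m ^+ 2 = s ^+ 2 * (256 * p ^+ 2) by rewrite -sE; ring.
  have -> : 512 * p ^+ 2 * m = 2 * m * (256 * p ^+ 2) by ring.
  exact: ler_wpM2r (mulr_ge0 (ler0n _ _) (sqr_ge0 p)) _ _ k2.
by rewrite -(ler_pM2r m0) -expr2.
Qed.

Lemma nonlocal_swap delta : 0 < delta ->
  (nonlocal delta Om = \int[mu]_z \int[mu]_x (jump delta Om x z)%:E)%E.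
Proof.
move=> d0; rewrite (nonlocal_borelE d0 mO).
have mF := measurable_jump d0 mO.
have mF' : measurable_fun setT (fun q : (BR * BR) * (BR * BR) => (jump delta Om q.1 q.2)%:E).
  exact/measurable_EFinP.
have F0 q : (0 <= (fun q : (BR * BR) * (BR * BR) => (jump delta Om q.1 q.2)%:E) q)%E.
  by rewrite lee_fin jump_ge0.
exact: (@fubini_tonelli _ _ _ _ _ mu mu _ mF' F0).
Qed.

Lemma integral_jump delta z :
  (\int[mu]_x (jump delta Om x z)%:E = (jump_kernel delta z)%:E * mu (shift_diff Om z))%E.
Proof.
have mS := measurable_shift_diff z mO.
rewrite -[X in (_ * X)%E](_ : (\int[mu]_x (\1_(shift_diff Om z) x)%:E)%E = _); last first.
  by rewrite integral_indic// setIT.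
rewrite -ge0_integralZl//; last 2 first.
- by apply/measurable_EFinP; exact: measurable_indic.
- by rewrite lee_fin jump_kernel_ge0.
apply: eq_integral => x _; rewrite -EFinM /jump mulrC; congr (_ * _)%:E.
have -> : \1_(shift_diff Om z) x = (\1_Om (x + z) != \1_Om x :> R)%:R :> R.
  by rewrite indicE; congr (_%:R); congr nat_of_bool; apply/idP/idP; rewrite inE.
rewrite !indicE; case: (x \in Om); case: (x + z \in Om); rewrite /= ?eqxx ?subrr ?normr0 ?expr0n//.
  by rewrite sub0r normrN normr1 expr1n eq_sym oner_eq0.
by rewrite subr0 normr1 expr1n oner_eq0.
Qed.

Lemma nonlocal_lty delta : 0 < delta -> (nonlocal delta Om < +oo)%E.
Proof.
move=> d0; rewrite (nonlocal_swap d0).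
have c0 : 0 <= 512 * p ^+ 2 := mulr_ge0 (ler0n _ _) (sqr_ge0 p).
set c := 512 * p ^+ 2 in c0 *.
have mk : measurable_fun setT (fun z : BR * BR => (jump_kernel delta z)%:E).
  by apply/measurable_EFinP; exact: measurable_jump_kernel.
have mF' : measurable_fun setT (fun q : (BR * BR) * (BR * BR) => (jump delta Om q.1 q.2)%:E).
  by apply/measurable_EFinP; exact: measurable_jump.
have F0 q : (0 <= (fun q : (BR * BR) * (BR * BR) => (jump delta Om q.1 q.2)%:E) q)%E.
  by rewrite lee_fin jump_ge0.
have mG := @measurable_fun_fubini_tonelli_G _ _ _ _ _ mu _ mF' F0.
apply: (@le_lt_trans _ _ (\int[mu]_z (c%:E * (jump_kernel delta z)%:E))%E).
  refine (@ge0_le_integral _ _ _ mu setT measurableT _ _ _ mG _ _).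
  - by move=> z _; apply: integral_ge0 => x _; rewrite lee_fin jump_ge0.
  - exact: measurable_funeM.
  - move=> z _; rewrite /fubini_G /= integral_jump muleC lee_wpmul2r//.
      by rewrite lee_fin jump_kernel_ge0.
    by have := shift_diff_uniform z.
rewrite ge0_integralZl//; last by move=> z _; rewrite lee_fin jump_kernel_ge0.
rewrite lte_mul_pinfty//; exact: jump_kernel_integral_lty.
Qed.

End bounds.
End finite_nonlocal.

(** * Cutting out a disk *)

Section splitting.
Context {R : realType}.
Local Notation BR := (measurableTypeR R).
Local Notation mu := (@plane_leb R).
Implicit Types (Om : set (R * R)) (z : R * R).

Lemma shift_diffE Om z x : (x \in shift_diff Om z) = ((x + z \in Om) != (x \in Om)).
Proof.
have -> : (x \in shift_diff Om z) = (\1_Om (x + z) != \1_Om x :> R).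
  by apply/idP/idP; rewrite inE.
rewrite !indicE; case: (x \in Om); case: (x + z \in Om); rewrite /= ?eqxx//.
  by rewrite eq_sym oner_eq0.
by rewrite oner_eq0.
Qed.

Lemma indic_shift_diff Om z x :
  \1_(shift_diff Om z) x = ((x + z \in Om) != (x \in Om))%:R :> R.
Proof. by rewrite indicE shift_diffE. Qed.

(** Integration of a pointwise inequality between indicators. Pairs leaving the disk and pairs
    entering it form two disjoint lunes of equal lower bound; each point of them is gained twice,
    whence the factor 4. *)
Lemma shift_diff_split Om rho z : 0 < rho -> enorm z <= rho ->
  measurable (Om : set (BR * BR)) -> disk 0 (2 * rho) `<=` Om ->
  (mu (shift_diff Om z) + (4 * (enorm z * (2 * rho - enorm z)))%:E <=
   mu (shift_diff (Om `\` disk 0%R rho) z) + mu (shift_diff (disk 0%R rho) z))%E.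
Proof.
move=> r0 zr mO dO.
set B : set (R * R) := disk 0 rho.
have mB : measurable (B : set (BR * BR)) by exact: measurable_disk.
have mA : measurable (Om `\` B : set (BR * BR)) by exact: measurableD.
(* The pairs that enter the disk: [x + z] plays the role of the inner point, so the lune is the one
   for [- z], translated. *)
pose S2 : set (BR * BR) := (fun x => x + z) @^-1` (lune rho (- z)).
have mS1 : measurable (lune rho z : set (BR * BR)) by exact: measurable_lune.
have mS2 : measurable S2.
  by rewrite -[S2]setTI; apply: measurable_translate => //; exact: measurable_lune.
have zr2 : enorm z <= 2 * rho by lra.
have b1 := lune_ge zr2.
have b2 : ((enorm z * (2 * rho - enorm z))%:E <= mu S2)%E.
  rewrite (plane_leb_translate z (measurable_lune rho (- z))).
  have nz : enorm (- z) = enorm z by rewrite /enorm /= !sqrrN.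
  by rewrite -nz; apply: lune_ge; rewrite nz.
have mi (E : set (BR * BR)) : measurable E ->
    measurable_fun setT (fun x : BR * BR => (\1_E x : R)%:E).
  by move=> mE; apply/measurable_EFinP; exact: measurable_indic.
have iE (E : set (BR * BR)) : measurable E -> (\int[mu]_x (\1_E x : R)%:E = mu E)%E.
  by move=> mE; rewrite integral_indic// setIT.
have mO' := measurable_shift_diff z mO.
have mA' := measurable_shift_diff z mA.
have mB' := measurable_shift_diff z mB.
apply: (@le_trans _ _ (mu (shift_diff Om z) + (2%:E * mu (lune rho z) + 2%:E * mu S2))%E).
  rewrite leeD2l//; apply: (@le_trans _ _ (2%:E * (enorm z * (2 * rho - enorm z))%:E +
    2%:E * (enorm z * (2 * rho - enorm z))%:E)%E).
    by rewrite -EFinM -EFinD lee_fin; lra.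
  have h2 : (0 <= 2%:E :> \bar R)%E by rewrite lee_fin.
  exact: (leeD (lee_wpmul2l h2 b1) (lee_wpmul2l h2 b2)).
rewrite -(iE _ mO') -(iE _ mS1) -(iE _ mS2) -(iE _ mA') -(iE _ mB').
rewrite -!ge0_integralZl//; try exact: mi.
rewrite -!ge0_integralD//; try exact: mi; try exact: (measurable_funeM _ (mi _ _)); last 2 first.
- by move=> x _; rewrite -!EFinM -!EFinD lee_fin addr_ge0// mulr_ge0.
- by apply: emeasurable_funD; apply: measurable_funeM; exact: mi.
apply: ge0_le_integral => //.
- by move=> x _; rewrite -!EFinM -!EFinD lee_fin !addr_ge0// ?mulr_ge0.
- apply: emeasurable_funD; first exact: mi.
  by apply: emeasurable_funD; apply: measurable_funeM; exact: mi.
- by apply: emeasurable_funD; exact: mi.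
move=> x _; rewrite -!EFinM -!EFinD lee_fin !indic_shift_diff.
(* By [|y + w|^2 <= 2 |y|^2 + 2 |w|^2]. This is where [Om] has to contain the disk of twice the
   radius. *)
have nD (y w : R * R) : enorm w <= rho -> B y -> Om (y + w).
  move=> wr /(disk0E _ r0) yr; apply: dO; apply/disk0E; first by lra.
  have w2 : w.1 ^+ 2 + w.2 ^+ 2 <= rho ^+ 2.
    rewrite -(sqr_sqrtr (addr_ge0 (sqr_ge0 w.1) (sqr_ge0 w.2))) -/(enorm w).
    by rewrite lerXn2r// nnegrE ?enorm_ge0// ltW.
  have /= := sqr_ge0 (y.1 - w.1); have /= := sqr_ge0 (y.2 - w.2).
  by move: yr w2; lra.
have -> : \1_(lune rho z) x = ((x \in B) && (x + z \notin B))%:R :> R.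
  rewrite indicE; congr (_%:R); congr nat_of_bool.
  by rewrite /lune in_setI; congr (_ && _); apply/idP/idP; rewrite ?notin_setE inE.
have -> : \1_S2 x = ((x + z \in B) && (x \notin B))%:R :> R.
  rewrite indicE; congr (_%:R); congr nat_of_bool.
  have -> : (x \in S2) = (x + z \in lune rho (- z)) by apply/idP/idP; rewrite !inE.
  rewrite /lune in_setI; congr (_ && _).
  by apply/idP/idP; rewrite ?notin_setE inE /= addrK.
rewrite !in_setD.
have oB : x \in B -> x \in Om /\ x + z \in Om.
  rewrite !inE => xB; split; last exact: nD.
  by rewrite -[x]addr0; apply: nD => //; rewrite /enorm /= expr0n addr0 sqrtr0 ltW.
have oB' : x + z \in B -> x \in Om /\ x + z \in Om.
  rewrite !inE => xB; split.
    rewrite -[x](addrK z); apply: nD => //.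
    by rewrite /enorm /= !sqrrN.
  by rewrite -[x + z]addr0; apply: nD => //; rewrite /enorm /= expr0n addr0 sqrtr0 ltW.
move: oB oB'; case: (x \in B); case: (x + z \in B) => /=.
- by move=> /(_ isT)[-> ->] _; rewrite /=; lra.
- by move=> /(_ isT)[-> ->] _; rewrite /=; lra.
- by move=> _ /(_ isT)[-> ->]; rewrite /=; lra.
- by move=> _ _; rewrite !andbT; lra.
Qed.

(** After exchanging the integrals the kernel multiplies the area of the shift difference, so the
    inequality is proved for each [z]: with the lune gain on the annulus, by subadditivity
    elsewhere. *)
Lemma nonlocal_split Om rho delta : 0 < delta -> 2 * delta < rho ->
  measurable (Om : set (BR * BR)) -> disk 0 (2 * rho) `<=` Om ->
  (nonlocal delta Om + (4 * (2 * pi * rho * (2 * ln (rho / (2 * delta)) - 3)))%:E <=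
   nonlocal delta (Om `\` disk 0%R rho) + nonlocal delta (disk 0%R rho))%E.
Proof.
move=> d0 dr mO dO; have r0 : 0 < rho by lra.
have d20 : 0 < 2 * delta by lra.
have mB : measurable (disk 0 rho : set (BR * BR)) by exact: measurable_disk.
have mA : measurable (Om `\` disk 0 rho : set (BR * BR)) by exact: measurableD.
have mann : measurable (disk 0 rho `\` disk 0 (2 * delta) : set (BR * BR)).
  by apply: measurableD; exact: measurable_disk.
pose ann : set (BR * BR) := disk 0 rho `\` disk 0 (2 * delta).
pose g (z : BR * BR) : \bar R := ((fun z => (radial_bound rho z)%:E) \_ ann) z.
have g0 z : (0 <= g z)%E.
  rewrite /g patchE; case: ifPn => //; rewrite inE => -[/diskE zr _].
  by rewrite lee_fin divr_ge0 ?sqr_ge0//; lra.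
have mg : measurable_fun setT g.
  apply/(measurable_restrictT _ mann); apply/measurable_EFinP.
  exact: (@measurable_radial_bound _ rho _ d20).
have mG (E : set (BR * BR)) : measurable E ->
    measurable_fun setT (fun z => \int[mu]_x (jump delta E x z)%:E)%E.
  move=> mE.
  have mF' : measurable_fun setT (fun q : (BR * BR) * (BR * BR) => (jump delta E q.1 q.2)%:E).
    by apply/measurable_EFinP; exact: measurable_jump.
  have F0 q : (0 <= (fun q : (BR * BR) * (BR * BR) => (jump delta E q.1 q.2)%:E) q)%E.
    by rewrite lee_fin jump_ge0.
  exact: (@measurable_fun_fubini_tonelli_G _ _ _ _ _ mu _ mF' F0).
have G0 (E : set (BR * BR)) z : (0 <= \int[mu]_x (jump delta E x z)%:E)%E.
  by apply: integral_ge0 => x _; rewrite lee_fin jump_ge0.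
have J := radial_bound_integral d20 dr.
rewrite integral_mkcond in J.
have c4 : (0 <= 4%:E :> \bar R)%E by rewrite lee_fin.
apply: (@le_trans _ _ (nonlocal delta Om + 4%:E * \int[mu]_z g z)%E).
  by rewrite leeD2l// EFinM; exact: (lee_wpmul2l c4 J).
rewrite (nonlocal_swap mO d0) (nonlocal_swap mA d0) (nonlocal_swap mB d0).
have mg4 := measurable_funeM 4%:E mg.
have g40 z : (0 <= 4%:E * g z)%E by exact: mule_ge0.
rewrite -(ge0_integralZl mu measurableT mg (fun z _ => g0 z) c4).
rewrite -(ge0_integralD mu measurableT (fun z _ => G0 Om z) (mG _ mO) (fun z _ => g40 z) mg4).
rewrite -(ge0_integralD mu measurableT (fun z _ => G0 _ z) (mG _ mA) (fun z _ => G0 _ z) (mG _ mB)).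
refine (@ge0_le_integral _ _ _ mu setT measurableT _ _ _ _ _ _).
- by move=> z _; exact: adde_ge0.
- exact: emeasurable_funD (mG _ mO) mg4.
- exact: emeasurable_funD (mG _ mA) (mG _ mB).
move=> z _; rewrite (integral_jump mO) (integral_jump mA) (integral_jump mB).
have k0 : (0 <= (jump_kernel delta z)%:E)%E by rewrite lee_fin jump_kernel_ge0.
rewrite -(ge0_muleDr _ (measure_ge0 mu _) (measure_ge0 mu _)).
rewrite /g patchE; case: ifPn => [|nz].
  rewrite inE => -[/diskE zr /diskE/negP]; rewrite -leNgt => zd.
  have zr' : enorm z <= rho by exact: ltW.
  have H := shift_diff_split r0 zr' mO dO.
  apply: le_trans (lee_wpmul2l k0 H).
  have h0 : (0 <= (4 * (enorm z * (2 * rho - enorm z)))%:E :> \bar R)%E.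
    by rewrite lee_fin mulr_ge0// mulr_ge0 ?enorm_ge0//; lra.
  rewrite (ge0_muleDr _ (measure_ge0 mu _) h0).
  rewrite leeD2l// -!EFinM lee_fin jump_kernelE//.
  (* The inner radius [2 delta] puts the whole annulus strictly beyond the cutoff, boundary circle
     included. *)
  have -> : delta < enorm z by lra.
  rewrite /radial_bound le_eqVlt; apply/orP; left; apply/eqP.
  by field; rewrite gt_eqF//; lra.
(* Off the annulus nothing is gained: a pair separated by [Om] is separated by one of its two
   parts. *)
rewrite mule0 adde0; apply: (lee_wpmul2l k0).
have mSA := measurable_shift_diff z mA; have mSB := measurable_shift_diff z mB.
apply: le_trans (measureU2 mu mSA mSB) => //.
apply: le_measure; rewrite ?inE.
- exact: measurable_shift_diff.
- exact: measurableU.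
move=> x /mem_set; rewrite shift_diffE => h; apply/set_mem.
rewrite in_setU !shift_diffE !in_setD.
have sub y : y \in disk 0 rho -> y \in Om.
  rewrite !inE => /diskE yr; apply: dO; apply/diskE; lra.
move: (sub x) (sub (x + z)) h.
case: (x \in Om); case: (x + z \in Om); case: (x \in disk 0 rho);
  case: (x + z \in disk 0 rho) => //=; by [move=> /(_ isT)|move=> _ /(_ isT)].
Qed.

End splitting.

(** * Energy comparison and conclusion *)

Section cutting.
Context {R : realType}.
Local Notation BR := (measurableTypeR R).
Implicit Types (Om : set (R * R)).

Lemma energy_null_eq lambda delta (A B : set (BR * BR)) : 0 < delta ->
  lmeasurable A -> measurable B -> A `<=` B -> leb2 R (B `\` A) = 0%E ->
  energy lambda delta A = energy lambda delta B.
Proof.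
move=> d0 mA mB AB BA0; rewrite /energy (nonlocal_null_eq d0 mB AB BA0).
by rewrite (perimeter_null_eq mA (borel_lmeasurable mB) AB BA0).
Qed.

Lemma leb2_setD (A B : set (R * R)) : lmeasurable A -> lmeasurable B -> B `<=` A ->
  leb2 R A = (leb2 R (A `\` B) + leb2 R B)%E.
Proof.
move=> mA mB BA; rewrite (measureDI (leb2 R) mA mB); congr (_ + leb2 R _)%E.
exact: setIidr.
Qed.

Lemma ge0_lty_EFin (x : \bar R) : (0 <= x)%E -> (x < +oo)%E ->
  exists2 a : R, 0 <= a & x = a%:E.
Proof. by move: x => [a| |]//=; rewrite lee_fin => a0 _; exists a. Qed.

Lemma nonlocal_ge0 delta Om : 0 < delta -> measurable (Om : set (BR * BR)) ->
  (0 <= nonlocal delta Om)%E.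
Proof.
move=> d0 mO; rewrite (nonlocal_borelE d0 mO); apply: integral_ge0 => x _.
by apply: integral_ge0 => z _; rewrite lee_fin jump_ge0.
Qed.

Lemma nonlocal_fin delta Om : 0 < delta -> measurable (Om : set (BR * BR)) ->
  (perimeter Om < +oo)%E -> exists a : R, nonlocal delta Om = a%:E.
Proof.
move=> d0 mO Ofin; have [p p0 pE] := ge0_lty_EFin (perimeter_ge0 Om) Ofin.
have p1 : 0 < p + 1 by lra.
have Op : (perimeter Om <= (p + 1)%:E)%E by rewrite pE lee_fin; lra.
have [a _ ->] := ge0_lty_EFin (nonlocal_ge0 d0 mO) (nonlocal_lty mO p1 Op d0).
by exists a.
Qed.

(** With [q = 2 pi rho] the perimeter grows by at most [2 q], while the nonlocal term, weighted by
    [k], grows by at least [4 k q L]; the hypothesis relating [|ln delta|] and [lambda] says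
    precisely that [2 k L > 1]. *)
Lemma energy_cut Om lambda rho delta : 0 < lambda -> 0 < delta -> 2 * delta < rho ->
  0 < `|ln delta| -> 2 * `|ln delta| < lambda * (2 * ln (rho / (2 * delta)) - 3) ->
  measurable (Om : set (BR * BR)) -> (perimeter Om < +oo)%E ->
  disk 0 (2 * rho) `<=` Om ->
  (perimeter (Om `\` disk 0%R rho) < +oo)%E /\
  (energy lambda delta (Om `\` disk 0%R rho) + energy lambda delta (disk 0%R rho)
    < energy lambda delta Om)%E.
Proof.
move=> l0 d0 dr ln0 ldr mO Ofin dO; have r0 : 0 < rho by lra.
have mB : measurable (disk 0 rho : set (BR * BR)) by exact: measurable_disk.
have mA : measurable (Om `\` disk 0 rho : set (BR * BR)) by exact: measurableD.
have BO : disk 0 rho `<=` Om by apply: subset_trans dO; apply: subset_disk; lra.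
have pB := perimeter_disk r0.
have pA := perimeter_setD (borel_lmeasurable mO) (borel_lmeasurable mB) BO.
have Bfin : (perimeter (disk 0%R rho) < +oo)%E by exact: le_lt_trans pB (ltry _).
have Afin : (perimeter (Om `\` disk 0%R rho) < +oo)%E.
  by apply: le_lt_trans pA _; exact: lte_add_pinfty.
split => //.
(* All six perimeters and nonlocal terms are finite, so the energies are genuine real differences
   and a strict inequality makes sense. *)
have [PO _ POE] := ge0_lty_EFin (perimeter_ge0 _) Ofin.
have [PA _ PAE] := ge0_lty_EFin (perimeter_ge0 _) Afin.
have [PB _ PBE] := ge0_lty_EFin (perimeter_ge0 _) Bfin.
have [NO NOE] := nonlocal_fin d0 mO Ofin.
have [NA NAE] := nonlocal_fin d0 mA Afin.
have [NB NBE] := nonlocal_fin d0 mB Bfin.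
have nl := nonlocal_split d0 dr mO dO.
rewrite POE PAE PBE -!EFinD lee_fin in pA; rewrite PBE lee_fin in pB.
rewrite NOE NAE NBE -!EFinD lee_fin in nl.
rewrite /energy POE PAE PBE NOE NAE NBE -!EFinM -!EFinB -!EFinD lte_fin.
set k := lambda / (4 * `|ln delta|).
have k0 : 0 < k by rewrite divr_gt0//; lra.
set L := 2 * ln (rho / (2 * delta)) - 3 in ldr nl *.
have kL : 1 < 2 * k * L.
  have -> : 2 * k * L = (lambda * L) / (2 * `|ln delta|).
    by rewrite /k; field; rewrite gt_eqF.
  by rewrite ltr_pdivlMr ?mul1r//; lra.
have pr0 : 0 < 2 * pi * rho by rewrite !mulr_gt0// pi_gt0.
have := ler_wpM2l (ltW k0) nl.
have := ltr_pM2l pr0 1 (2 * k * L); rewrite kL mulr1.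
set q := 2 * pi * rho in pB *.
by move=> h1 h2; nra.
Qed.

(** A single null modification makes the set Borel and lets it contain the disk exactly rather than
    almost everywhere, as the pointwise cutting argument requires. *)
Lemma borel_saturation Om r : lmeasurable Om -> leb2 R (disk 0%R r `\` Om) = 0%E ->
  exists G : set (BR * BR), [/\ measurable G, Om `<=` G, disk 0 r `<=` G
    & leb2 R (G `\` Om) = 0%E].
Proof.
move=> mO dO0; have [F [mF OF FO0]] := borel_hull mO.
have mD := measurable_disk r.
exists (F `|` disk 0 r); split; first exact: measurableU.
- exact: subset_trans OF (@subsetUl _ _ _).
- exact: subsetUr.
have m1 := measurableD (borel_lmeasurable mF : measurable (F : set (Leb2 R))) mO.
have m2 := measurableD (borel_lmeasurable mD : measurable (_ : set (Leb2 R))) mO.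
have E : (F `|` disk 0 r) `\` Om = (F `\` Om) `|` (disk 0 r `\` Om) by exact: setDUl.
have h : (leb2 R ((F `\` Om) `|` (disk 0%R r `\` Om)) <=
    leb2 R (F `\` Om) + leb2 R (disk 0%R r `\` Om))%E by exact: (measureU2 (leb2 R) m1 m2).
by apply/eqP; rewrite eq_le measure_ge0 andbT E (le_trans h)// FO0 dO0 adde0.
Qed.

(** The exponent is [1 - 1 / lambda], so division by [delta] leaves [delta] to the power
    [- 1 / lambda]. *)
Lemma ln_radius_ratio (lambda delta : R) : 0 < lambda -> 0 < delta ->
  ln (2 * expR 2 * delta `^ ((lambda - 1) / lambda) / (2 * delta)) =
  2 - ln delta / lambda.
Proof.
move=> l0 d0.
have pw : 0 < delta `^ ((lambda - 1) / lambda) by exact: powR_gt0.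
have -> : 2 * expR 2 * delta `^ ((lambda - 1) / lambda) / (2 * delta) =
    expR 2 * delta `^ ((lambda - 1) / lambda) / delta.
  by field; rewrite gt_eqF.
rewrite ln_div ?posrE ?mulr_gt0 ?expR_gt0// lnM ?posrE ?expR_gt0// expRK ln_powR.
by field; rewrite gt_eqF.
Qed.

End cutting.

Theorem proposition2p9 (R : realType) :
  exists C : R, 0 < C /\
    forall lambda : R, 1 < lambda ->
    exists delta0 : R, 0 < delta0 /\
      forall delta : R, 0 < delta -> delta < 1 / 2 -> delta < delta0 ->
      forall (Omega : set (R * R)) (r : R),
        finite_perimeter Omega ->
        C * delta `^ ((lambda - 1) / lambda) <= r ->
        leb2 R (disk 0%R r `\` Omega) = 0%E ->
        exists (Omega' : set (R * R)) (r' : R),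
          [/\ finite_perimeter Omega',
              0 < r',
              leb2 R Omega = (leb2 R Omega' + leb2 R (disk 0%R r'))%E
            & (energy lambda delta Omega' + energy lambda delta (disk 0%R r')
               < energy lambda delta Omega)%E].
Proof.
(* Twice the constant in [rho], because the given disk has to contain the one of radius [2 rho]. *)
exists (4 * expR 2); split; first by rewrite mulr_gt0 ?expR_gt0.
move=> lambda l1; exists 1; split=> // delta d0 d12 _ Omega r [mOm pOm] Cr OmD.
have l0 : 0 < lambda by lra.
pose rho := 2 * expR 2 * delta `^ ((lambda - 1) / lambda).
have r0 : 0 < rho by rewrite !mulr_gt0 ?expR_gt0// powR_gt0.
have rr : 2 * rho <= r by apply: le_trans Cr; rewrite /rho; lra.
have [G [mG OG DG G0]] := borel_saturation mOm OmD.
have lnd : ln delta < 0 by rewrite ln_lt0// d0; lra.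
have nln : `|ln delta| = - ln delta by rewrite ltr0_norm.
have Lr := ln_radius_ratio l0 d0; rewrite -/rho in Lr.
have t0 : 0 < - (ln delta / lambda) by rewrite -mulNr divr_gt0//; lra.
have dr : 2 * delta < rho.
  have d20 : 0 < 2 * delta by lra.
  rewrite -[2 * delta]mul1r -ltr_pdivlMr// -ltr_ln ?posrE ?divr_gt0// ln1 Lr; lra.
have mB : lmeasurable (disk 0 rho : set (R * R)).
  exact: borel_lmeasurable (measurable_disk rho).
have mGl := borel_lmeasurable mG.
have dG : disk 0 (2 * rho) `<=` G by apply: subset_trans DG; exact: subset_disk.
have BG : disk 0 rho `<=` G by apply: subset_trans dG; apply: subset_disk; lra.
have pG : (perimeter G < +oo)%E by rewrite -(perimeter_null_eq mOm mGl OG G0).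
have ln0 : 0 < `|ln delta| by rewrite nln; lra.
(* The terms in [|ln delta|] cancel; the [e^2] in the radius contributes [2 * 2 - 3 = 1], which
   leaves the margin [lambda]. *)
have ldr : 2 * `|ln delta| < lambda * (2 * ln (rho / (2 * delta)) - 3).
  rewrite Lr nln.
  have -> : lambda * (2 * (2 - ln delta / lambda) - 3) = lambda - 2 * ln delta.
    by field; rewrite gt_eqF.
  by lra.
have [pA En] := energy_cut l0 d0 dr ln0 ldr mG pG dG.
exists (G `\` disk 0 rho), rho; split; last 1 first.
- rewrite (energy_null_eq lambda d0 mOm mG OG G0); exact: En.
- split; last exact: pA.
  exact: (measurableD (mGl : measurable (_ : set (Leb2 R))) mB).
- exact: r0.
- rewrite -(leb2_setD mGl mB BG) (leb2_setD mGl mOm OG).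
  rewrite G0; exact: esym (add0e _).
Qed.
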